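(* Let $K$ be algebraically closed, $n\ge2$, $\operatorname{char}(K)\nmid n$ (characteristic $0$ allowed). Let $l=x_1+\dots+x_n$ and $b_i=x_i-x_{i+1}$ for $1\le i\le n-1$, so that every $f\in K[x_1,\dots,x_n]_d$ can be uniquely written as $f=\sum_{i=0}^d l^ip_i$ with each $p_i$ a homogeneous polynomial of degree $d-i$ in $b_1,\dots,b_{n-1}$. Let $0\neq f\in K[x_1,\dots,x_n]_d^{S_n}$ be symmetric, with $O_f$ its orbit under the natural action of $\operatorname{SL}_n$. Then: (i) $f$ is unstable if and only if either $l^{\lfloor d/n\rfloor+1}$ divides $f$, or $f=\sum_{i=0}^{\lceil d/n\rceil-1}l^ip_i$. (ii) If $f$ is not unstable, then $f$ fails to be polystable if and only if all of the following hold: $n\mid d$; $l^{d/n}p_{d/n}\notin O_f$; and either $l^{d/n}$ divides $f$ or $f=\sum_{i=0}^{d/n}l^ip_i$.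
   Context: Unstable: $0\in\overline{O_f}$; polystable: $f\neq0$ and $O_f$ Zariski closed. *)

(* Defs.v *)
From HB Require Import structures.
From mathcomp Require Import all_boot all_order all_algebra.
From mathcomp Require Import mpoly.
Set Implicit Arguments.
Unset Strict Implicit.
Unset Printing Implicit Defensive.
Import Order.TTheory GRing.Theory.
Local Open Scope ring_scope.

Section Defs.
Variables (K : fieldType) (n : nat).

(* x_{i+1} as a polynomial (0-based index i); 0 if i >= n (never used so) *)
Definition xvar (i : nat) : {mpoly K[n]} :=
  if @insub _ (fun j => j < n)%N 'I_n i is Some j then 'X_j else 0.

Definition lform : {mpoly K[n]} := \sum_(i < n) 'X_i.

Definition bvec : (n.-1).-tuple {mpoly K[n]} :=
  [tuple xvar i - xvar i.+1 | i < n.-1].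

Definition sl_act (A : 'M[K]_n) (f : {mpoly K[n]}) : {mpoly K[n]} :=
  f \mPo [tuple \sum_(j < n) A i j *: 'X_j | i < n].

Definition sl_orbit (f g : {mpoly K[n]}) : Prop :=
  exists A : 'M[K]_n, \det A = 1 /\ g = sl_act A f.

Definition polyfun (F : {mpoly K[n]} -> K) : Prop :=
  exists (k : nat) (ms : k.-tuple 'X_{1..n}) (P : {mpoly K[k]}),
    forall g, F g = P.@[fun i => g@_(tnth ms i)].

(* Zariski closure (for the topology whose closed sets are common zero sets
   of polynomial functions in the coefficients; restricted to the space of
   degree-d forms this is the usual Zariski topology) *)
Definition zclosure (S : {mpoly K[n]} -> Prop) (g : {mpoly K[n]}) : Prop :=
  forall F, polyfun F -> (forall h, S h -> F h = 0) -> F g = 0.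

Definition f_unstable (f : {mpoly K[n]}) : Prop := zclosure (sl_orbit f) 0.

Definition f_polystable (f : {mpoly K[n]}) : Prop :=
  f != 0 /\ (forall g, zclosure (sl_orbit f) g -> sl_orbit f g).

Definition ldiv (k : nat) (f : {mpoly K[n]}) : Prop :=
  exists g : {mpoly K[n]}, f = lform ^+ k * g.

End Defs.

Definition ceil_div (d n : nat) : nat := ((d + n.-1) %/ n)%N.

Arguments sl_act {K n}.
Arguments sl_orbit {K n}.
Arguments polyfun {K n}.
Arguments zclosure {K n}.
Arguments f_unstable {K n}.
Arguments f_polystable {K n}.
Arguments ldiv {K n}.

(* Main.v *)
(* A point [g] of the closure of [O_f] is the reduction of [A f], [A] the generic matrix of
   [SL_n], along a place of the function field of [GL_n].  Diagonalizing [A] over the valuation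
   ring of the place, and replacing the valuation by integer weights through a theorem of the
   alternative, gives a weighted basis of linear forms for which [f] has nonnegative weights,
   while a given polynomial function that vanishes at [g] but not on [O_f] has positive ones.
   The sum of squares of the weights is strictly convex on the apartment of any two weighted
   bases (Bruhat), so, as in Kempf's theorem, for symmetric [f] a nearly shortest one is nearly
   invariant under [S_n].  As [char K] does not divide [n], such a filtration of the linear
   forms only involves the line of [l] and the span of the [b_i]: up to sign it is the
   one-parameter subgroup of weights [-(n-1)] on [l] and [1] on each [b_i], on whose
   eigenvectors [l^i p_i] it has weight [d - n i].  Hence the [p_i <> 0] all have [n i <= d] or
   all have [n i >= d], and [f] tends to [l^(d/n) p_(d/n)], or to [0] if [d/n] is not an
   integer.  For (i) take [g = 0]; for
   (ii) take [g] in the closure outside [O_f], orbits being open in their closure. *)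
Require Import Defs.
From HB Require Import structures.
From mathcomp Require Import all_boot all_order all_algebra all_fingroup.
From mathcomp Require Import closed_field lra zify mpoly.
From mathcomp Require boolp classical_sets.
Set Implicit Arguments.
Unset Strict Implicit.
Unset Printing Implicit Defensive.
Import Order.TTheory GRing.Theory Num.Theory.
Local Open Scope ring_scope.

(** * Linear substitutions and weights *)

(** The zero weights give the shortest filtration of all, so minimizing the norm under nonnegativity
    on [f] alone would yield nothing. What excludes them is the polynomial function: weight at least
    1 on it, expressed through [Phi], forces nonzero weights, and like the condition on [f] it
    survives midpoints and compatible changes of basis. Permutation matrices may have determinant
    [-1] and so leave [SL_n]. Hence the function is asked to vanish on the translates of [g] by all
    matrices of determinant 1 or [-1], and [Phi] carries a sign [eps]. A minimum over infinitely
    many bases is not known to be attained. A nearly minimal one is used instead, with explicit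
    errors, which the integrality of the weights of the final one-parameter subgroup absorbs. A
    place is a subring of [F * K], its elements being paired with their residues: a matrix or a form
    over this ring is a generic object together with its reduction, and ring identities project to
    both factors. For this reason [act], [phi] and [Phi] are defined over any commutative ring. *)

HB.lock Definition act (n : nat) (R : comNzRingType) (A : 'M[R]_n) (f : {mpoly R[n]}) :
  {mpoly R[n]} := f \mPo [tuple \sum_(j < n) A i j *: 'X_j | i < n].
Arguments act {n R} A f.

Section Act.
Variable n : nat.

Lemma actE (R : comNzRingType) (A : 'M[R]_n) f :
  act A f = f \mPo [tuple \sum_(j < n) A i j *: 'X_j | i < n].
Proof. by rewrite act.unlock. Qed.

Lemma act_zmod_morphism (R : comNzRingType) (A : 'M[R]_n) : zmod_morphism (act A).
Proof. by move=> f g; rewrite !actE rmorphB. Qed.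

Lemma act_monoid_morphism (R : comNzRingType) (A : 'M[R]_n) : monoid_morphism (act A).
Proof. by split=> [|f g]; rewrite !actE ?rmorph1 ?rmorphM. Qed.

HB.instance Definition _ (R : comNzRingType) (A : 'M[R]_n) :=
  GRing.isZmodMorphism.Build {mpoly R[n]} {mpoly R[n]} (act A) (act_zmod_morphism A).
HB.instance Definition _ (R : comNzRingType) (A : 'M[R]_n) :=
  GRing.isMonoidMorphism.Build {mpoly R[n]} {mpoly R[n]} (act A) (act_monoid_morphism A).

Lemma actC (R : comNzRingType) (A : 'M[R]_n) c : act A c%:MP = c%:MP.
Proof. by rewrite actE comp_mpolyC. Qed.

Lemma actZ (R : comNzRingType) (A : 'M[R]_n) c f : act A (c *: f) = c *: act A f.
Proof. by rewrite !actE comp_mpolyZ. Qed.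

Lemma actX (R : comNzRingType) (A : 'M[R]_n) i : act A 'X_i = \sum_j A i j *: 'X_j.
Proof. by rewrite actE comp_mpolyXU -tnth_nth tnth_mktuple. Qed.

Lemma mpoly_morph_eq (k : nat) (R : nzRingType) (S : comNzRingType)
    (u v : {rmorphism {mpoly R[k]} -> S}) :
  (forall c, u c%:MP = v c%:MP) -> (forall i, u 'X_i = v 'X_i) -> u =1 v.
Proof.
move=> uvC uvX f; rewrite (mpolyE f) !rmorph_sum /=; apply: eq_bigr => m _.
rewrite -mul_mpolyC !rmorphM /= uvC; congr (_ * _).
rewrite mpolyXE_id !rmorph_prod; apply: eq_bigr => i _.
by rewrite !rmorphXn /= uvX.
Qed.

Lemma act_comp (R : comNzRingType) (A B : 'M[R]_n) f :
  act B (act A f) = act (A *m B) f.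
Proof.
have /= := @mpoly_morph_eq _ _ _ (act B \o act A) (act (A *m B)).
apply=> [c|i] /=; first by rewrite !actC.
rewrite !actX rmorph_sum /=.
under eq_bigr do rewrite actZ actX scaler_sumr.
rewrite exchange_big; apply: eq_bigr => j _ /=.
rewrite mxE scaler_suml; apply: eq_bigr => l _.
by rewrite scalerA.
Qed.

Lemma act1 (R : comNzRingType) (f : {mpoly R[n]}) : act 1%:M f = f.
Proof.
rewrite actE -[RHS]comp_mpoly_id; congr (_ \mPo _); apply/eq_from_tnth => i.
rewrite !tnth_mktuple (bigD1 i) //= big1 ?addr0 => [|j ji].
  by rewrite mxE eqxx scale1r.
by rewrite mxE eq_sym (negPf ji) scale0r.
Qed.

Lemma map_act (R S : comNzRingType) (u : {rmorphism R -> S}) (A : 'M[R]_n) f :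
  map_mpoly u (act A f) = act (map_mx u A) (map_mpoly u f).
Proof.
have /= := @mpoly_morph_eq _ _ _ (map_mpoly u \o act A) (act (map_mx u A) \o map_mpoly u).
apply=> [c|i] /=; first by rewrite actC !map_mpolyC /= actC.
rewrite map_mpolyX !actX rmorph_sum /=.
by apply: eq_bigr => j _; rewrite map_mpolyZ map_mpolyX mxE.
Qed.

End Act.

Section Weight.
Variable T : realDomainType.

Definition wt (k : nat) (w : 'I_k -> T) (m : 'X_{1..k}) : T := \sum_i w i *+ m i.

Lemma wtD k (w : 'I_k -> T) m1 m2 : wt w (m1 + m2)%MM = wt w m1 + wt w m2.
Proof. by rewrite /wt -big_split /=; apply: eq_bigr => i _; rewrite mnmDE mulrnDr. Qed.

Lemma wt0 k (w : 'I_k -> T) : wt w 0%MM = 0.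
Proof. by rewrite /wt big1 // => i _; rewrite mnm0E. Qed.

Lemma wtU k (w : 'I_k -> T) i : wt w U_(i)%MM = w i.
Proof.
rewrite /wt (bigD1 i) //= mnm1E eqxx big1 ?addr0 // => j ji.
by rewrite mnm1E eq_sym (negPf ji).
Qed.

Definition wge (R : nzRingType) (k : nat) (w : 'I_k -> T) (c : T) (p : {mpoly R[k]}) :=
  forall m, p@_m != 0 -> c <= wt w m.

Section WgeRing.
Variables (R : comNzRingType) (k : nat) (w : 'I_k -> T).
Implicit Types (p q : {mpoly R[k]}) (c : T).

Lemma wge0 c : wge w c (0 : {mpoly R[k]}).
Proof. by move=> m; rewrite mcoeff0 eqxx. Qed.

Lemma wge_le c c' p : c' <= c -> wge w c p -> wge w c' p.
Proof. by move=> le wp m /wp; apply: le_trans. Qed.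

Lemma wgeD c p q : wge w c p -> wge w c q -> wge w c (p + q).
Proof.
move=> wp wq m; rewrite mcoeffD; have [->|/wp//] := eqVneq p@_m 0.
by rewrite add0r; apply: wq.
Qed.

Lemma wge_sum c (I : Type) (r : seq I) (P : pred I) (F : I -> {mpoly R[k]}) :
  (forall i, P i -> wge w c (F i)) -> wge w c (\sum_(i <- r | P i) F i).
Proof. by move=> h; elim/big_ind: _ => //; [apply: wge0|apply: wgeD]. Qed.

Lemma wgeM c c' p q : wge w c p -> wge w c' q -> wge w (c + c') (p * q).
Proof.
move=> wp wq m; rewrite -mcoeff_msupp => /msuppM_le /allpairsP [[m1 m2]] /= [].
rewrite !mcoeff_msupp => /wp h1 /wq h2 ->.
by rewrite wtD lerD.
Qed.

Lemma wgeC a : wge w 0 (a%:MP : {mpoly R[k]}).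
Proof.
move=> m; rewrite mcoeffC; have [->|_] := eqVneq m 0%MM; first by rewrite wt0.
by rewrite mulr0 eqxx.
Qed.

Lemma wgeX i : wge w (w i) ('X_i : {mpoly R[k]}).
Proof.
by move=> m; rewrite mcoeffX; have [<-|_] := eqVneq U_(i)%MM m; rewrite ?wtU // eqxx.
Qed.

Lemma wgeZ c a p : wge w c p -> wge w c (a *: p).
Proof.
move=> wp m; rewrite mcoeffZ => h; apply: wp.
by apply: contraNneq h => ->; rewrite mulr0.
Qed.

Lemma wge_exp c p e : wge w c p -> wge w (c *+ e) (p ^+ e).
Proof.
move=> wp; elim: e => [|e IH]; first by rewrite expr0 mulr0n; apply: wgeC.
by rewrite exprS mulrS; apply: wgeM.
Qed.

Lemma wge_prod (I : Type) (r : seq I) (cs : I -> T) (F : I -> {mpoly R[k]}) :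
  (forall i, wge w (cs i) (F i)) ->
  wge w (\sum_(i <- r) cs i) (\prod_(i <- r) F i).
Proof.
move=> h; elim/big_rec2: _ => [|i c p _ IH]; first exact: wgeC.
exact: wgeM.
Qed.

End WgeRing.

Lemma wge_comp (R : comNzRingType) k l (w : 'I_k -> T) (w' : 'I_l -> T) c
    (p : {mpoly R[k]}) (q : k.-tuple {mpoly R[l]}) :
  wge w c p -> (forall i, wge w' (w i) (tnth q i)) -> wge w' c (p \mPo q).
Proof.
move=> wp wq; rewrite comp_mpolyEX big_seq_cond; apply: wge_sum => m.
rewrite andbT mcoeff_msupp => /wp cm; apply: wgeZ; apply: wge_le cm _.
rewrite comp_mpolyX; apply: wge_prod => i; exact: wge_exp.
Qed.

(** The condition on [A] is compatibility with the flags of [w] and [w']; comparisons of weighted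
    bases go through it. *)
Lemma wge_act (R : comNzRingType) n (w w' : 'I_n -> T) c (A : 'M[R]_n) f :
  (forall i j, A i j != 0 -> w i <= w' j) -> wge w c f -> wge w' c (act A f).
Proof.
move=> Aw wf; rewrite actE; apply: wge_comp wf _ => i; rewrite tnth_mktuple.
apply: wge_sum => j _; have [->|/Aw le] := eqVneq (A i j) 0.
  by rewrite scale0r; apply: wge0.
by apply: wgeZ; apply: wge_le le _; apply: wgeX.
Qed.

End Weight.

Lemma wt_cst (T : realDomainType) k (c : T) m : wt (fun _ : 'I_k => c) m = c *+ mdeg m.
Proof. by rewrite /wt mdegE -sumrMnr. Qed.

(** Homogeneity becomes two weight bounds, so that its invariance under substitutions is a case of
    [wge_act]. *)
Lemma homog_wge (R : comNzRingType) n d (f : {mpoly R[n]}) :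
  f \is d.-homog <->
  (wge (fun=> 1) (d%:Z) f /\ wge (fun=> -1) (- d%:Z) f).
Proof.
split=> [/dhomogP h|[h1 h2]].
  by split=> m; rewrite -mcoeff_msupp => /h <-; rewrite wt_cst ?mulNrn natz.
apply/dhomogP => m; rewrite mcoeff_msupp => mf.
have := h1 _ mf; have := h2 _ mf; rewrite !wt_cst mulNrn !natz lerN2 !lez_nat => a b.
by apply/eqP; rewrite eqn_leq a b.
Qed.

Lemma act_homog (R : comNzRingType) n (A : 'M[R]_n) d f :
  f \is d.-homog -> act A f \is d.-homog.
Proof.
by move=> /homog_wge [h1 h2]; apply/homog_wge; split;
  [apply: wge_act h1|apply: wge_act h2].
Qed.

Lemma mcoeff_scale (R : comNzRingType) k (x : 'I_k -> R) (p : {mpoly R[k]}) m :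
  (p \mPo [tuple x i *: 'X_i | i < k])@_m = p@_m * \prod_i x i ^+ m i.
Proof.
rewrite comp_mpolyEX raddf_sum /=.
have E m' : ('X_[m'] \mPo [tuple x i *: 'X_i | i < k]) =
    (\prod_i x i ^+ m' i) *: 'X_[m'] :> {mpoly R[k]}.
  rewrite comp_mpolyX [in RHS]mpolyXE_id -scaler_prod.
  by apply: eq_bigr => i _; rewrite tnth_mktuple exprZn.
under eq_bigr do rewrite mcoeffZ E mcoeffZ mcoeffX mulrA.
have [mp|mp] := boolP (m \in msupp p).
  rewrite (bigD1_seq m) //= eqxx mulr1 [X in _ + X]big1 ?addr0 // => m' /negPf ->.
  by rewrite mulr0.
rewrite [LHS]big1_seq => [|m' /= m'p]; last first.
  by rewrite (_ : m' == m = false) ?mulr0 //; apply: contraNF mp => /eqP <-.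
by rewrite (memN_msupp_eq0 mp) mul0r.
Qed.

Lemma mcoeff_act_diag (R : comNzRingType) n (x : 'rV[R]_n) f m :
  (act (diag_mx x) f)@_m = f@_m * \prod_i x 0 i ^+ m i.
Proof.
rewrite -(mcoeff_scale (x 0)) actE; congr ((_ \mPo _)@_m).
apply/eq_from_tnth => i; rewrite !tnth_mktuple (bigD1 i) //= big1 ?addr0 => [|j ji].
  by rewrite mxE eqxx mulr1n.
by rewrite mxE eq_sym (negPf ji) scale0r.
Qed.

Lemma act_perm (R : comNzRingType) n (s : 'S_n) (f : {mpoly R[n]}) :
  act (perm_mx s) f = msym s f.
Proof.
rewrite actE /msym /comp_mpoly /mmap; apply: eq_bigr => m _; congr (_ * _).
apply: mmap1_eq => i; rewrite tnth_mktuple (bigD1 (s i)) //= big1 ?addr0 => [|j ji].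
  by rewrite !mxE eqxx scale1r.
by rewrite !mxE eq_sym (negPf ji) scale0r.
Qed.

Lemma mpoly_neq0_coef (R : nzRingType) k (q : {mpoly R[k]}) :
  q != 0 -> exists m, q@_m != 0.
Proof.
rewrite -msupp_eq0; case E: (msupp q) => [//|m s] _; exists m.
by rewrite -mcoeff_msupp E mem_head.
Qed.

(** * Nonvanishing of polynomials over an algebraically closed field *)

Section Closed.
Variable K : closedFieldType.

(** For nonconstant [p], a root of [p - 1] is a point where [p] takes the value 1. *)
Lemma poly_nonroot (p : {poly K}) : p != 0 -> exists x, p.[x] != 0.
Proof.
move=> p0; have [sp|sp] := eqVneq (size p) 1%N.
  exists 0; move: sp => /eqP/size_poly1P [c c0 ->].
  by rewrite hornerC.
have: size (p - 1) != 1%N.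
  apply: contraNneq sp => /eqP/size_poly1P [c c0 e].
  have -> : p = (c + 1)%:P by rewrite polyCD -e subrK.
  rewrite size_polyC; have [h|//] := eqVneq (c + 1) 0.
  by move: p0; rewrite -[p](subrK 1) e -polyCD h eqxx.
move=> /closed_rootP [x]; rewrite rootE hornerD hornerN hornerC subr_eq0 => /eqP px.
by exists x; rewrite px oner_neq0.
Qed.

(** Multiplying the difference by ['X] makes the nonroot nonzero. This is how identities along a
    one-parameter subgroup extend to its limit at 0. *)
Lemma poly_eq_nonzero (p q : {poly K}) :
  (forall t, t != 0 -> p.[t] = q.[t]) -> p = q.
Proof.
move=> h; apply/eqP; rewrite -subr_eq0; apply: contraT => pq0.
have /poly_nonroot [x] : (p - q) * 'X != 0 by rewrite mulf_neq0 // polyX_eq0.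
rewrite hornerM hornerX mulf_eq0 negb_or hornerD hornerN => /andP [pq /h e].
by rewrite e subrr eqxx in pq.
Qed.

Lemma base_expansion_inj B n (a b : nat -> nat) :
  (forall i, i < n -> a i < B)%N -> (forall i, i < n -> b i < B)%N ->
  (\sum_(i < n) a i * B ^ i = \sum_(i < n) b i * B ^ i)%N ->
  forall i, (i < n)%N -> a i = b i.
Proof.
elim: n a b => [//|n IH] a b ha hb.
have E (c : nat -> nat) : (\sum_(i < n.+1) c i * B ^ i = (\sum_(i < n) c i.+1 * B ^ i) * B + c 0)%N.
  rewrite big_ord_recl expn0 muln1 addnC; congr addn; rewrite big_distrl /=.
  by apply: eq_bigr => i _; rewrite -mulnA -expnSr.
rewrite !E => e.
have e0 : a 0%N = b 0%N.
  have := congr1 (modn^~ B) e.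
  by rewrite /= !modnMDl ?modn_small ?ha ?hb.
move: e; rewrite e0 => /addIn /eqP; rewrite eqn_pmul2r; last by case: B ha {hb IH E} (ha 0%N isT).
move/eqP => h [//|i] lti; apply: (IH (a \o S) (b \o S)) => // j lj; [exact: ha|exact: hb].
Qed.

(* Kronecker substitution 'X_i |-> t ^ (B ^ i) reduces to one variable. *)
Lemma mpoly_nonroot k (p : {mpoly K[k]}) : p != 0 -> exists v, p.@[v] != 0.
Proof.
move=> p0; pose B := msize p.
pose q := mmap polyC (fun i : 'I_k => 'X ^+ (B ^ i)) p.
pose N (m : 'X_{1..k}) := (\sum_(i < k) m i * B ^ i)%N.
have qE : q = \sum_(m <- msupp p) p@_m *: 'X^(N m).
  apply: eq_bigr => m _; rewrite mul_polyC /mmap1 /N; congr (_ *: _).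
  rewrite -prodrXr; apply: eq_bigr => i _; rewrite -exprM.
  by rewrite mulnC.
have NI m m' : m \in msupp p -> m' \in msupp p -> N m = N m' -> m = m'.
  have bd m0 (i : 'I_k) : m0 \in msupp p -> (m0 i < B)%N.
    move=> h; apply: leq_ltn_trans (msize_mdeg_lt h).
    by rewrite mdegE (bigD1 i) //= leq_addr.
  move=> mp m'p e; apply/mnmP => i.
  pose f (m0 : 'X_{1..k}) j := if insub j is Some j then m0 (j : 'I_k) else 0%N.
  have fE m0 (j : 'I_k) : f m0 j = m0 j by rewrite /f valK.
  rewrite -!fE; apply: (@base_expansion_inj B k) => // [j lt|j lt|].
  - by rewrite (fE _ (Ordinal lt)); apply: bd.
  - by rewrite (fE _ (Ordinal lt)); apply: bd.
  - by rewrite /N in e; under eq_bigr do rewrite fE; under [RHS]eq_bigr do rewrite fE.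
have q0 : q != 0.
  have [m] := mpoly_neq0_coef p0; rewrite -mcoeff_msupp => mp.
  apply: contraTneq (mp) => e; have := congr1 (fun r : {poly K} => r`_(N m)) e.
  rewrite qE coef_sum coef0 (bigD1_seq m) //= coefZ coefXn eqxx mulr1.
  rewrite big_seq_cond big1 => [|m' /andP [m'p ne]].
    by rewrite addr0 mcoeff_msupp => ->; rewrite eqxx.
  rewrite coefZ coefXn; case: eqP => [e'|]; rewrite ?mulr0 //.
  by rewrite (NI _ _ mp m'p e') eqxx in ne.
have [t qt] := poly_nonroot q0; exists (fun i => t ^+ (B ^ i)).
rewrite mevalE; apply: contraNneq qt => <-; rewrite qE horner_sum.
apply/eqP; apply: eq_bigr => m _; rewrite hornerZ hornerXn; congr (_ * _).
rewrite /N -prodrXr; apply: eq_bigr => i _.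
by rewrite -exprM mulnC.
Qed.

End Closed.

(** * Polynomial functions and orbits *)

Section Polyfun.
Variables (K : fieldType) (n : nat).
Implicit Types (F G : {mpoly K[n]} -> K) (A B : 'M[K]_n).

Lemma polyfun_ext F G : F =1 G -> polyfun F -> polyfun G.
Proof. by move=> FG [k [ms [P h]]]; exists k, ms, P => g; rewrite -FG. Qed.

Lemma polyfun_cst c : polyfun (fun _ : {mpoly K[n]} => c).
Proof. by exists 0%N, [tuple], c%:MP => g; rewrite mevalC. Qed.

Lemma polyfun_coef m : polyfun (fun g : {mpoly K[n]} => g@_m).
Proof. by exists 1%N, [tuple m], 'X_ord0 => g; rewrite mevalXU. Qed.

Lemma polyfun_binop (op : forall k, {mpoly K[k]} -> {mpoly K[k]} -> {mpoly K[k]})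
    (op0 : K -> K -> K) F G :
  (forall k v (p q : {mpoly K[k]}), (op k p q).@[v] = op0 p.@[v] q.@[v]) ->
  polyfun F -> polyfun G -> polyfun (fun g => op0 (F g) (G g)).
Proof.
move=> opE [k1 [ms1 [P1 h1]]] [k2 [ms2 [P2 h2]]].
exists (k1 + k2)%N, [tuple of ms1 ++ ms2],
  (op _ (P1 \mPo [tuple 'X_(lshift k2 i) | i < k1])
        (P2 \mPo [tuple 'X_(rshift k1 i) | i < k2])) => g.
rewrite opE h1 h2 !comp_mpoly_meval; congr op0; apply: meval_eq => i.
  by rewrite tnth_mktuple mevalXU tnth_lshift.
by rewrite tnth_mktuple mevalXU tnth_rshift.
Qed.

Lemma polyfunD F G : polyfun F -> polyfun G -> polyfun (fun g => F g + G g).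
Proof. by apply: (polyfun_binop (op := fun k p q => p + q)) => *; rewrite mevalD. Qed.

Lemma polyfunM F G : polyfun F -> polyfun G -> polyfun (fun g => F g * G g).
Proof. by apply: (polyfun_binop (op := fun k p q => p * q)) => *; rewrite mevalM. Qed.

Lemma polyfun_sum (I : Type) (r : seq I) (Fs : I -> {mpoly K[n]} -> K) :
  (forall i, polyfun (Fs i)) -> polyfun (fun g => \sum_(i <- r) Fs i g).
Proof.
move=> h; elim: r => [|i r IH].
  by apply: (polyfun_ext _ (polyfun_cst 0)) => g; rewrite big_nil.
by apply: (polyfun_ext _ (polyfunD (h i) IH)) => g; rewrite big_cons.
Qed.

Lemma polyfun_prod (I : Type) (r : seq I) (Fs : I -> {mpoly K[n]} -> K) :
  (forall i, polyfun (Fs i)) -> polyfun (fun g => \prod_(i <- r) Fs i g).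
Proof.
move=> h; elim: r => [|i r IH].
  by apply: (polyfun_ext _ (polyfun_cst 1)) => g; rewrite big_nil.
by apply: (polyfun_ext _ (polyfunM (h i) IH)) => g; rewrite big_cons.
Qed.

Lemma polyfunX F e : polyfun F -> polyfun (fun g => F g ^+ e).
Proof.
move=> h; elim: e => [|e IH].
  by apply: (polyfun_ext _ (polyfun_cst 1)) => g; rewrite expr0.
by apply: (polyfun_ext _ (polyfunM h IH)) => g; rewrite exprS.
Qed.

Lemma polyfun_meval k (P : {mpoly K[k]}) (Fs : 'I_k -> {mpoly K[n]} -> K) :
  (forall i, polyfun (Fs i)) -> polyfun (fun g => P.@[fun i => Fs i g]).
Proof.
move=> h; have H : polyfun (fun g => \sum_(m <- msupp P) P@_m * \prod_i Fs i g ^+ m i).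
  apply: polyfun_sum => m; apply: polyfunM; first exact: polyfun_cst.
  by apply: polyfun_prod => i; apply: polyfunX.
by apply: polyfun_ext H => g; rewrite mevalE.
Qed.

(** A linear substitution does not lower degrees, so only the truncation of [g] to degree at most
    [mdeg m] contributes. The coefficient is thus a finite linear expression in those of [g], as
    [polyfun_act] requires. *)
Lemma mcoeff_act A g m :
  (act A g)@_m = \sum_(m' : 'X_{1..n < (mdeg m).+1}) g@_m' * (act A 'X_[m'])@_m.
Proof.
pose D := (mdeg m).+1.
pose g1 : {mpoly K[n]} := \sum_(m' : 'X_{1..n < D}) g@_m' *: 'X_[m'].
have g2 : wge (fun=> 1) (D%:Z) (g - g1).
  move=> m'; rewrite mcoeffB wt_cst natz lez_nat leqNgt; apply: contraNN => lt.
  by rewrite (mcoeff_mpoly (fun m0 => g@_m0)) // subrr.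
have /(_ m) h : wge (fun=> 1) (D%:Z) (act A (g - g1)) by apply: wge_act g2.
rewrite -[in LHS](subrK g1 g) rmorphD /= mcoeffD.
have [->|/h] := eqVneq (act A (g - g1))@_m 0; last first.
  by rewrite wt_cst natz lez_nat ltnn.
rewrite add0r rmorph_sum raddf_sum /=; apply: eq_bigr => m' _.
by rewrite actZ mcoeffZ.
Qed.

Lemma polyfun_act F A : polyfun F -> polyfun (fun g => F (act A g)).
Proof.
case=> k [ms [P h]].
have H : polyfun (fun g => P.@[fun i => (act A g)@_(tnth ms i)]).
  apply: polyfun_meval => i.
  have H : polyfun (fun g => \sum_(m' : 'X_{1..n < (mdeg (tnth ms i)).+1})
                g@_m' * (act A 'X_[m'])@_(tnth ms i)).
    apply: polyfun_sum => m'; apply: polyfunM; first exact: polyfun_coef.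
    exact: polyfun_cst.
  by apply: polyfun_ext H => g; rewrite mcoeff_act.
by apply: polyfun_ext H => g; rewrite h.
Qed.

Lemma sl_actE (f : {mpoly K[n]}) A : sl_act A f = act A f.
Proof. by rewrite actE. Qed.

Lemma sl_orbit_refl (f : {mpoly K[n]}) : sl_orbit f f.
Proof. by exists 1%:M; rewrite det1; split=> //; rewrite sl_actE act1. Qed.

Lemma sl_orbitP (f g : {mpoly K[n]}) :
  sl_orbit f g <-> exists A : 'M[K]_n, \det A = 1 /\ g = act A f.
Proof.
by split=> -[A [dA e]]; exists A; split; rewrite // e sl_actE.
Qed.

Lemma sl_orbit_act (f : {mpoly K[n]}) A : \det A = 1 -> sl_orbit f (act A f).
Proof. by move=> h; apply/sl_orbitP; exists A. Qed.

Lemma sl_orbit_trans (f g h : {mpoly K[n]}) :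
  sl_orbit f g -> sl_orbit g h -> sl_orbit f h.
Proof.
move=> /sl_orbitP [A [dA ->]] /sl_orbitP [B [dB ->]]; rewrite act_comp.
by apply: sl_orbit_act; rewrite det_mulmx dA dB mul1r.
Qed.

Lemma sl_orbit_sym (f g : {mpoly K[n]}) : sl_orbit f g -> sl_orbit g f.
Proof.
move=> /sl_orbitP [A [dA ->]]; have uA : A \in unitmx by rewrite unitmxE dA unitr1.
apply/sl_orbitP; exists (invmx A); rewrite det_inv dA invr1; split=> //.
by rewrite act_comp mulmxV // act1.
Qed.

Lemma zclosure_sub (X : {mpoly K[n]} -> Prop) f : X f -> zclosure X f.
Proof. by move=> Xf F _; apply. Qed.

Lemma zclosure_orbit_act (f g : {mpoly K[n]}) A : \det A = 1 ->
  zclosure (sl_orbit f) g -> zclosure (sl_orbit f) (act A g).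
Proof.
move=> dA cg F pF hF; apply: (cg (fun x => F (act A x))); first exact: polyfun_act.
by move=> x fx; apply/hF/(sl_orbit_trans fx)/sl_orbit_act.
Qed.

Lemma zclosure_homog d (f g : {mpoly K[n]}) : f \is d.-homog ->
  zclosure (sl_orbit f) g -> g \is d.-homog.
Proof.
move=> fd cg; apply/dhomogP => m; rewrite mcoeff_msupp => gm.
apply/eqP; apply: contraNT gm => md; apply/eqP; apply: cg; first exact: polyfun_coef.
move=> h /sl_orbitP [A [_ ->]]; apply: (dhomog_nemf_coeff (mf := mdeg)) md.
by apply: act_homog.
Qed.

End Polyfun.

(** * Extension of places *)

Section Subring.
Variables (R : nzRingType).

(** The predicate is [Prop]-valued because the valuation rings to come are produced by Zorn's
    lemma. *)
Record subring_pred (S : R -> Prop) : Prop := SubringPred {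
  sub_1 : S 1;
  sub_B : forall x y, S x -> S y -> S (x - y);
  sub_M : forall x y, S x -> S y -> S (x * y) }.

Variables (S : R -> Prop) (sS : subring_pred S).

Lemma sub_0 : S 0.
Proof. by have := sub_B sS (sub_1 sS) (sub_1 sS); rewrite subrr. Qed.

Lemma sub_N x : S x -> S (- x).
Proof. by move=> Sx; have := sub_B sS sub_0 Sx; rewrite sub0r. Qed.

Lemma sub_D x y : S x -> S y -> S (x + y).
Proof. by move=> Sx Sy; rewrite -[y]opprK; apply: (sub_B sS) => //; apply: sub_N. Qed.

Lemma sub_sum (I : Type) (r : seq I) (P : pred I) (G : I -> R) :
  (forall i, P i -> S (G i)) -> S (\sum_(i <- r | P i) G i).
Proof. by move=> h; elim/big_ind: _ => //; [apply: sub_0|apply: sub_D]. Qed.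

Lemma sub_prod (I : Type) (r : seq I) (P : pred I) (G : I -> R) :
  (forall i, P i -> S (G i)) -> S (\prod_(i <- r | P i) G i).
Proof. by move=> h; elim/big_ind: _ => //; [apply: sub_1|apply: (sub_M sS)]. Qed.

Lemma sub_exp x k : S x -> S (x ^+ k).
Proof. by move=> Sx; elim: k => [|k IH]; [apply: sub_1|rewrite exprS; apply: (sub_M sS)]. Qed.

End Subring.

Section SubringConstructions.
Variables (R : comNzRingType) (S : R -> Prop) (sS : subring_pred S).

Lemma sub_det n (M : 'M[R]_n) : (forall i j, S (M i j)) -> S (\det M).
Proof.
move=> SM; apply: (sub_sum sS) => s _; apply: (sub_M sS).
  by apply: (sub_exp sS); apply: (sub_N sS); apply: (sub_1 sS).
by apply: (sub_prod sS) => i _.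
Qed.

Definition coef_in n (p : {mpoly R[n]}) : Prop := forall m, S p@_m.

Lemma coef_in_subring n : subring_pred (@coef_in n).
Proof.
split=> [m|p q Sp Sq m|p q Sp Sq m].
- by rewrite mcoeff1; case: (m == 0%MM); [apply: (sub_1 sS)|apply: (sub_0 sS)].
- by rewrite mcoeffB; apply: (sub_B sS).
- by rewrite mcoeffM; apply: (sub_sum sS) => i _; apply: (sub_M sS).
Qed.

Lemma coef_inC n c : S c -> coef_in (c%:MP : {mpoly R[n]}).
Proof.
by move=> Sc m; rewrite mcoeffC; case: (m == 0%MM); rewrite ?mulr1 ?mulr0 //; apply: (sub_0 sS).
Qed.

Lemma coef_inX n m : coef_in ('X_[m] : {mpoly R[n]}).
Proof.
by move=> m'; rewrite mcoeffX; case: (m == m'); [apply: (sub_1 sS)|apply: (sub_0 sS)].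
Qed.

Lemma coef_inZ n c (p : {mpoly R[n]}) : S c -> coef_in p -> coef_in (c *: p).
Proof. by move=> Sc Sp m; rewrite mcoeffZ; apply: (sub_M sS). Qed.

Lemma coef_in_act n (A : 'M[R]_n) p : (forall i j, S (A i j)) -> coef_in p -> coef_in (act A p).
Proof.
move=> SA Sp; rewrite actE comp_mpolyEX.
have sC := coef_in_subring n.
apply: (sub_sum sC) => m _; apply: coef_inZ => //; rewrite comp_mpolyX.
apply: (sub_prod sC) => i _; apply: (sub_exp sC); rewrite tnth_mktuple.
by apply: (sub_sum sC) => j _; apply: coef_inZ => //; apply: coef_inX.
Qed.

End SubringConstructions.

Section Place.
Variables (F : fieldType) (K : closedFieldType) (iota : {rmorphism K -> F}).
Local Notation E := (F * K)%type.
Implicit Types (S : E -> Prop).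

Lemma expfB_le (x : F) i n : x != 0 -> (i <= n)%N -> x ^+ (n - i) = x ^+ n * (x ^+ i)^-1.
Proof. by move=> x0 le; rewrite -[in RHS](subnK le) exprD mulfK // expf_neq0. Qed.

(* A [K]-subalgebra of [F * K] that is the graph of a function. *)
Record place S : Prop := Place {
  place_cst : forall c, S (iota c, c);
  placeB : forall x y, S x -> S y -> S (x - y);
  placeM : forall x y, S x -> S y -> S (x * y);
  place_fun : forall k, S (0, k) -> k = 0 }.

Section PlaceTheory.
Variables (S : E -> Prop) (pS : place S).

Lemma place_subring : subring_pred S.
Proof.
split; [|exact: placeB|exact: placeM].
by have := place_cst pS 1; rewrite rmorph1.
Qed.

Definition place1 := sub_1 place_subring.
Definition place0 := sub_0 place_subring.
Definition place_sum := sub_sum place_subring.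
Definition place_exp := sub_exp place_subring.

End PlaceTheory.

Definition place_adjoin S (x : E) (z : E) : Prop :=
  exists2 p : {poly E}, (forall i, S p`_i) & z = p.[x].

Lemma place_adjoinP S x : place S ->
  (forall k, place_adjoin S x (0, k) -> k = 0) -> place (place_adjoin S x).
Proof.
move=> pS fS; split=> //.
- move=> c; exists (iota c, c)%:P; last by rewrite hornerC.
  by move=> i; rewrite coefC; case: ifP => _; [apply: place_cst|apply: place0].
- move=> _ _ [p Sp ->] [q Sq ->]; exists (p - q); last by rewrite hornerD hornerN.
  by move=> i; rewrite coefB; apply: placeB.
- move=> _ _ [p Sp ->] [q Sq ->]; exists (p * q); last by rewrite hornerM.
  by move=> i; rewrite coefM; apply: place_sum => // j _; apply: placeM.
Qed.

Lemma place_adjoin_sub S x z : place S -> S z -> place_adjoin S x z.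
Proof.
move=> pS Sz; exists z%:P; last by rewrite hornerC.
by move=> i; rewrite coefC; case: ifP => _ //; apply: place0.
Qed.

Lemma place_adjoin_id S x : place S -> place_adjoin S x x.
Proof.
move=> pS; exists 'X; last by rewrite hornerX.
by move=> i; rewrite coefX; case: (i == 1%N); [apply: place1|apply: place0].
Qed.

Section Maximal.
Variables (S : E -> Prop) (pS : place S).
Hypothesis maxS : forall S', place S' -> (forall z, S z -> S' z) -> forall z, S' z -> S z.

(** A witness, as in Chevalley's extension theorem, that 1 lies in the extension to [R[x]] of the
    maximal ideal of the valuation ring [R]. *)
Definition place_rel n x := exists a : nat -> E,
  [/\ forall i, S (a i), \sum_(i < n.+1) (a i).1 * x ^+ i = 0,
      (a 0%N).2 = 1 & forall i, (0 < i)%N -> (a i).2 = 0].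

(** The reductions [J] of the polynomials over [S] that vanish at [x] form an ideal of [K[X]]. By
    maximality no pair [(x, xi)] can be adjoined, so [J] has no common root; as [K] is algebraically
    closed, Euclidean descent shows that it contains 1, and a polynomial reducing to 1 is the
    relation. *)
Lemma place_relP x : (forall k, ~ S (x, k)) -> exists n, place_rel n x.
Proof.
move=> nx; pose J (q : {poly K}) := exists p : {poly E},
  [/\ forall i, S p`_i, (map_poly fst p).[x] = 0 & map_poly snd p = q].
have Jxi xi : exists2 q, J q & q.[xi] != 0.
  have [h|] := boolp.EM (place (place_adjoin S (x, xi))).
    case: (nx xi); apply: (maxS h) => [z|]; first exact: place_adjoin_sub.
    exact: place_adjoin_id.
  move=> h; apply: boolp.contrapT => h'; apply: h; apply: place_adjoinP => // k [p Sp].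
  move=> e; apply/eqP; apply: boolp.contrapT => /negP k0; apply: h'.
  exists (map_poly snd p); last by rewrite (horner_map snd p (x, xi)) /= -e.
  by exists p; split=> //; rewrite (horner_map fst p (x, xi)) /= -e.
have JB q q' : J q -> J q' -> J (q - q').
  move=> [p [Sp px <-]] [p' [Sp' px' <-]]; exists (p - p'); split.
  - by move=> i; rewrite coefB; apply: placeB.
  - by rewrite rmorphB hornerD hornerN px px' subrr.
  - by rewrite rmorphB.
have JM q r : J q -> J (r * q).
  move=> [p [Sp px <-]].
  pose r' : {poly E} := \poly_(i < size r) (iota r`_i, r`_i).
  have Sr i : S r'`_i.
    by rewrite coef_poly; case: ifP => _; [apply: place_cst|apply: place0].
  have r'E : map_poly snd r' = r.
    apply/polyP => i; rewrite coef_map coef_poly; case: ltnP => //= h.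
    by rewrite nth_default.
  exists (r' * p); split.
  - by move=> i; rewrite coefM; apply: place_sum => // j _; apply: placeM.
  - by rewrite rmorphM hornerM px mulr0.
  - by rewrite rmorphM /= r'E.
have J1 : J 1.
  have H s : forall q, J q -> q != 0 -> (size q <= s)%N -> J 1.
    elim: s => [|s IH] q Jq q0 qs.
      by move: q0; rewrite -size_poly_eq0; case: (size q) qs.
    have [q1|q1] := eqVneq (size q) 1%N.
      move/eqP/size_poly1P: q1 => [c c0 qc].
      have -> : 1 = c^-1%:P * q by rewrite qc -polyCM mulVf.
      exact: JM.
    have /closed_rootP [xi qxi] := q1.
    have [q' Jq' q'xi] := Jxi xi.
    have Jr : J (q' %% q)%R.
      have -> : (q' %% q)%R = q' - (q' %/ q) * q by rewrite {2}(divp_eq q' q) addrC addKr.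
      by apply: JB => //; apply: JM.
    have [r0|r0] := eqVneq (q' %% q) 0.
      case/negP: q'xi; rewrite (divp_eq q' q) r0 addr0 hornerM.
      by move: qxi; rewrite rootE => /eqP ->; rewrite mulr0.
    by apply: IH Jr r0 _; rewrite -ltnS; apply: leq_trans qs; rewrite ltn_modp.
  have [q Jq q0] := Jxi 0; apply: (H _ q Jq) => //.
  by apply: contraNneq q0 => ->; rewrite horner0.
have [p [Sp px p1]] := J1; exists (size p), (fun i => p`_i); split=> //.
- have sp : (size (map_poly fst p) <= (size p).+1)%N by apply: leqW; apply: size_poly.
  rewrite (horner_coef_wide _ sp) in px; rewrite -[RHS]px.
  by apply: eq_bigr => i _; rewrite coef_map.
- by have := congr1 (fun q : {poly K} => q`_0) p1; rewrite coef_map coef1.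
- case=> // i _.
  by have := congr1 (fun q : {poly K} => q`_i.+1) p1; rewrite coef_map coef1.
Qed.

(** If [x^-1] had no value, a relation for it multiplied by [x ^+ n] would give an element over 0
    with residue [k ^+ n]. *)
Lemma max_placeV x k : S (x, k) -> k != 0 -> S (x^-1, k^-1).
Proof.
move=> Sx k0.
have x0 : x != 0.
  by apply: contraNneq k0 => x0; rewrite x0 in Sx; rewrite (place_fun pS Sx).
have [[l Sl]|h] := boolp.EM (exists l, S (x^-1, l)).
  suff <- : l = k^-1 by [].
  have := placeB pS (placeM pS Sx Sl) (place1 pS).
  rewrite (_ : _ - _ = (0, k * l - 1)); last first.
    by congr (_, _); rewrite /= mulfV // subrr.
  move/(place_fun pS)/eqP; rewrite subr_eq0 => /eqP kl.
  by rewrite -[l](mulKf k0) kl mulr1.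
have [n [a [Sa ax a0 ai]]] : exists n, place_rel n x^-1.
  by apply: place_relP => l Sl; apply: h; exists l.
have := @place_fun _ pS (k ^+ n).
have : S (\sum_(i < n.+1) a i * (x, k) ^+ (n - i)).
  by apply: place_sum => // i _; apply: placeM => //; apply: place_exp.
have prE (z : E) e : z ^+ e = (z.1 ^+ e, z.2 ^+ e).
  elim: e => [|e IH]; first by rewrite !expr0.
  by rewrite !exprS IH.
rewrite (_ : \sum_(i < n.+1) _ = (0, k ^+ n)).
  by move=> Sk /(_ Sk)/eqP; rewrite expf_eq0 (negPf k0) andbF.
apply/eqP; rewrite -pair_eqE /pair_eq /=; apply/andP; split.
  rewrite (raddf_sum fst) /=; apply/eqP; transitivity (x ^+ n * 0); last exact: mulr0.
  rewrite -[in RHS]ax mulr_sumr; apply: eq_bigr => i _; rewrite prE /= mulrCA exprVn.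
  by congr (_ * _); apply: expfB_le; rewrite // -ltnS.
rewrite (raddf_sum snd) /= big_ord_recl big1 ?addr0 => [|i _] /=.
  by rewrite a0 subn0 prE mul1r.
by rewrite ai // mul0r.
Qed.

(** Descent on the sum of the degrees: the relation of smaller degree cancels the leading term of
    the other one. In degree 0 a relation says that an element over 0 has residue 1. *)
Lemma place_rel_absurd N n m x : (n + m <= N)%N -> x != 0 ->
  place_rel n x -> place_rel m x^-1 -> False.
Proof.
elim: N n m x => [|N IH] n m x nmN x0.
  move: nmN; rewrite leqn0 addn_eq0 => /andP [/eqP -> /eqP ->] [a [Sa ax a0 _]] _.
  move: ax; rewrite big_ord1 expr0 mulr1 => a1.
  have := Sa 0%N; rewrite [a 0%N]surjective_pairing a0 a1 => /(place_fun pS)/eqP.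
  by rewrite oner_eq0.
wlog mn : n m x nmN x0 / (m <= n)%N => [W|].
  have [mn|mn] := leqP m n; first exact: W mn.
  move=> rn rm; apply: (W m n x^-1); rewrite ?invr_eq0 ?(ltnW mn) // 1?addnC //.
  by rewrite invrK.
move=> [a [Sa ax a0 ai]] rm.
have [b [Sb bx b0 bi]] := rm.
have n0 : (0 < n)%N.
  case: n ax {nmN mn} => // ; rewrite big_ord1 expr0 mulr1 => a1.
  have := Sa 0%N; rewrite [a 0%N]surjective_pairing a0 a1 => /(place_fun pS)/eqP.
  by rewrite oner_eq0.
have Su : S ((b 0%N).1^-1, 1).
  rewrite -(invr1 K); apply: max_placeV; last exact: oner_neq0.
  by rewrite -b0 -surjective_pairing.
have b00 : (b 0%N).1 != 0.
  apply/eqP => h; have := Sb 0%N; rewrite [b 0%N]surjective_pairing b0 h.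
  by move/(place_fun pS)/eqP; rewrite oner_eq0.
(* The relation for [x^-1] divided by its constant term, a unit, and cut off at its degree [m].
   Multiplied by [x ^+ n] it has leading coefficient 1; its coefficient of [x ^+ 0] has residue 0
   because [0 < n], so subtracting a multiple keeps the residue 1 of the constant term. *)
pose c j : E := if (j <= m)%N then ((b 0%N).1^-1, 1) * b j else 0.
have Sc j : S (c j) by rewrite /c; case: ifP => _; [apply: placeM|apply: place0].
have c0 : c 0%N = 1.
  by rewrite /c /= [b 0%N]surjective_pairing b0; congr (_, _); rewrite /= ?mulVf ?mulr1.
have ci i : (0 < i)%N -> (c i).2 = 0 by rewrite /c; case: ifP => //= _ /bi ->; rewrite mulr0.
have cx : \sum_(i < n.+1) (c (n - i)%N).1 * x ^+ i = 0.
  rewrite (reindex_inj rev_ord_inj) /=.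
  have E : \sum_(i < n.+1) (c i).1 * x^-1 ^+ i = 0.
    move: bx; rewrite (big_ord_widen n.+1 (fun i => (b i).1 * x^-1 ^+ i)) // => h.
    transitivity ((b 0%N).1^-1 * 0); last exact: mulr0.
    rewrite -[in RHS]h [in RHS]big_mkcond mulr_sumr; apply: eq_bigr => i _.
    by rewrite /c ltnS; case: ifP => _ /=; rewrite ?mul0r ?mulr0 // mulrA.
  transitivity (x ^+ n * 0); last exact: mulr0.
  rewrite -[in RHS]E mulr_sumr; apply: eq_bigr => i _; rewrite subSS subKn -1?ltnS //.
  rewrite mulrCA; congr (_ * _).
  by rewrite exprVn; apply: expfB_le; rewrite // -ltnS.
apply: (IH n.-1 m x) => //.
  by rewrite -ltnS; apply: leq_trans nmN; rewrite -addSn prednK.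
exists (fun i => a i - a n * c (n - i)%N); rewrite prednK //; split.
- by move=> i; apply: placeB => //; apply: placeM.
- have : \sum_(i < n.+1) (a i - a n * c (n - i)%N).1 * x ^+ i = 0.
    transitivity (0 - (a n).1 * 0); last by rewrite mulr0 subrr.
    rewrite -[X in _ = X - _]ax -[X in _ = _ - _ * X]cx mulr_sumr -sumrB.
    by apply: eq_bigr => i _; rewrite /= mulrBl mulrA.
  rewrite big_ord_recr /= subnn c0 mulr1 subrr mul0r addr0.
  exact.
- by rewrite /= subn0 a0 ci // mulr0 subr0.
- by move=> i i0 /=; rewrite !ai // mul0r subr0.
Qed.

Lemma max_place_total x : (exists k, S (x, k)) \/ (exists k, S (x^-1, k)).
Proof.
apply: boolp.contrapT => h.
have x0 : x != 0.
  by apply/eqP => x0; apply: h; left; exists 0; rewrite x0; apply: place0.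
have [|n rn] := @place_relP x; first by move=> k Sk; apply: h; left; exists k.
have [|m rm] := @place_relP x^-1; first by move=> k Sk; apply: h; right; exists k.
exact: place_rel_absurd (leqnn _) x0 rn rm.
Qed.

End Maximal.

Lemma place_extend S0 : place S0 -> exists S,
  [/\ place S, forall z, S0 z -> S z,
      forall x k, S (x, k) -> k != 0 -> S (x^-1, k^-1)
    & forall x, (exists k, S (x, k)) \/ (exists k, S (x^-1, k))].
Proof.
(* Taking the union with [S0] inside [P] also covers the empty chain. *)
move=> pS0; pose P (X : E -> Prop) := place (fun z => S0 z \/ X z).
have [C CP totC|A [PA maxA]] := @classical_sets.Zorn_bigcup _ P.
  have mem2 x y : (S0 x \/ classical_sets.bigcup C id x) ->
      (S0 y \/ classical_sets.bigcup C id y) ->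
      (S0 x /\ S0 y) \/ exists2 X, C X & (S0 x \/ X x) /\ (S0 y \/ X y).
    move=> [x0|[X CX Xx]] [y0|[Y CY Yy]]; first by left.
    - by right; exists Y; tauto.
    - by right; exists X; tauto.
    - have [XY|YX] := totC X Y CX CY.
        by right; exists Y => //; split; right => //; apply: XY.
      by right; exists X => //; split; right => //; apply: YX.
  split.
  - by move=> c; left; apply: place_cst.
  - move=> x y hx hy; have [[x0 y0]|[X CX [x0 y0]]] := mem2 x y hx hy.
      by left; apply: placeB.
    by have [h|h] := placeB (CP X CX) x0 y0; [left|right; exists X].
  - move=> x y hx hy; have [[x0 y0]|[X CX [x0 y0]]] := mem2 x y hx hy.
      by left; apply: placeM.
    by have [h|h] := placeM (CP X CX) x0 y0; [left|right; exists X].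
  - move=> k [h|[X CX h]]; first exact: (place_fun pS0).
    by apply: (place_fun (CP X CX)); right.
exists (fun z => S0 z \/ A z).
have maxS S' : place S' -> (forall z, S0 z \/ A z -> S' z) ->
    forall z, S' z -> S0 z \/ A z.
  move=> pS' sub z S'z; apply: boolp.contrapT => h.
  apply: (maxA S').
    split=> [y Ay|sub']; first by apply: sub; right.
    by apply: h; right; apply: sub'.
  have S'E y : S0 y \/ S' y -> S' y by case=> // y0; apply: sub; left.
  split.
  - by move=> c; left; apply: place_cst.
  - by move=> x y /S'E hx /S'E hy; right; apply: placeB.
  - by move=> x y /S'E hx /S'E hy; right; apply: placeM.
  - by move=> k /S'E; apply: (place_fun pS').
split=> //; first by left.
  by move=> x k; apply: (max_placeV PA maxS).
exact: (max_place_total PA maxS).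
Qed.

End Place.

(** * Cartan and Bruhat decompositions *)

Lemma invmx_mul (F : fieldType) n (M N : 'M[F]_n) : M \in unitmx -> N \in unitmx ->
  invmx (M *m N) = invmx N *m invmx M.
Proof.
move=> uM uN; rewrite -[RHS]mul1mx -(@mulVmx _ _ (M *m N)) ?unitmx_mul ?uM //.
by rewrite -!mulmxA (mulmxA N) mulmxV // mul1mx mulmxV // mulmx1.
Qed.

Section Elimination.
Variables (F : fieldType) (n : nat).

(** These axioms make the matrices with [(i, j)] entry in [a i j] a ring. With a valuation ring in
    all positions, one elimination gives the Cartan decomposition; with vanishing conditions from a
    flag, the Bruhat decomposition. *)
Record entry_ideal (a : 'I_n -> 'I_n -> F -> Prop) : Prop := EntryIdeal {
  entry1 : forall i, a i i 1;
  entry0 : forall i j, a i j 0;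
  entryD : forall i j x y, a i j x -> a i j y -> a i j (x + y);
  entryN : forall i j x, a i j x -> a i j (- x);
  entryM : forall i k j x y, a i k x -> a k j y -> a i j (x * y) }.

Definition entry_unit (a : 'I_n -> 'I_n -> F -> Prop) (M : 'M[F]_n) : Prop :=
  [/\ M \in unitmx, forall i j, a i j (M i j) & forall i j, a i j (invmx M i j)].

Lemma entry_unit_mul a M N : entry_ideal a ->
  entry_unit a M -> entry_unit a N -> entry_unit a (M *m N).
Proof.
move=> ida [uM aM aM'] [uN aN aN'].
have H (A B : 'M[F]_n) : (forall i j, a i j (A i j)) -> (forall i j, a i j (B i j)) ->
    forall i j, a i j ((A *m B) i j).
  move=> hA hB i j; rewrite mxE; elim/big_ind: _ => [|x y|k _].
  - exact: entry0.
  - exact: entryD.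
  - exact: entryM.
split; [by rewrite unitmx_mul uM|exact: H|].
by rewrite invmx_mul //; apply: H.
Qed.

Lemma entry_unit_transv a (N : 'M[F]_n) : entry_ideal a ->
  (forall i j, a i j (N i j)) -> N *m N = 0 -> entry_unit a (1%:M + N).
Proof.
move=> ida aN NN.
have E : (1%:M + N) *m (1%:M - N) = 1%:M.
  by rewrite mulmxDl !mulmxBr mul1mx mulmx1 NN subr0 mul1mx subrK.
have [u _] := mulmx1_unit E.
have e1 i j : a i j (1%:M i j).
  by rewrite mxE; have [->|_] := eqVneq i j; [apply: entry1|apply: entry0].
split=> // i j; first by rewrite mxE; apply: entryD.
have -> : invmx (1%:M + N) = 1%:M - N.
  by rewrite -[RHS]mul1mx -[X in _ = X *m _](mulVmx u) -mulmxA E mulmx1.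
by rewrite mxE [X in _ + X]mxE; apply: entryD => //; apply: entryN.
Qed.

Definition monomial_rows (I : {set 'I_n}) (M : 'M[F]_n) := forall i, i \in I ->
  exists j, [/\ M i j != 0, forall j', j' != j -> M i j' = 0
            & forall i', i' != i -> M i' j = 0].

Variables aL aU : 'I_n -> 'I_n -> F -> Prop.
Hypotheses (idL : entry_ideal aL) (idU : entry_ideal aU).
Hypothesis pivot : forall (M : 'M[F]_n) (I : {set 'I_n}), M \in unitmx ->
  I != setT -> exists i0 j0, [/\ i0 \notin I, M i0 j0 != 0,
    forall k, k \notin I -> aL k i0 (M k j0 / M i0 j0)
  & forall j, aU j0 j (M i0 j / M i0 j0)].

Lemma elimination_step (M : 'M[F]_n) I : M \in unitmx -> I != setT -> monomial_rows I M ->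
  exists L U i0, [/\ entry_unit aL L, entry_unit aU U, i0 \notin I
                 & monomial_rows (i0 |: I) (L *m M *m U)].
Proof.
move=> uM IT fI; have [i0 [j0 [i0I p0 hL hU]]] := pivot uM IT.
set p := M i0 j0 in p0 hL hU.
pose NL : 'M[F]_n := \matrix_(k, l) if (l == i0) && (k != i0) then - (M k j0 / p) else 0.
pose NU : 'M[F]_n := \matrix_(l, j) if (l == j0) && (j != j0) then - (M i0 j / p) else 0.
have NLE (B : 'M[F]_n) k j :
    (NL *m B) k j = if k != i0 then - (M k j0 / p) * B i0 j else 0.
  rewrite mxE (bigD1 i0) //= big1 ?addr0 => [|l /negPf li]; rewrite mxE ?li ?mul0r //.
  by rewrite eqxx /=; case: ifP; rewrite ?mul0r.
have NUE (B : 'M[F]_n) i j :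
    (B *m NU) i j = if j != j0 then - (B i j0 * (M i0 j / p)) else 0.
  rewrite mxE (bigD1 j0) //= big1 ?addr0 => [|l /negPf li]; rewrite [NU _ _]mxE ?li ?mulr0 //.
  by rewrite eqxx /=; case: ifP; rewrite ?mulr0 ?mulrN.
have uL : entry_unit aL (1%:M + NL).
  apply: entry_unit_transv => // [k l|].
    rewrite mxE; case: ifP => [/andP [/eqP -> ki]|_]; last exact: entry0.
    apply: entryN => //; have [kI|] := boolP (k \in I); last exact: hL.
    (* A finished row [k] is zero in column [j0]: otherwise [j0] would be its pivot column, in which
       [M i0 j0] vanishes. *)
    have [j [Mkj h _]] := fI k kI.
    rewrite (h j0) ?mul0r; first exact: entry0.
    apply: contraNneq p0 => jj0; have [j' [Mj' _ h2]] := fI k kI.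
    have jj' : j' = j by apply: contraTeq (Mj') => ne; rewrite h // eqxx.
    by rewrite /p jj0 -jj' h2 // eq_sym.
  apply/matrixP => k l; rewrite NLE !mxE; case: ifP => // _.
  by rewrite eqxx andbF mulr0.
have uU : entry_unit aU (1%:M + NU).
  apply: entry_unit_transv => // [l j|].
    rewrite mxE; case: ifP => [/andP [/eqP -> ki]|_]; last exact: entry0.
    by apply: entryN.
  apply/matrixP => k l; rewrite NUE !mxE; case: ifP => // _.
  by rewrite eqxx andbF mul0r oppr0.
exists (1%:M + NL), (1%:M + NU), i0; split=> //.
have ME i j : ((1%:M + NL) *m M *m (1%:M + NU)) i j =
    if i == i0 then (if j == j0 then p else 0) else M i j - M i j0 / p * M i0 j.
  have LME i' j' : ((1%:M + NL) *m M) i' j' =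
      if i' != i0 then M i' j' - M i' j0 / p * M i0 j' else M i' j'.
    rewrite mulmxDl mul1mx mxE NLE; case: ifP => _; rewrite ?addr0 //.
    by rewrite mulNr.
  rewrite mulmxDr mulmx1 mxE NUE !LME.
  have [->|ii] := eqVneq i i0; rewrite /=.
    have [->|jj] := eqVneq j j0; first by rewrite addr0.
    by rewrite -/p mulrCA mulfV // mulr1 subrr.
  by rewrite -/p mulfVK // subrr mul0r oppr0 if_same addr0.
move=> i; rewrite in_setU1 => /predU1P [->|iI].
  exists j0; split=> [|j jj|i' ii]; rewrite ME ?eqxx //.
    by rewrite (negPf jj).
  by rewrite (negPf ii) -/p mulfVK // subrr.
have [j [Mij h1 h2]] := fI i iI.
have ii0 : i != i0 by apply: contraTneq iI => ->.
have M0j : M i0 j = 0 by apply: h2; rewrite eq_sym.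
have jj0 : j != j0 by apply: contraNneq p0 => e; rewrite /p -e M0j.
have Mij0 : M i j0 = 0 by apply: h1; rewrite eq_sym.
exists j; split=> [|j' jj|i' ii]; rewrite ME.
- by rewrite (negPf ii0) Mij0 !mul0r subr0.
- by rewrite (negPf ii0) Mij0 !mul0r subr0 h1.
- by case: ifP; rewrite ?(negPf jj0) // M0j mulr0 subr0 h2.
Qed.

Lemma monomial_elimination (M : 'M[F]_n) : M \in unitmx ->
  exists L U, [/\ entry_unit aL L, entry_unit aU U
    & exists (s : 'S_n) (d : 'I_n -> F), forall i j,
      (L *m M *m U) i j = if j == s i then d i else 0].
Proof.
move=> uM.
have e1 a : entry_ideal a -> entry_unit a 1%:M.
  move=> ida; rewrite -[1%:M]addr0; apply: entry_unit_transv; rewrite ?mul0mx //.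
  by move=> i j; rewrite mxE; apply: entry0.
have H k (I : {set 'I_n}) (N : 'M[F]_n) : (#|~: I| <= k)%N -> N \in unitmx ->
   monomial_rows I N -> exists L U, [/\ entry_unit aL L, entry_unit aU U
    & monomial_rows setT (L *m N *m U)].
  elim: k I N => [|k IH] I N cI uN fN.
    exists 1%:M, 1%:M; split; [exact: e1|exact: e1|rewrite mul1mx mulmx1].
    move: cI; rewrite leqn0 cards_eq0 => /eqP I0.
    by rewrite -(setCK I) I0 setC0 in fN.
  have [IT|IT] := eqVneq I setT.
    by exists 1%:M, 1%:M; split; [exact: e1|exact: e1|rewrite mul1mx mulmx1 -IT].
  have [L [U [i0 [uL uU i0I fLU]]]] := elimination_step uN IT fN.
  have [|||L' [U' [uL' uU' f']]] := IH (i0 |: I) (L *m N *m U) => //.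
  - rewrite -ltnS; apply: leq_trans cI; rewrite setCU [X in (_ < X)%N](cardsD1 i0).
    by rewrite in_setC i0I add1n ltnS setIC -setDE.
  - by rewrite !unitmx_mul uN; case: uL => -> _ _; case: uU => -> _ _.
  exists (L' *m L), (U *m U'); split; try exact: entry_unit_mul.
  by move: f'; rewrite !mulmxA.
have [||L [U [uL uU f]]] := H n set0 M _ uM.
- by rewrite setC0 cardsT card_ord.
- by move=> i; rewrite in_set0.
exists L, U; split=> //.
have /fin_all_exists [s hs] : forall i, exists j, [/\ (L *m M *m U) i j != 0,
   forall j', j' != j -> (L *m M *m U) i j' = 0
    & forall i', i' != i -> (L *m M *m U) i' j = 0].
  by move=> i; apply: f; rewrite in_setT.
have sI : injective s.
  move=> i i' e; apply: contraTeq isT => ne.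
  have [h1 _ _] := hs i'; have [_ _ h3] := hs i; move: h1.
  by rewrite -e h3 ?eqxx // eq_sym.
exists (perm sI), (fun i => (L *m M *m U) i (s i)) => i j; rewrite permE.
have [->//|ne] := eqVneq j (s i).
by have [_ -> //] := hs i.
Qed.

End Elimination.

Lemma total_min (T : eqType) (R : T -> T -> Prop) (s : seq T) :
  (forall x y, x \in s -> y \in s -> R x y \/ R y x) ->
  (forall x y z, R x y -> R y z -> R x z) ->
  s != [::] -> exists2 x, x \in s & forall y, y \in s -> R x y.
Proof.
move=> tot tr; elim: s tot => [//|x s IH] tot _.
have xx : R x x by case: (tot x x); rewrite ?mem_head.
have [->|s0] := eqVneq s [::].
  by exists x; rewrite ?mem_head // => y; rewrite inE => /eqP ->.
have [|z zs hz] := IH _ s0.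
  by move=> y z ys zs; apply: tot; rewrite in_cons ?ys ?zs orbT.
have [xz|zx] := tot x z (mem_head _ _) (mem_behead (s := x :: s) zs).
  exists x; rewrite ?mem_head // => y; rewrite in_cons => /predU1P [->//|/hz].
  exact: tr.
exists z; first by rewrite in_cons zs orbT.
by move=> y; rewrite in_cons => /predU1P [->|/hz].
Qed.

Lemma unitmx_row_neq0 (F : fieldType) n (M : 'M[F]_n) i :
  M \in unitmx -> exists j, M i j != 0.
Proof.
move=> uM; apply/existsP; apply: contraT; rewrite negb_exists => /forallP h.
have := congr1 (fun N : 'M[F]_n => N i i) (mulmxV uM).
rewrite /= !mxE eqxx big1 => [/eqP|j _]; first by rewrite eq_sym oner_eq0.
by have := h j; rewrite negbK => /eqP ->; rewrite mul0r.
Qed.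

(* Smith form over a valuation ring. *)
Lemma cartan (F : fieldType) n (R : F -> Prop) :
  R 1 -> (forall x y, R x -> R y -> R (x - y)) -> (forall x y, R x -> R y -> R (x * y)) ->
  (forall x, R x \/ R x^-1) ->
  forall A : 'M[F]_n, A \in unitmx -> exists L U (x : 'rV[F]_n),
    [/\ entry_unit (fun _ _ => R) L, entry_unit (fun _ _ => R) U
      & L *m A *m U = diag_mx x].
Proof.
move=> R1 RB RM Rtot A uA.
have R0 : R 0 by rewrite -(subrr 1); apply: RB.
have RN x : R x -> R (- x) by move=> Rx; rewrite -sub0r; apply: RB.
have RD x y : R x -> R y -> R (x + y) by move=> Rx Ry; rewrite -[y]opprK; auto.
have idR : entry_ideal (fun _ _ : 'I_n => R) by split.
have [M I uM IT|L [U [uL uU [s [d LU]]]]] := @monomial_elimination F n _ _ idR idR _ A uA.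
  (* Divisibility is total in a valuation ring, so some nonzero entry of the remaining rows divides
     all the others; it is the pivot. *)
  pose s := [seq ij <- enum {: 'I_n * 'I_n} | (ij.1 \notin I) && (M ij.1 ij.2 != 0)].
  have ms ij : (ij \in s) = (ij.1 \notin I) && (M ij.1 ij.2 != 0).
    by rewrite mem_filter mem_enum andbT.
  have [| | |[i0 j0]] := @total_min _ (fun x y => M x.1 x.2 != 0 /\ R (M y.1 y.2 / M x.1 x.2)) s.
  - move=> x y; rewrite !ms => /andP [_ x0] /andP [_ y0].
    have [h|h] := Rtot (M y.1 y.2 / M x.1 x.2); first by left.
    by right; split=> //; rewrite -invf_div.
  - move=> x y z [x0 h] [y0 h']; split=> //; have := RM _ _ h' h.
    by rewrite mulrA mulfVK.
  - have [i iI] : exists i, i \notin I.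
      by apply/existsP; apply: contraNT IT; rewrite negb_exists => /forallP h;
         apply/eqP/setP => i; rewrite in_setT; have := h i; rewrite negbK.
    have [j Mij] := unitmx_row_neq0 i uM.
    have : (i, j) \in s by rewrite ms iI.
    by case: s {ms}.
  rewrite ms => /andP [/= i0I p0] h; exists i0, j0; split=> //.
    move=> k kI; have [->|h0] := eqVneq (M k j0) 0; first by rewrite mul0r.
    by have [|_] := h (k, j0); rewrite ?ms /= ?kI ?h0.
  move=> j; have [->|h0] := eqVneq (M i0 j) 0; first by rewrite mul0r.
  by have [|_] := h (i0, j); rewrite ?ms /= ?i0I ?h0.
exists L, (U *m perm_mx (s^-1)%g), (\row_i d i); split=> //.
  have ep (t : 'S_n) i j : R (perm_mx t i j).
    by rewrite !mxE; case: (_ == _).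
  apply: entry_unit_mul => //; split; first exact: unitmx_perm.
    by move=> i j; apply: ep.
  move=> i j; rewrite -[invmx _]mulmx1 -(perm_mx1 F n) -(mulVg s) perm_mxM mulmxA.
  by rewrite mulVmx ?unitmx_perm // mul1mx; apply: ep.
rewrite mulmxA; apply/matrixP => i j; rewrite mxE (bigD1 (s i)) //= big1 ?addr0.
  by rewrite LU eqxx !mxE permK; case: (i == j); rewrite ?mulr1 ?mulr0.
by move=> k ks; rewrite LU (negPf ks) mul0r.
Qed.

Definition flag_unit (F : fieldType) (T : realDomainType) n (a : 'I_n -> T) :=
  entry_unit (fun (i j : 'I_n) (x : F) => x != 0 -> a i <= a j).

(* Bruhat decomposition for the flags of [a] and [b], whose weights need not be sorted. *)
Lemma bruhat (F : fieldType) (T : realDomainType) n (a b : 'I_n -> T) (M : 'M[F]_n) :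
  M \in unitmx -> exists L U,
    [/\ flag_unit a L, flag_unit b U
    & exists (s : 'S_n) (d : 'I_n -> F), forall i j,
      (L *m M *m U) i j = if j == s i then d i else 0].
Proof.
have id0 (c : 'I_n -> T) : entry_ideal (fun (i j : 'I_n) (x : F) => x != 0 -> c i <= c j).
  split=> //.
  - by move=> i j; rewrite eqxx.
  - move=> i j x y hx hy; have [->|//] := eqVneq x 0; last by move=> /hx.
    by rewrite add0r.
  - by move=> i j x; rewrite oppr_eq0.
  - move=> i k j x y hx hy; rewrite mulf_eq0 negb_or => /andP [/hx h1 /hy].
    exact: le_trans.
move=> uM; apply: monomial_elimination => // {uM M} M I uM IT.
have [i iI] : exists i, i \notin I.
  by apply/existsP; apply: contraNT IT; rewrite negb_exists => /forallP h;
     apply/eqP/setP => i; rewrite in_setT; have := h i; rewrite negbK.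
have [j Mij] := unitmx_row_neq0 i uM.
(* The pivot column minimizes [b] among those with a nonzero entry in the remaining rows, and the
   pivot row then maximizes [a] within this column; so all row and column operations respect the
   flags. *)
pose P j := [exists i, (i \notin I) && (M i j != 0)].
have Pj : P j by apply/existsP; exists i; rewrite iI.
have [j0 /existsP [i1 /andP [i1I Mi1]] jmin] := arg_minP b Pj.
pose Q i := (i \notin I) && (M i j0 != 0).
have Q1 : Q i1 by rewrite /Q i1I.
have [i0 /andP [i0I p0] imax] := @arg_maxP _ T _ _ Q a Q1.
exists i0, j0; split=> // [k kI|j1]; rewrite mulf_eq0 negb_or => /andP [h _].
  by apply: imax; rewrite /Q kI.
by apply: jmin; apply/existsP; exists i0; rewrite i0I.
Qed.

(** * A theorem of the alternative over the integers *)

Section Farkas.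
Variable n : nat.
Local Notation V := 'rV[int]_n.
Implicit Types (s : seq V) (a b x v : V).

Definition dot a x : int := \sum_i a 0 i * x 0 i.

Lemma dotDl a b x : dot (a + b) x = dot a x + dot b x.
Proof. by rewrite /dot -big_split; apply: eq_bigr => i _; rewrite mxE mulrDl. Qed.

Lemma dotDr a x v : dot a (x + v) = dot a x + dot a v.
Proof. by rewrite /dot -big_split; apply: eq_bigr => i _; rewrite mxE mulrDr. Qed.

Lemma dotZl c a x : dot (c *: a) x = c * dot a x.
Proof. by rewrite /dot mulr_sumr; apply: eq_bigr => i _; rewrite mxE mulrA. Qed.

Lemma dotZr c a x : dot a (c *: x) = c * dot a x.
Proof. by rewrite /dot mulr_sumr; apply: eq_bigr => i _; rewrite mxE mulrCA. Qed.

Lemma dotNr a x : dot a (- x) = - dot a x.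
Proof. by rewrite -scaleN1r dotZr mulN1r. Qed.

Fixpoint cone s v : Prop :=
  if s is x :: s' then exists c : nat, cone s' (v - x *+ c) else v = 0.

(** This lifts a relation between projected vectors back to the original ones, up to a multiple of
    [x]. *)
Lemma cone_shift s x (q : nat) (h : V -> nat) v :
  cone [seq y *+ q + x *+ h y | y <- s] v -> exists c, cone s (v - x *+ c).
Proof.
elim: s v => [|y s IH] v /=; first by move=> ->; exists 0%N; rewrite subr0.
move=> [c /IH [c' hc']]; exists (h y * c + c')%N, (q * c)%N.
move: hc'; congr cone; rewrite mulrnDl mulrnDr -!mulrnA opprD.
by rewrite addrAC !opprD !addrA [in RHS]addrAC (addrAC (v - _)).
Qed.

(* Gale's form of the theorem of the alternative, over the integers: the induction
   eliminates [x] by projecting along it. *)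
Lemma farkas s b : (exists2 k : nat, (0 < k)%N & cone s (b *+ k)) \/
  (exists a, (forall x, x \in s -> 0 <= dot a x) /\ dot a b < 0).
Proof.
move: {2}(size s) (erefl (size s)) b => N; elim: N s => [|N IH] [|x s] //=.
  move=> _ b; have [->|b0] := eqVneq b 0; first by left; exists 1%N; rewrite ?mul0rn.
  right; exists (- b); split=> //; rewrite -scaleN1r dotZl mulN1r oppr_lt0.
  rewrite /dot lt_neqAle eq_sym; apply/andP; split; last first.
    by apply: sumr_ge0 => i _; rewrite -expr2 sqr_ge0.
  apply: contraNN b0 => /eqP/psumr_eq0P h; apply/eqP/rowP => i; rewrite mxE.
  have /eqP := h (fun i _ => sqr_ge0 (b 0 i)) i isT.
  by rewrite mulf_eq0 orbb => /eqP.
move=> [sN] b; have [[k k0 hk]|[a [ha ab]]] := IH s sN b.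
  by left; exists k => //; exists 0%N; rewrite subr0.
have [ax|ax] := leP 0 (dot a x).
  by right; exists a; split=> // y; rewrite in_cons => /predU1P [->|/ha].
(* The absolute values are [q = - dot a x], [h y = dot a y] on [s] and [h b = - dot a b]. The
   vectors of the recursive call are therefore [q] times the projections along [x] to the hyperplane
   where [a] vanishes. *)
pose q := `|dot a x|%N; pose h y := `|dot a y|%N.
have qE : q%:Z = - dot a x by rewrite /q -abszN gez0_abs // oppr_ge0 ltW.
have bE : (h b)%:Z = - dot a b by rewrite /h -abszN gez0_abs // oppr_ge0 ltW.
have q0 : (0 < q)%N by rewrite -ltz_nat qE oppr_gt0.
have nZ (v : V) (c : nat) : v *+ c = c%:Z *: v by rewrite -scaler_nat natz.
have [|[k k0 hk]|[a' [ha' ab']]] := IH [seq y *+ q + x *+ h y | y <- s] _ (b *+ q - x *+ h b).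
- by rewrite size_map.
- have [c hc] := cone_shift hk; left; exists (q * k)%N; first by rewrite muln_gt0 q0.
  exists (h b * k + c)%N; move: hc; congr cone.
  by rewrite mulrnBl -!mulrnA mulrnDr opprD addrA.
(* This functional vanishes at [x] and takes at [y] the value of [a'] at the scaled projection of
   [y]. *)
right; exists (q%:Z *: a' + dot a' x *: a); split=> [y|].
  rewrite in_cons => /predU1P [->|ys]; rewrite dotDl !dotZl.
    by rewrite qE mulrC mulrN addNr.
  have := ha' _ (map_f _ ys); rewrite dotDr !nZ !dotZr.
  by rewrite /h gez0_abs ?ha // (mulrC (dot a y)).
move: ab'; rewrite dotDr dotNr !nZ !dotZr bE mulNr opprK dotDl !dotZl.
by rewrite (mulrC (dot a b)).
Qed.

(** In the application, [pos] and [spos] say that the value of a character of the torus lies in the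
    valuation ring, or reduces to 0. For [x] in [s1], a positive multiple of [- x] in the cone would
    put 0 in [spos]; the functionals obtained for the various [x] are added. *)
Lemma motzkin (pos spos : V -> Prop) (s1 s2 : seq V) :
  pos 0 -> (forall u v, pos u -> pos v -> pos (u + v)) ->
  (forall u v, spos u -> pos v -> spos (u + v)) -> (forall u, spos u -> pos u) ->
  ~ spos 0 -> (forall x, x \in s1 -> spos x) -> (forall x, x \in s2 -> pos x) ->
  exists a, (forall x, x \in s1 -> 0 < dot a x) /\ (forall x, x \in s2 -> 0 <= dot a x).
Proof.
move=> pos0 posD sposD sp s0 h1 h2.
have pos12 x : x \in s1 ++ s2 -> pos x.
  by rewrite mem_cat => /orP [/h1/sp|/h2].
have posn x k : pos x -> pos (x *+ k).
  by move=> px; elim: k => [|k IH]; rewrite ?mulr0n // mulrS; apply: posD.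
have posc s v : (forall x, x \in s -> pos x) -> cone s v -> pos v.
  elim: s v => [|x s IH] v hs /=; first by move=> ->.
  move=> [c hc]; rewrite -(subrK (x *+ c) v); apply: posD.
    by apply: IH hc => y ys; apply: hs; rewrite in_cons ys orbT.
  by apply: posn; apply: hs; rewrite mem_head.
have A x : x \in s1 -> exists a, (forall y, y \in s1 ++ s2 -> 0 <= dot a y) /\ 0 < dot a x.
  move=> xs; have [[k k0 hk]|[a [ha ax]]] := farkas (s1 ++ s2) (- x); last first.
    by exists a; split=> //; rewrite -oppr_lt0 -dotNr.
  case: s0; have := posc _ _ pos12 hk; case: k k0 {hk} => // k _ hp.
  rewrite -(subrr (x *+ k.+1)) -mulNrn; apply: (sposD (x *+ k.+1) (- x *+ k.+1)) => //.
  by rewrite mulrS; apply: (sposD x (x *+ k)); [apply: h1|apply/posn/sp/h1].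
have B s : (forall x, x \in s -> x \in s1) -> exists a,
    (forall y, y \in s1 ++ s2 -> 0 <= dot a y) /\ (forall x, x \in s -> 0 < dot a x).
  elim: s => [|x s IH] hs.
    by exists 0; split=> // y _; rewrite /dot big1 // => i _; rewrite mxE mul0r.
  have [|a [a1 a2]] := IH; first by move=> y ys; apply: hs; rewrite in_cons ys orbT.
  have xs1 : x \in s1 by apply: hs; rewrite mem_head.
  have [a' [a1' a2']] := A x xs1; exists (a + a'); split=> y ys; rewrite dotDl.
    by rewrite addr_ge0 ?a1 ?a1'.
  move: ys; rewrite in_cons => /predU1P [->|ys].
    by rewrite ltr_wpDl // a1 // mem_cat xs1.
  by rewrite ltr_pwDl ?a2 // a1' // mem_cat hs // in_cons ys orbT.
have [//|a [a1 a2]] := B s1; exists a; split=> // x xs.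
by apply: a1; rewrite mem_cat xs orbT.
Qed.

End Farkas.

(** * Polynomial functions at a generic translate *)

Lemma map_mpoly_comp_ext (R1 R2 R3 : nzRingType) (v : {rmorphism R1 -> R2})
    (u : {rmorphism R2 -> R3}) (w : {rmorphism R1 -> R3}) n (h : {mpoly R1[n]}) :
  (forall c, u (v c) = w c) -> map_mpoly u (map_mpoly v h) = map_mpoly w h.
Proof. by move=> uv; apply/mpolyP => m; rewrite !mcoeff_map_mpoly; apply: uv. Qed.

Lemma map_mx_comp_ext (R1 R2 R3 : Type) (v : R1 -> R2)
    (u : R2 -> R3) (w : R1 -> R3) m n (A : 'M[R1]_(m, n)) :
  (forall c, u (v c) = w c) -> map_mx u (map_mx v A) = map_mx w A.
Proof. by move=> uv; apply/matrixP => i j; rewrite !mxE; apply: uv. Qed.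

(* When [eps * \det Y = D] is invertible, [phi] is [D ^ (d N)] times the value of [Q] on
   the coefficients of [h] moved by [Y *m diag(1, .., 1, D^-1)], a matrix of determinant
   [eps^-1]; clearing denominators makes it polynomial in [Y]. *)
HB.lock Definition phi (K : fieldType) (n' d k : nat) (ms : k.-tuple 'X_{1..n'.+1})
    (Q : {mpoly K[k]}) (L : comNzRingType) (kap : {rmorphism K -> L}) (eps : L)
    (h : {mpoly L[n'.+1]}) (Y : 'M[L]_n'.+1) : L :=
  let D := eps * \det Y in
  \sum_(nu <- msupp Q) kap Q@_nu *
    (\prod_i ((act Y h)@_(tnth ms i) * D ^+ (d - tnth ms i ord_max)) ^+ nu i) *
    (D ^+ d) ^+ (msize Q - mdeg nu).
Arguments phi {K n'} d {k} ms Q {L} kap eps h Y.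

Definition genmx n' (L : comNzRingType) : 'M[{mpoly L[n'.+1 * n'.+1]}]_n'.+1 :=
  \matrix_(i, j) 'X_(mxvec_index i j).

(* [phi] at [A *m Y] with [Y] generic; keeping [A] apart from [Y] turns a rescaling of the
   columns of [A] into one of the coefficients ([mcoeff_Phi_diag]). *)
HB.lock Definition Phi (K : fieldType) (n' d k : nat) (ms : k.-tuple 'X_{1..n'.+1})
    (Q : {mpoly K[k]}) (L : comNzRingType) (kap : {rmorphism K -> L}) (eps : L)
    (h : {mpoly L[n'.+1]}) (A : 'M[L]_n'.+1) : {mpoly L[n'.+1 * n'.+1]} :=
  phi d ms Q (@mpolyC (n'.+1 * n'.+1) L \o kap) eps%:MP
    (map_mpoly (@mpolyC (n'.+1 * n'.+1) L) h)
    (map_mx (@mpolyC (n'.+1 * n'.+1) L) A *m genmx n' L).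
Arguments Phi {K n'} d {k} ms Q {L} kap eps h A.

Section Phi.
Variables (K : fieldType) (n' d k : nat) (ms : k.-tuple 'X_{1..n'.+1}) (Q : {mpoly K[k]}).
Local Notation n := n'.+1.
Local Notation genmx := (genmx n' _).
Local Notation phi := (phi d ms Q).
Local Notation Phi := (Phi d ms Q).

Definition qval (L : comNzRingType) (kap : {rmorphism K -> L}) (h : {mpoly L[n]}) : L :=
  mmap kap (fun i => h@_(tnth ms i)) Q.

Lemma phi_map (L L' : comNzRingType) (u : {rmorphism L -> L'})
    (kap : {rmorphism K -> L}) (kap' : {rmorphism K -> L'}) eps h Y :
    (forall c, u (kap c) = kap' c) ->
  u (phi kap eps h Y) = phi kap' (u eps) (map_mpoly u h) (map_mx u Y).
Proof.
move=> uk; rewrite phi.unlock rmorph_sum /=; apply: eq_bigr => nu _.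
rewrite !rmorphM /= uk !rmorphXn rmorphM /= -det_map_mx; congr (_ * _ * _).
rewrite rmorph_prod; apply: eq_bigr => i _.
by rewrite rmorphXn rmorphM /= rmorphXn rmorphM /= -det_map_mx -map_act mcoeff_map_mpoly.
Qed.

Lemma phi_congr (L : comNzRingType) (kap : {rmorphism K -> L}) eps eps' h h' Y Y' :
  eps = eps' -> h = h' -> Y = Y' -> phi kap eps h Y = phi kap eps' h' Y'.
Proof. by move=> -> -> ->. Qed.

Section Ring.
Variables (L : comNzRingType) (kap : {rmorphism K -> L}).
Implicit Types (eps : L) (h : {mpoly L[n]}) (A Y : 'M[L]_n).

Lemma phi_act eps h A Y : phi kap (eps * \det A) (act A h) Y = phi kap eps h (A *m Y).
Proof. by rewrite phi.unlock act_comp det_mulmx mulrA. Qed.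

Lemma phi_det1 eps h Y : eps * \det Y = 1 -> phi kap eps h Y = qval kap (act Y h).
Proof.
move=> e; rewrite phi.unlock /qval e /mmap; apply: eq_bigr => nu _.
rewrite !expr1n mulr1; congr (_ * _); apply: eq_bigr => i _.
by rewrite expr1n mulr1.
Qed.

Lemma phi_sub (S : L -> Prop) eps h Y : subring_pred S -> (forall c, S (kap c)) ->
  S eps -> coef_in S h -> (forall i j, S (Y i j)) -> S (phi kap eps h Y).
Proof.
move=> sS Sk Se Sh SY.
have SD : S (eps * \det Y) by apply: (sub_M sS) => //; apply: sub_det.
rewrite phi.unlock; apply: (sub_sum sS) => nu _; apply: (sub_M sS); last by apply/(sub_exp sS)/(sub_exp sS).
apply: (sub_M sS) => //; apply: (sub_prod sS) => i _; apply/(sub_exp sS)/(sub_M sS).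
  exact: coef_in_act.
exact: (sub_exp sS).
Qed.

End Ring.

Section Generic.
Variables (L : comNzRingType) (kap : {rmorphism K -> L}).
Implicit Types (eps : L) (h : {mpoly L[n]}) (A Y : 'M[L]_n).

Lemma Phi_meval eps h A Y :
  (Phi kap eps h A).@[fun l => mxvec Y 0 l] = phi kap eps h (A *m Y).
Proof.
rewrite Phi.unlock (@phi_map _ _ (@meval (n * n) L (fun l => mxvec Y 0 l)) _ kap) => [|c]; last first.
  by rewrite /= mevalC.
apply: phi_congr; first by rewrite /= mevalC.
  by apply/mpolyP => m; rewrite !mcoeff_map_mpoly /= mevalC.
rewrite map_mxM; congr (_ *m _); apply/matrixP => i j; rewrite !mxE /=.
  by rewrite mevalC.
by rewrite mevalXU mxvecE.
Qed.

Lemma Phi_comp eps h A q : Phi kap eps h (A *m q) =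
  Phi kap eps h A \mPo [tuple mxvec (map_mx (@mpolyC (n * n) L) q *m genmx) 0 l | l < n * n].
Proof.
set t := [tuple _ | _ < _].
rewrite Phi.unlock (@phi_map _ _ (comp_mpoly t) _ (@mpolyC (n * n) L \o kap)) => [|c]; last first.
  by rewrite /= comp_mpolyC.
have tC c : comp_mpoly t c%:MP_[n * n] = c%:MP_[n * n] by apply: comp_mpolyC.
apply: phi_congr; first by rewrite [RHS]tC.
  by apply/esym; apply: map_mpoly_comp_ext; apply: tC.
rewrite !map_mxM -mulmxA; congr (_ *m _).
  by apply/esym; apply: map_mx_comp_ext; apply: tC.
apply/matrixP => i j; rewrite [RHS]mxE [genmx i j]mxE.
by rewrite [RHS]comp_mpolyXU -tnth_nth tnth_mktuple mxvecE.
Qed.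

(** Moving [A] between the form and the matrix multiplies the normalizing determinant by [\det A];
    the parameter [eps] exists to absorb this factor. *)
Lemma Phi_act eps h A B : Phi kap (eps * \det A) (act A h) B = Phi kap eps h (A *m B).
Proof.
rewrite Phi.unlock map_act map_mxM -mulmxA -[RHS]phi_act; apply: phi_congr => //.
by rewrite det_map_mx rmorphM.
Qed.

Lemma Phi_sub (S : L -> Prop) eps h A : subring_pred S -> (forall c, S (kap c)) ->
  S eps -> coef_in S h -> (forall i j, S (A i j)) -> coef_in S (Phi kap eps h A).
Proof.
move=> sS Sk Se Sh SA; have sC := coef_in_subring sS (n * n).
rewrite Phi.unlock; apply: (phi_sub sC) => [c|||i j].
- exact: coef_inC.
- exact: coef_inC.
- by move=> m; rewrite mcoeff_map_mpoly; apply: coef_inC.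
- rewrite mxE; apply: (sub_sum sC) => l _; apply: (sub_M sC); rewrite mxE.
    exact: coef_inC.
  exact: coef_inX.
Qed.

End Generic.

Lemma Phi_map (L L' : comNzRingType) (u : {rmorphism L -> L'})
    (kap : {rmorphism K -> L}) (kap' : {rmorphism K -> L'}) eps h A :
    (forall c, u (kap c) = kap' c) ->
  map_mpoly u (Phi kap eps h A) = Phi kap' (u eps) (map_mpoly u h) (map_mx u A).
Proof.
move=> uk; rewrite Phi.unlock (@phi_map _ _ (map_mpoly u) _ (@mpolyC (n * n) L' \o kap')) => [|c].
  have uC c : map_mpoly u c%:MP_[n * n] = (u c)%:MP_[n * n] by apply: map_mpolyC.
  apply: phi_congr; first exact: uC.
    transitivity (map_mpoly (@mpolyC (n * n) L' \o u) h).
      by apply: map_mpoly_comp_ext; apply: uC.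
    by apply/esym; apply: map_mpoly_comp_ext.
  rewrite map_mxM; congr (_ *m _).
    transitivity (map_mx (@mpolyC (n * n) L' \o u) A).
      by apply: map_mx_comp_ext; apply: uC.
    by apply/esym; apply: map_mx_comp_ext.
  apply/matrixP => i j; rewrite [LHS]mxE ![genmx _ _]mxE; exact: map_mpolyX.
by rewrite [LHS]map_mpolyC; congr (mpolyC _ _); apply: uk.
Qed.

Section Weights.
Variable T : realDomainType.

(** A one-parameter subgroup inserted between [A] and the generic matrix multiplies row [i] of the
    latter by [t ^ a i]; hence the same weight on all variables of a row. *)
Definition roww (a : 'I_n -> T) : 'I_(n * n) -> T :=
  fun l => mxvec (\matrix_(i < n, j < n) a i) 0 l.

Lemma rowwE a i j : roww a (mxvec_index i j) = a i.
Proof. by rewrite /roww mxvecE mxE. Qed.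

Lemma wge_Phi (L : comNzRingType) (kap : {rmorphism K -> L}) eps h A (q : 'M[L]_n) (a a' : 'I_n -> T) c :
  (forall i j, q i j != 0 -> a i <= a' j) -> wge (roww a) c (Phi kap eps h A) ->
  wge (roww a') c (Phi kap eps h (A *m q)).
Proof.
move=> qa wP; rewrite Phi_comp; apply: wge_comp wP _ => l; rewrite tnth_mktuple.
case/mxvec_indexP: l => i j; rewrite mxvecE rowwE mxE; apply: wge_sum => l _.
rewrite !mxE mul_mpolyC; have [->|/qa le] := eqVneq (q i l) 0.
  by rewrite scale0r; apply: wge0.
apply/wgeZ/(wge_le le); rewrite -(rowwE a' l j); exact: wgeX.
Qed.

End Weights.

Lemma mcoeff_Phi_diag (L : comNzRingType) (kap : {rmorphism K -> L}) eps h A (x : 'rV[L]_n) mu :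
  (Phi kap eps h (A *m diag_mx x))@_mu =
  (Phi kap eps h A)@_mu * \prod_l (mxvec (\matrix_(i < n, j < n) x 0 i) 0 l) ^+ mu l.
Proof.
rewrite Phi_comp -mcoeff_scale; congr ((_ \mPo _)@_mu); apply/eq_from_tnth => l.
rewrite !tnth_mktuple; case/mxvec_indexP: l => i j; rewrite !mxvecE !mxE.
rewrite (bigD1 i) //= big1 ?addr0 => [|l li]; rewrite !mxE ?eqxx ?mulr1n ?mul_mpolyC //.
by rewrite eq_sym (negPf li) mulr0n scale0r.
Qed.

Definition normmx (L : fieldType) (eps : L) (Y : 'M[L]_n) : 'M[L]_n :=
  Y *m diag_mx (\row_i if i == ord_max then (eps * \det Y)^-1 else 1).

Lemma det_normmx (L : fieldType) (eps : L) Y :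
  eps * \det Y != 0 -> \det (normmx eps Y) = eps^-1.
Proof.
rewrite mulf_eq0 negb_or => /andP [e0 dY0]; rewrite det_mulmx det_diag (bigD1 ord_max) //=.
rewrite mxE eqxx big1 ?mulr1 => [|i /negPf ni]; last by rewrite mxE ni.
by rewrite invfM mulrCA mulfV ?mulr1.
Qed.

Lemma phi_field (L : fieldType) (kap : {rmorphism K -> L}) eps h Y :
  h \is d.-homog -> eps * \det Y != 0 ->
  phi kap eps h Y = (eps * \det Y) ^+ (d * msize Q) * qval kap (act (normmx eps Y) h).
Proof.
move=> hd; set D := eps * \det Y => D0.
pose x : 'rV[L]_n := \row_i if i == ord_max then D^-1 else 1.
rewrite -[normmx eps Y]/(Y *m diag_mx x).
have valE i : (act Y h)@_(tnth ms i) * D ^+ (d - tnth ms i ord_max) =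
    (act (Y *m diag_mx x) h)@_(tnth ms i) * D ^+ d.
  rewrite -(act_comp Y (diag_mx x)) (mcoeff_act_diag x (act Y h)) (bigD1 ord_max) //= mxE eqxx.
  rewrite big1 ?mulr1 => [|j /negPf nj]; last by rewrite mxE nj expr1n.
  have [->|h0] := eqVneq ((act Y h)@_(tnth ms i)) 0; first by rewrite !mul0r.
  rewrite -mulrA; congr (_ * _).
  (* Homogeneity bounds the exponent of the last variable, so that the subtraction
     [d - tnth ms i ord_max] is not truncated. *)
  have le : (tnth ms i ord_max <= d)%N.
    have /dhomogP/(_ (tnth ms i)) := act_homog Y hd.
    by rewrite mcoeff_msupp => /(_ h0) <-; rewrite /= mdegE (bigD1 ord_max) //= leq_addr.
  by rewrite -[in RHS](subnK le) exprD exprVn mulrCA mulVf ?mulr1 // expf_neq0.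
rewrite phi.unlock /qval -/D /mmap mulr_sumr big_seq_cond [RHS]big_seq_cond; apply: eq_bigr => nu.
rewrite andbT => nuQ; rewrite [RHS]mulrCA -mulrA; congr (_ * _).
under eq_bigr do rewrite valE exprMn.
rewrite big_split /= -mulrA mulrC; congr (_ * _).
rewrite prodrXr -mdegE exprM -exprD subnKC //.
by apply: ltnW; apply: msize_mdeg_lt.
Qed.

End Phi.

(** * Orbits are open in their closure *)

Section OrbitClosure.
Variables (K : closedFieldType) (n' d : nat).
Local Notation n := n'.+1.
Implicit Types (f g h : {mpoly K[n]}) (F G : {mpoly K[n]} -> K).

Lemma Phi_orbit k (ms : k.-tuple 'X_{1..n}) (Q : {mpoly K[k]}) f :
  Phi d ms Q (@idfun K) 1 f 1%:M = 0 ->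
  forall h, sl_orbit f h -> Q.@[fun i => h@_(tnth ms i)] = 0.
Proof.
move=> P0 _ /sl_orbitP [A [dA ->]].
have := Phi_meval d ms Q idfun 1 f 1%:M A; rewrite P0 meval0 mul1mx => e.
suff : qval ms Q (@idfun K) (act A f) = 0 by [].
by rewrite -(@phi_det1 _ _ d _ ms Q _ idfun 1 f A) ?mul1r // -e.
Qed.

Lemma meval_det_genmx v : (\det (genmx n' K)).@[v] = \det (vec_mx (\row_l v l) : 'M[K]_n).
Proof.
rewrite -(det_map_mx (meval v)); congr (\det _); apply/matrixP => i j.
by rewrite !mxE /= mevalXU.
Qed.

Lemma det_genmx_neq0 : \det (genmx n' K) != 0.
Proof.
apply: contraTneq isT => e.
have := meval_det_genmx (fun l => mxvec (1%:M : 'M[K]_n) 0 l); rewrite e meval0.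
rewrite (_ : \row_l _ = mxvec 1%:M); last by apply/rowP => l; rewrite mxE.
by rewrite mxvecK det1 => /esym/eqP; rewrite oner_eq0.
Qed.

Lemma Phi_nonroot k (ms : k.-tuple 'X_{1..n}) (Q : {mpoly K[k]}) eps f p :
  Phi d ms Q (@idfun K) eps f 1%:M != 0 -> p != 0 -> exists Y : 'M[K]_n,
    [/\ phi d ms Q (@idfun K) eps f Y != 0, \det Y != 0 & p.@[fun l => mxvec Y 0 l] != 0].
Proof.
move=> p1 p2; have [v] := mpoly_nonroot (mulf_neq0 (mulf_neq0 p1 p2) det_genmx_neq0).
pose Y : 'M[K]_n := vec_mx (\row_l v l).
have vE : v =1 (fun l => mxvec Y 0 l) by move=> l; rewrite /Y vec_mxK mxE.
rewrite !mevalM meval_det_genmx -/Y !mulf_eq0 !negb_or => /andP [/andP [h1 h2] dY].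
by exists Y; split=> //; [move: h1|move: h2]; rewrite !(meval_eq _ vE) // Phi_meval mul1mx.
Qed.

(* [SL_n] is irreducible, being the image of [GL_n] under [normmx]. *)
Lemma orbit_irreducible f F G : f \is d.-homog -> polyfun F -> polyfun G ->
  (exists2 h, sl_orbit f h & F h != 0) -> (exists2 h, sl_orbit f h & G h != 0) ->
  exists2 h, sl_orbit f h & (F h != 0) && (G h != 0).
Proof.
move=> fd [k1 [ms1 [Q1 F1]]] [k2 [ms2 [Q2 F2]]] [h1 o1 nh1] [h2 o2 nh2].
have p1 : Phi d ms1 Q1 idfun 1 f 1%:M != 0.
  by apply: contraNneq nh1 => /Phi_orbit p0; rewrite F1 p0.
have p2 : Phi d ms2 Q2 idfun 1 f 1%:M != 0.
  by apply: contraNneq nh2 => /Phi_orbit p0; rewrite F2 p0.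
have [Y [h1' dY]] := Phi_nonroot p1 p2.
rewrite Phi_meval mul1mx => h2'.
have D0 : 1 * \det Y != 0 by rewrite mul1r.
exists (act (normmx 1 Y) f).
  by apply: sl_orbit_act; rewrite det_normmx // invr1.
move: h1' h2'; rewrite !phi_field // !mulf_eq0 !negb_or.
by rewrite F1 F2 => /andP [_ ->] /andP [_ ->].
Qed.

Section Decide.
Variables (f : {mpoly K[n]}) (fd : f \is d.-homog).
Variables (k : nat) (ms : k.-tuple 'X_{1..n}).

Definition coef_env (x : {mpoly K[n]}) : seq K := [seq x@_(tnth ms i) | i <- enum 'I_k].

Lemma size_coef_env x : size (coef_env x) = k.
Proof. by rewrite size_map size_enum_ord. Qed.

Lemma nth_coef_env x (i : 'I_k) : (coef_env x)`_i = x@_(tnth ms i).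
Proof. by rewrite (nth_map i) ?size_enum_ord // nth_ord_enum. Qed.

Lemma polyfun_term (t : GRing.term K) : GRing.rterm t ->
  polyfun (fun x => GRing.eval (coef_env x) t).
Proof.
elim: t => //=.
- move=> i _; have [lt|le] := ltnP i k; last first.
    apply: (polyfun_ext _ (polyfun_cst _ 0)) => x.
    by rewrite nth_default // size_coef_env.
  apply: (polyfun_ext _ (polyfun_coef _ (tnth ms (Ordinal lt)))) => x.
  by rewrite -(nth_coef_env x (Ordinal lt)).
- by move=> c _; apply: polyfun_cst.
- by move=> c _; apply: polyfun_cst.
- by move=> t1 IH1 t2 IH2 /andP [/IH1 h1 /IH2 h2]; apply: polyfunD.
- move=> t IH /IH h; apply: (polyfun_ext _ (polyfunM (polyfun_cst _ (-1)) h)) => x.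
  by rewrite mulN1r.
- move=> t IH c /IH h; apply: (polyfun_ext _ (polyfunM (polyfun_cst _ c%:R) h)) => x.
  by rewrite mulr_natl.
- by move=> t1 IH1 t2 IH2 /andP [/IH1 h1 /IH2 h2]; apply: polyfunM.
- by move=> t IH c /IH h; apply: polyfunX.
Qed.

(* A constructible condition is constant on a nonempty open part of the orbit closure. *)
Lemma generic_decide (psi : GRing.formula K) : GRing.qf_form psi && GRing.rformula psi ->
  exists F, [/\ polyfun F, exists2 h, sl_orbit f h & F h != 0
    & exists b : bool, forall x, zclosure (sl_orbit f) x -> F x != 0 ->
        GRing.qf_eval (coef_env x) psi = b].
Proof.
have one : exists2 h, sl_orbit f h & (fun _ : {mpoly K[n]} => 1 : K) h != 0.
  by exists f; [apply: sl_orbit_refl|apply: oner_neq0].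
have bin (op : bool -> bool -> bool) p1 p2 p :
   (forall x, GRing.qf_eval (coef_env x) p =
      op (GRing.qf_eval (coef_env x) p1) (GRing.qf_eval (coef_env x) p2)) ->
   (exists F, [/\ polyfun F, exists2 h, sl_orbit f h & F h != 0
      & exists b : bool, forall x, zclosure (sl_orbit f) x -> F x != 0 ->
        GRing.qf_eval (coef_env x) p1 = b]) ->
   (exists F, [/\ polyfun F, exists2 h, sl_orbit f h & F h != 0
      & exists b : bool, forall x, zclosure (sl_orbit f) x -> F x != 0 ->
        GRing.qf_eval (coef_env x) p2 = b]) ->
   exists F, [/\ polyfun F, exists2 h, sl_orbit f h & F h != 0
      & exists b : bool, forall x, zclosure (sl_orbit f) x -> F x != 0 ->
        GRing.qf_eval (coef_env x) p = b].
  move=> pE [F1 [pF1 n1 [b1 h1]]] [F2 [pF2 n2 [b2 h2]]].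
  have [h oh /andP [x1 x2]] := orbit_irreducible fd pF1 pF2 n1 n2.
  exists (fun x => F1 x * F2 x); split; first exact: polyfunM.
    by exists h => //; rewrite mulf_neq0.
  exists (op b1 b2) => x cx; rewrite mulf_eq0 negb_or => /andP [y1 y2].
  by rewrite pE h1 ?h2.
elim: psi => //=.
- by move=> b _; exists (fun=> 1); split; [apply: polyfun_cst| |exists b].
- move=> t1 t2 /andP [r1 r2].
  pose D x := GRing.eval (coef_env x) t1 - GRing.eval (coef_env x) t2.
  have pD : polyfun D.
    apply: (polyfun_ext _ (polyfunD (polyfun_term r1)
      (polyfunM (polyfun_cst _ (-1)) (polyfun_term r2)))) => x.
    by rewrite mulN1r.
  (* If [D] is nonzero somewhere on the orbit, it is itself the function [F] and the equation is
     false where [F] is nonzero; otherwise [D] vanishes on the closure and the equation holds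
     there. *)
  have [ex|nex] := boolp.EM (exists2 h, sl_orbit f h & D h != 0).
    exists D; split=> //; exists false => x _; rewrite subr_eq0; exact: negPf.
  exists (fun=> 1); split; [exact: polyfun_cst|by []|exists true => x cx _].
  rewrite -subr_eq0; apply/eqP; apply: (cx D pD) => h oh; apply/eqP.
  by apply: boolp.contrapT => /negP Dh; apply: nex; exists h.
- move=> p1 IH1 p2 IH2 /andP [/andP [q1 q2] /andP [r1 r2]].
  by apply: (bin andb p1 p2 (GRing.And p1 p2)) => //; [apply: IH1|apply: IH2]; rewrite ?q1 ?q2.
- move=> p1 IH1 p2 IH2 /andP [/andP [q1 q2] /andP [r1 r2]].
  by apply: (bin orb p1 p2 (GRing.Or p1 p2)) => //; [apply: IH1|apply: IH2]; rewrite ?q1 ?q2.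
- move=> p1 IH1 p2 IH2 /andP [/andP [q1 q2] /andP [r1 r2]].
  by apply: (bin implb p1 p2 (GRing.Implies p1 p2)) => //; [apply: IH1|apply: IH2]; rewrite ?q1 ?q2.
- move=> p IH /IH [F [pF nF [b hb]]]; exists F; split=> //; exists (~~ b) => x cx Fx.
  by rewrite (hb x).
Qed.

End Decide.

Section Terms.
Variables (N : nat) (g : 'I_N -> nat).

Definition mpoly_term (P : {mpoly K[N]}) : GRing.term K :=
  foldr (fun m t => GRing.Add (GRing.Mul (GRing.Const P@_m)
     (foldr (fun i t => GRing.Mul (GRing.Exp (GRing.Var K (g i)) (m i)) t)
        (GRing.Const 1) (enum 'I_N))) t)
   (GRing.Const 0) (msupp P).

Lemma mpoly_term_rterm P : GRing.rterm (mpoly_term P).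
Proof.
rewrite /mpoly_term; elim: (msupp P) => //= m s ->; rewrite andbT.
by elim: (enum _).
Qed.

Lemma eval_mpoly_term e P : GRing.eval e (mpoly_term P) = P.@[fun i => e`_(g i)].
Proof.
rewrite mevalE /mpoly_term; elim: (msupp P) => [|m s IH] /=; first by rewrite big_nil.
rewrite big_cons IH; congr (_ * _ + _).
transitivity (\prod_(i <- enum 'I_N) e`_(g i) ^+ m i); last by rewrite big_enum.
by elim: (enum _) => [|i r IHr] /=; rewrite ?big_nil // big_cons IHr.
Qed.

End Terms.

(** Chevalley's theorem on images, by quantifier elimination. The variables below [k] stand for the
    coefficients of degree at most [d] of a form, and the variables [k + l] for the entries of the
    matrix that is quantified out. *)
Lemma orbit_constructible f : f \is d.-homog ->
  exists k (ms : k.-tuple 'X_{1..n}) psi, GRing.qf_form psi && GRing.rformula psi /\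
    forall x, x \is d.-homog -> GRing.qf_eval (coef_env ms x) psi <-> sl_orbit f x.
Proof.
move=> fd; pose k := #|{: 'X_{1..n < d.+1}}|.
pose ms : k.-tuple 'X_{1..n} := [tuple (enum_val i : 'X_{1..n < d.+1}) : 'X_{1..n} | i < k].
pose T m : {mpoly K[n * n]} := (act (genmx n' K) (map_mpoly (@mpolyC (n * n) K) f))@_m.
have TE m A : (T m).@[fun l => mxvec A 0 l] = (act A f)@_m.
  have := congr1 (mcoeff m) (map_act (@meval (n * n) K (fun l => mxvec A 0 l))
    (genmx n' K) (map_mpoly (@mpolyC (n * n) K) f)).
  rewrite mcoeff_map_mpoly => /= ->.
  rewrite (_ : map_mx _ _ = A); last by apply/matrixP => i j; rewrite !mxE /= mevalXU mxvecE.
  rewrite (_ : map_mpoly _ _ = f) //.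
  by apply/mpolyP => m'; rewrite !mcoeff_map_mpoly /= mevalC.
have dE A : (\det (genmx n' K)).@[fun l => mxvec A 0 l] = \det A.
  rewrite meval_det_genmx (_ : \row_l _ = mxvec A) ?mxvecK //.
  by apply/rowP => l; rewrite mxE.
pose g (l : 'I_(n * n)) := (k + l)%N.
pose body : GRing.formula K := foldr (fun i p =>
    GRing.And (GRing.Equal (GRing.Var K (nat_of_ord i)) (mpoly_term g (T (tnth ms i)))) p)
  (GRing.Equal (mpoly_term g (\det (genmx n' K))) (GRing.Const 1)) (enum 'I_k).
have rb : GRing.rformula body.
  rewrite /body; elim: (enum _) => [|i s IH] /=; first by rewrite mpoly_term_rterm.
  by rewrite mpoly_term_rterm IH.
pose vars := [seq g l | l <- enum 'I_(n * n)].
pose ph := foldr (@GRing.Exists K) body vars.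
have rph : GRing.rformula ph.
  have H s : GRing.rformula (foldr (@GRing.Exists K) body s) by elim: s.
  exact: H.
have bodyP e : GRing.holds e body <->
    (\det (genmx n' K)).@[fun l => e`_(g l)] = 1 /\
    forall i : 'I_k, e`_i = (T (tnth ms i)).@[fun l => e`_(g l)].
  have H s : GRing.holds e (foldr (fun i p =>
    GRing.And (GRing.Equal (GRing.Var K (nat_of_ord i)) (mpoly_term g (T (tnth ms i)))) p)
     (GRing.Equal (mpoly_term g (\det (genmx n' K))) (GRing.Const 1)) s) <->
    (\det (genmx n' K)).@[fun l => e`_(g l)] = 1 /\
    forall i : 'I_k, i \in s -> e`_i = (T (tnth ms i)).@[fun l => e`_(g l)].
    elim: s => [|i s IH] /=; first by rewrite eval_mpoly_term; split=> [->|[]].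
    rewrite eval_mpoly_term; split=> [[h1 /IH [h2 h3]]|[h1 h2]].
      split; [exact: h2|move=> j]; rewrite in_cons => /predU1P [->|/h3]; [exact: h1|exact].
    split; first by apply: h2; rewrite mem_head.
    by apply/IH; split=> // j js; apply: h2; rewrite in_cons js orbT.
  rewrite H; split=> -[h1 h2]; split; [exact: h1| |exact: h1|].
    by move=> i; apply: h2; rewrite mem_enum.
  by move=> i _; apply: h2.
exists k, ms, (GRing.quantifier_elim (@ClosedFieldQE.ex_elim K) ph).
split; first exact: (GRing.quantifier_elim_wf (@ClosedFieldQE.wf_ex_elim K)).
move=> x xd; have R := GRing.quantifier_elim_rformP (@ClosedFieldQE.wf_ex_elim K)
  (ClosedFieldQE.holds_ex_elim (@GRing.solve_monicpoly K)) (coef_env ms x) rph.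
suff E : GRing.holds (coef_env ms x) ph <-> sl_orbit f x by split=> [/R/E|/E/R].
have eqx A : (forall i, x@_(tnth ms i) = (act A f)@_(tnth ms i)) -> x = act A f.
  move=> h; apply/mpolyP => m; have [md|md] := ltnP (mdeg m) d.+1.
    by have := h (enum_rank (BMultinom md)); rewrite tnth_mktuple enum_rankK.
  have md' : mdeg m != d by rewrite neq_ltn md orbT.
  by rewrite !(dhomog_nemf_coeff (mf := mdeg) _ md') //; apply: act_homog.
have notv i : (i < k)%N -> i \notin vars.
  move=> lt; apply/mapP => -[l _ e]; move: lt; rewrite e /g ltnNge leq_addr.
  by [].
rewrite -GRing.foldExistsP; split.
- move=> [e' ee' /bodyP [h1 h2]].
  pose A : 'M[K]_n := vec_mx (\row_l e'`_(g l)).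
  have eA : (fun l => e'`_(g l)) =1 (fun l => mxvec A 0 l) by move=> l; rewrite /A vec_mxK mxE.
  apply/sl_orbitP; exists A; split; first by rewrite -dE -(meval_eq _ eA).
  apply: eqx => i; rewrite -TE -(meval_eq _ eA) -h2 -nth_coef_env.
  by apply: ee'; apply: notv.
move=> /sl_orbitP [A [dA xA]].
pose e' := coef_env ms x ++ [seq mxvec A 0 l | l <- enum 'I_(n * n)].
have e1 (i : nat) : (i < k)%N -> e'`_i = (coef_env ms x)`_i.
  by move=> lt; rewrite /e' nth_cat size_coef_env lt.
have e2 : (fun l => e'`_(g l)) =1 (fun l => mxvec A 0 l).
  move=> l; rewrite /e' nth_cat size_coef_env ltnNge leq_addr /= addKn.
  by rewrite (nth_map l) ?size_enum_ord // nth_ord_enum.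
exists e'.
  move=> i; rewrite inE => iv; have [lt|ge] := ltnP i k; first by rewrite e1.
  rewrite !nth_default ?size_coef_env // size_cat size_coef_env size_map size_enum_ord.
  rewrite leqNgt; apply: contraNN iv => lt; apply/mapP.
  have lt' : (i - k < n * n)%N by rewrite ltn_subLR.
  by exists (Ordinal lt'); rewrite ?mem_enum // /g /= subnKC.
apply/bodyP; split; first by rewrite (meval_eq _ e2) dE.
by move=> i; rewrite (meval_eq _ e2) TE e1 // nth_coef_env xA.
Qed.

(** Membership in the orbit of [f] is constant where [F] is nonzero on the closure, and true at [h];
    so this open part lies in the orbit. The closure of the orbit of [g] contains [f], hence [h], so
    [F] is nonzero at some point of the orbit of [g]. *)
Lemma orbit_closure_antisym f g : f \is d.-homog ->
  zclosure (sl_orbit f) g -> zclosure (sl_orbit g) f -> sl_orbit f g.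
Proof.
move=> fd cg cf; have [k [ms [psi [wf hpsi]]]] := orbit_constructible fd.
have [F [pF [h oh Fh] [b hb]]] := generic_decide fd ms wf.
have oF x : zclosure (sl_orbit f) x -> F x != 0 -> sl_orbit f x.
  move=> cx Fx; have xd := zclosure_homog fd cx.
  apply/(hpsi x xd); rewrite (hb x cx Fx).
  have hc : zclosure (sl_orbit f) h by apply: zclosure_sub.
  by rewrite -(hb h hc Fh); apply/(hpsi h); [apply: zclosure_homog fd hc|].
have /sl_orbitP [A [dA hA]] := oh.
have ch : zclosure (sl_orbit g) h by rewrite hA; apply: zclosure_orbit_act.
have [[y oy Fy]|nex] := boolp.EM (exists2 y, sl_orbit g y & F y != 0); last first.
  case/negP: Fh; apply/eqP; apply: (ch F pF) => y oy; apply/eqP.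
  by apply: boolp.contrapT => /negP Fy; apply: nex; exists y.
apply: sl_orbit_trans (sl_orbit_sym oy); apply: oF => //.
by have /sl_orbitP [B [dB ->]] := oy; apply: zclosure_orbit_act.
Qed.

End OrbitClosure.

(** * Destabilizing weights from a point of the closure *)

Lemma big_mxvec (R : Type) (idx : R) (op : Monoid.com_law idx) m n (G : 'I_(m * n) -> R) :
  \big[op/idx]_l G l = \big[op/idx]_i \big[op/idx]_j G (mxvec_index i j).
Proof.
have [g h1 h2] := @curry_mxvec_bij m n.
rewrite pair_bigA (reindex (uncurry (@mxvec_index m n))) /=; first by apply: eq_bigr => -[].
by exists g => x _; [apply: h1|apply: h2].
Qed.

Lemma rmorph_mmap (R : nzRingType) (S1 S2 : comNzRingType) l (u : {rmorphism S1 -> S2})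
    (kap : {rmorphism R -> S1}) (kap' : {rmorphism R -> S2}) (v : 'I_l -> S1) (P : {mpoly R[l]}) :
  (forall c, u (kap c) = kap' c) -> u (mmap kap v P) = mmap kap' (u \o v) P.
Proof.
move=> uk; rewrite /mmap rmorph_sum /=; apply: eq_bigr => m _.
by rewrite rmorphM uk rmorph_prod; congr (_ * _); apply: eq_bigr => i _; rewrite rmorphXn.
Qed.

Lemma sqr_eq1P (R : idomainType) (x : R) : x ^+ 2 = 1 -> x = 1 \/ x = -1.
Proof. by move/eqP; rewrite sqrf_eq1 => /orP [] /eqP; [left|right]. Qed.

Section Pairs.
Variables (F : fieldType) (K : closedFieldType) (iota : {rmorphism K -> F}).
Local Notation E := (F * K)%type.

Definition diag_emb (c : K) : E := (iota c, c).

Lemma diag_emb_zmod : zmod_morphism diag_emb.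
Proof. by move=> x y; rewrite /diag_emb rmorphB. Qed.

Lemma diag_emb_monoid : monoid_morphism diag_emb.
Proof. by split=> [|x y]; rewrite /diag_emb ?rmorph1 ?rmorphM. Qed.

HB.instance Definition _ := GRing.isZmodMorphism.Build K E diag_emb diag_emb_zmod.
HB.instance Definition _ := GRing.isMonoidMorphism.Build K E diag_emb diag_emb_monoid.

Section Destab.
Variables (n' d : nat) (f g : {mpoly K[n'.+1]}).
Local Notation n := n'.+1.
Hypothesis (gd : g \is d.-homog).
Variables (k : nat) (ms : k.-tuple 'X_{1..n}) (Q : {mpoly K[k]}).
Hypothesis Qg : forall B : 'M[K]_n, (\det B) ^+ 2 = 1 ->
  Q.@[fun i => (act B g)@_(tnth ms i)] = 0.
Variables (S : E -> Prop) (pS : place iota S).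
Hypothesis invS : forall x c, S (x, c) -> c != 0 -> S (x^-1, c^-1).
Hypothesis totS : forall x, (exists c, S (x, c)) \/ (exists c, S (x^-1, c)).
Variables (A : 'M[F]_n) (dA : \det A = 1).
Hypothesis coefS : forall m, S ((act A (map_mpoly iota f))@_m, g@_m).

Let sS := place_subring pS.
Let R x := exists c, S (x, c).

Lemma lift_mx (M : 'M[F]_n) : (forall i j, R (M i j)) ->
  exists2 ME : 'M[E]_n, (forall i j, S (ME i j)) & map_mx fst ME = M.
Proof.
move=> RM; have /fin_all_exists [c hc] : forall i, exists c : 'I_n -> K, forall j, S (M i j, c j).
  by move=> i; have /fin_all_exists [c hc] := RM i; exists c.
exists (\matrix_(i, j) (M i j, c i j)); first by move=> i j; rewrite mxE.
by apply/matrixP => i j; rewrite !mxE.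
Qed.

Lemma place_inj x c c' : S (x, c) -> S (x, c') -> c = c'.
Proof.
move=> h h'; have := sub_B sS h h'.
rewrite (_ : _ - _ = (0, c - c')); last by congr (_, _); apply: subrr.
by move/(place_fun pS)/eqP; rewrite subr_eq0 => /eqP.
Qed.

Lemma fstM (M N : 'M[E]_n) : map_mx fst (M *m N) = map_mx fst M *m map_mx fst N.
Proof. exact: map_mxM. Qed.

Lemma sndM (M N : 'M[E]_n) : map_mx snd (M *m N) = map_mx snd M *m map_mx snd N.
Proof. exact: map_mxM. Qed.

(** The inverse lifts as well, and the product of the two lifts reduces to the identity since
    residues are unique. *)
Lemma lift_unit (M : 'M[F]_n) : entry_unit (fun _ _ => R) M ->
  exists ME : 'M[E]_n, [/\ forall i j, S (ME i j), map_mx fst ME = M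
    & map_mx snd ME \in unitmx].
Proof.
move=> [uM /lift_mx [ME SM MEE] /lift_mx [NE SN NM]]; exists ME; split=> //.
suff h : map_mx snd (ME *m NE) = 1%:M.
  by have [] := mulmx1_unit (etrans (esym (sndM ME NE)) h).
have h : map_mx fst (ME *m NE) = 1%:M by rewrite fstM NM MEE mulmxV.
apply/matrixP => i j; rewrite [LHS]mxE [RHS]mxE.
have Sij : S ((ME *m NE) i j).
  by rewrite mxE; apply: (sub_sum sS) => l _; apply: (sub_M sS).
have e1 : ((ME *m NE) i j).1 = (i == j)%:R.
  by have := congr1 (fun N : 'M[F]_n => N i j) h; rewrite [LHS]mxE [RHS]mxE.
have Sd : S ((i == j)%:R, (i == j)%:R).
  by case: (i == j); [apply: (sub_1 sS)|apply: (sub_0 sS)].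
move: Sij; rewrite [(ME *m NE) i j]surjective_pairing e1 => Sij /=.
exact: place_inj Sij Sd.
Qed.

Lemma Phi_closure eps (B : 'M[K]_n) : eps ^+ 2 = 1 -> \det B != 0 ->
  Phi d ms Q (@idfun K) (eps * \det B) (act B g) 1%:M = 0.
Proof.
move=> eps2 dB; apply/eqP; apply: contraT => p0.
have [Y [h dY _]] := Phi_nonroot p0 (oner_neq0 _).
have eps0 : eps != 0.
  by apply/eqP => e0; move: eps2; rewrite e0 expr0n => /esym/eqP; rewrite oner_eq0.
have D0 : (eps * \det B) * \det Y != 0 by rewrite !mulf_neq0.
move: h; rewrite phi_field //; last exact: act_homog.
rewrite act_comp [qval _ _ _ _]Qg ?mulr0 ?eqxx //.
rewrite det_mulmx det_normmx // invfM mulrCA mulfV // mulr1 exprVn eps2.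
by rewrite invr1.
Qed.

(** [mvec] and [rvec] give the characters by which [diag_mx x] multiplies the coefficients of a form
    and of [Phi]. *)
Definition mvec (m : 'X_{1..n}) : 'rV[int]_n := \row_i (m i)%:Z.
Definition rvec (mu : 'X_{1..n * n}) : 'rV[int]_n :=
  \row_i \sum_j (mu (mxvec_index i j))%:Z.

Lemma dot_mvec a m : dot a (mvec m) = wt (a 0) m.
Proof. by apply: eq_bigr => i _; rewrite mxE -natz mulr_natr. Qed.

Lemma dot_rvec a mu : dot a (rvec mu) = wt (roww (a 0)) mu.
Proof.
rewrite /dot /wt big_mxvec; apply: eq_bigr => i _; rewrite mxE mulr_sumr.
by apply: eq_bigr => j _; rewrite rowwE -natz mulr_natr.
Qed.

Definition charx (x : 'rV[F]_n) (u : 'rV[int]_n) : F := \prod_i x 0 i ^ u 0 i.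

Lemma charxD (x : 'rV[F]_n) u v : (forall i, x 0 i != 0) -> charx x (u + v) = charx x u * charx x v.
Proof.
move=> x0; rewrite /charx -big_split; apply: eq_bigr => i _.
by rewrite mxE expfzDr.
Qed.

Lemma charx_mvec x m : charx x (mvec m) = \prod_i x 0 i ^+ m i.
Proof. by apply: eq_bigr => i _; rewrite mxE. Qed.

Lemma charx_rvec x mu :
  charx x (rvec mu) = \prod_l (mxvec (\matrix_(i < n, j < n) x 0 i) 0 l) ^+ mu l.
Proof.
rewrite big_mxvec; apply: eq_bigr => i _; rewrite mxE.
under eq_bigr do rewrite mxvecE mxE.
rewrite prodrXr exprnP; congr (_ ^ _).
by rewrite (big_morph Posz PoszD (erefl _)).
Qed.

Lemma mpoly_pair l (p : {mpoly F[l]}) (q : {mpoly K[l]}) :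
  exists H : {mpoly E[l]}, [/\ map_mpoly fst H = p, map_mpoly snd H = q
    & forall m, H@_m = (p@_m, q@_m)].
Proof.
pose D := maxn (msize p) (msize q).
pose G m : E := (p@_m, q@_m).
pose H : {mpoly E[l]} := \sum_(m : 'X_{1..l < D}) G m *: 'X_[m].
have HE m : H@_m = (p@_m, q@_m).
  have [lt|le] := ltnP (mdeg m) D; first by rewrite /H (mcoeff_mpoly G).
  rewrite /H raddf_sum /= big1 => [|m' _].
    rewrite !memN_msupp_eq0 //; apply/negP => /msize_mdeg_lt.
      by rewrite ltnNge (leq_trans _ le) // leq_maxr.
    by rewrite ltnNge (leq_trans _ le) // leq_maxl.
  rewrite mcoeffZ mcoeffX (_ : (_ == _) = false) ?mulr0 //.
  by apply: contraTF (bmdeg m') => /eqP ->; rewrite -leqNgt.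
exists H; split=> //; apply/mpolyP => m.
  by rewrite [LHS](mcoeff_map_mpoly (fst : {rmorphism E -> F})) HE.
by rewrite [LHS](mcoeff_map_mpoly (snd : {rmorphism E -> K})) HE.
Qed.

Lemma place_divl (z w : E) x : S z -> S w -> z.2 != 0 -> w.1 = z.1 * x ->
  S (x, w.2 / z.2).
Proof.
move=> Sz Sw z2 wx.
have z1 : z.1 != 0.
  apply: contraNneq z2 => z1; apply/eqP/(place_fun pS); rewrite -z1.
  by rewrite -surjective_pairing.
have Sz' : S (z.1^-1, z.2^-1) by apply: invS; rewrite // -surjective_pairing.
have := sub_M sS Sw Sz'; congr S.
by rewrite [w]surjective_pairing wx; congr (_, _); rewrite /= mulrC mulKf.
Qed.

Lemma fst_act (M : 'M[E]_n) h m :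
  ((act M h)@_m).1 = (act (map_mx fst M) (map_mpoly fst h))@_m.
Proof.
rewrite -(map_act (fst : {rmorphism E -> F})).
by rewrite [RHS](mcoeff_map_mpoly (fst : {rmorphism E -> F})).
Qed.

Lemma snd_act (M : 'M[E]_n) h m :
  ((act M h)@_m).2 = (act (map_mx snd M) (map_mpoly snd h))@_m.
Proof.
rewrite -(map_act (snd : {rmorphism E -> K})).
by rewrite [RHS](mcoeff_map_mpoly (snd : {rmorphism E -> K})).
Qed.

Lemma fst_Phi eps h (M : 'M[E]_n) mu :
  ((Phi d ms Q diag_emb eps h M)@_mu).1 =
  (Phi d ms Q iota eps.1 (map_mpoly fst h) (map_mx fst M))@_mu.
Proof.
rewrite -(@Phi_map _ _ _ _ ms Q _ _ (fst : {rmorphism E -> F}) diag_emb iota) //.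
by rewrite [RHS](mcoeff_map_mpoly (fst : {rmorphism E -> F})).
Qed.

Lemma snd_Phi eps h (M : 'M[E]_n) mu :
  ((Phi d ms Q diag_emb eps h M)@_mu).2 =
  (Phi d ms Q (@idfun K) eps.2 (map_mpoly snd h) (map_mx snd M))@_mu.
Proof.
rewrite -(@Phi_map _ _ _ _ ms Q _ _ (snd : {rmorphism E -> K}) diag_emb idfun) //.
by rewrite [RHS](mcoeff_map_mpoly (snd : {rmorphism E -> K})).
Qed.

(** By [cartan], [A *m U = invmx L *m diag_mx x]; [e] is the reduction of [invmx L]. A coefficient
    of [f] moved by [invmx L], times a character at [x], is a coefficient of [f] moved by [A *m U],
    which has a value. Where the former has nonzero residue, it is a unit and the character has a
    value too. For [Phi] the right-hand side reduces to its value at a translate of [g], which is 0,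
    so the character reduces to 0. *)
Lemma reduction_weights : exists e : 'M[K]_n, e \in unitmx /\ exists x : 'rV[F]_n,
  [/\ forall i, x 0 i != 0, R (charx x (const_mx 1)), R (charx x (const_mx (-1))),
      forall m, (act e f)@_m != 0 -> R (charx x (mvec m))
    & forall eps mu, eps ^+ 2 = 1 -> (Phi d ms Q (@idfun K) eps f e)@_mu != 0 ->
        S (charx x (rvec mu), 0)].
Proof.
have uA : A \in unitmx by rewrite unitmxE dA unitr1.
have R1 : R 1 by exists 1; apply: (sub_1 sS).
have RB x y : R x -> R y -> R (x - y).
  by move=> [c Sx] [c' Sy]; exists (c - c'); apply: (sub_B sS) Sx Sy.
have RM x y : R x -> R y -> R (x * y).
  by move=> [c Sx] [c' Sy]; exists (c * c'); apply: (sub_M sS) Sx Sy.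
have sR : subring_pred R by split.
have [L [U [x [uL uU LAU]]]] := cartan R1 RB RM totS uA.
have uL' : entry_unit (fun _ _ => R) (invmx L).
  by case: uL => ? ? ?; split; rewrite ?unitmx_inv ?invmxK.
have [k2 [Sk2 k2E uk2]] := lift_unit uL'.
have [UE [SU UEE uUE]] := lift_unit uU.
have k2x : invmx L *m diag_mx x = A *m U.
  by rewrite -LAU !mulmxA mulVmx ?mul1mx //; case: uL.
have dx : \prod_i x 0 i = \det L * \det U.
  by rewrite -det_diag -LAU !det_mulmx dA mulr1.
have dx' : (\prod_i x 0 i)^-1 = \det (invmx L) * \det (invmx U).
  by rewrite dx invfM !det_inv.
have x0 i : x 0 i != 0.
  have : \prod_i x 0 i != 0.
    by rewrite dx mulf_neq0 //; rewrite -unitfE -unitmxE; [case: uL|case: uU].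
  by move/prodf_neq0; apply.
have [H [Hf Hs HE]] := mpoly_pair (act A (map_mpoly iota f)) g.
have SH : coef_in S H by move=> m; rewrite HE.
pose fE := map_mpoly diag_emb f.
have SfE : coef_in S fE by move=> m; rewrite mcoeff_map_mpoly; apply: (place_cst pS).
have fEf : map_mpoly fst fE = map_mpoly iota f.
  exact: (map_mpoly_comp_ext (u := (fst : {rmorphism E -> F}))).
have fEs : map_mpoly snd fE = f.
  transitivity (map_mpoly (@idfun K) f).
    exact: (map_mpoly_comp_ext (u := (snd : {rmorphism E -> K}))).
  by apply/mpolyP => m; rewrite mcoeff_map_mpoly.
exists (map_mx snd k2); split=> //; exists x; split=> //.
- rewrite /charx (eq_bigr (fun i => x 0 i)) => [|i _]; last by rewrite mxE.
  by rewrite dx; apply: RM; apply: (sub_det sR); [case: uL|case: uU].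
- rewrite /charx (eq_bigr (fun i => (x 0 i)^-1)) => [|i _]; last by rewrite mxE.
  by rewrite prodfV dx'; apply: RM; apply: (sub_det sR); [case: uL|case: uU].
- move=> m hm.
  have Sz : S (act k2 fE)@_m by apply: (coef_in_act sS).
  have Sy : S (act UE H)@_m by apply: (coef_in_act sS).
  exists (((act UE H)@_m).2 / ((act k2 fE)@_m).2); apply: place_divl => //.
    by rewrite snd_act fEs.
  rewrite (fst_act UE H) (fst_act k2 fE) Hf fEf UEE k2E (act_comp A U) -k2x.
  rewrite -(act_comp (invmx L) (diag_mx x)) charx_mvec.
  exact: (mcoeff_act_diag x (act (invmx L) _)).
move=> eps mu eps2 hmu.
pose z := (Phi d ms Q diag_emb (diag_emb eps) fE k2)@_mu.
pose y := (Phi d ms Q diag_emb (diag_emb eps * \det UE) (act UE H) 1%:M)@_mu.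
have Sd c : S (diag_emb c) by apply: (place_cst pS).
have Sz : S z by apply: (Phi_sub (n' := n') d ms Q sS) => //.
have S1 i j : S ((1%:M : 'M[E]_n) i j).
  by rewrite mxE; case: (i == j); [apply: (sub_1 sS)|apply: (sub_0 sS)].
have Sy : S y.
  apply: (Phi_sub (n' := n') d ms Q sS) => //.
    by apply: (sub_M sS) => //; apply: (sub_det sS).
  exact: (coef_in_act sS).
have y2 : y.2 = 0.
  rewrite /y snd_Phi (_ : _.2 = eps * \det (map_mx snd UE)); last first.
    exact: (congr1 (fun z => eps * z) (esym (det_map_mx (snd : {rmorphism E -> K}) UE))).
  rewrite (map_act (snd : {rmorphism E -> K})) Hs map_mx1 Phi_closure ?mcoeff0 //.
  by rewrite -unitfE -unitmxE.
have := @place_divl z y (charx x (rvec mu)) Sz Sy.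
rewrite y2 mul0r; apply; first by rewrite /z snd_Phi fEs.
rewrite /y /z !fst_Phi fEf k2E charx_rvec.
rewrite -(mcoeff_Phi_diag d ms Q iota _ _ (invmx L) x) k2x -[A *m U]mulmx1 -Phi_act.
congr (mcoeff _ _); rewrite map_mx1 (map_act (fst : {rmorphism E -> F})) Hf UEE act_comp.
congr (Phi _ _ _ _ _ _ _); rewrite det_mulmx dA mul1r -UEE.
exact: (congr1 (fun z => iota eps * z) (esym (det_map_mx (fst : {rmorphism E -> F}) UE))).
Qed.

Lemma reduction_destab : exists (e : 'M[K]_n) (a : 'I_n -> int),
  [/\ e \in unitmx, \sum_i a i = 0, wge a 0 (act e f)
    & forall eps, eps ^+ 2 = 1 -> wge (roww a) 1 (Phi d ms Q (@idfun K) eps f e)].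
Proof.
have [e [ue [x [x0 Rx Rx' Rf Rphi]]]] := reduction_weights.
pose pos u := R (charx x u); pose spos u := S (charx x u, 0).
pose P eps := Phi d ms Q (@idfun K) eps f e.
(* The same weights must serve both signs [eps], since odd permutations exchange them. The vectors
   [const_mx 1] and [const_mx (-1)] in [s2] force the weights to have sum 0. *)
pose s1 := [seq rvec mu | mu <- msupp (P 1) ++ msupp (P (-1))].
pose s2 := const_mx 1 :: const_mx (-1) :: [seq mvec m | m <- msupp (act e f)].
have [|||||||a [a1 a2]] := @motzkin _ pos spos s1 s2.
- by exists 1; rewrite /charx big1 => [|i _]; [apply: (sub_1 sS)|rewrite mxE].
- move=> u v [c Su] [c' Sv]; exists (c * c'); rewrite charxD //.
  exact: (sub_M sS Su Sv).
- move=> u v Su [c Sv]; rewrite /spos charxD // -(mul0r c).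
  exact: (sub_M sS Su Sv).
- by move=> u Su; exists 0.
- rewrite /spos {1}/charx big1 => [S10|i _]; last by rewrite mxE.
  by have /eqP := place_inj S10 (sub_1 sS); rewrite eq_sym oner_eq0.
- move=> _ /mapP [mu + ->]; rewrite mem_cat !mcoeff_msupp => /orP [] h; apply: Rphi h.
    by rewrite expr1n.
  by rewrite sqrrN expr1n.
- move=> u; rewrite !in_cons => /or3P [/eqP ->|/eqP ->|/mapP [m + ->]] //.
  by rewrite mcoeff_msupp => /Rf.
exists e, (a 0); split=> //.
- apply/eqP; rewrite eq_le; apply/andP; split.
    have := a2 (const_mx (-1)); rewrite !in_cons eqxx orbT => /(_ isT).
    rewrite /dot (eq_bigr (fun i => - a 0 i)) => [|i _]; last by rewrite mxE mulrN1.
    by rewrite sumrN oppr_ge0.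
  have := a2 (const_mx 1); rewrite in_cons eqxx => /(_ isT).
  by rewrite /dot (eq_bigr (fun i => a 0 i)) // => i _; rewrite mxE mulr1.
- move=> m hm; rewrite -dot_mvec; apply: a2; rewrite !in_cons; apply/or3P/Or33/map_f.
  by rewrite mcoeff_msupp.
move=> eps eps2 mu hmu; rewrite -dot_rvec -gtz0_ge1; apply: a1; apply: map_f.
rewrite mem_cat !mcoeff_msupp.
by case: (sqr_eq1P eps2) => e1; move: hmu; rewrite e1 => ->; rewrite ?orbT.
Qed.

End Destab.
End Pairs.

(* A point of the closure of the orbit is the reduction of a translate of [f] by the generic
   matrix of [SL_n], along some place of the function field. *)
Lemma closure_destab (K : closedFieldType) n' d (f g : {mpoly K[n'.+1]}) k
    (ms : k.-tuple 'X_{1..n'.+1}) (Q : {mpoly K[k]}) :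
  f \is d.-homog -> zclosure (sl_orbit f) g ->
  (forall B : 'M[K]_n'.+1, (\det B) ^+ 2 = 1 ->
     Q.@[fun i => (act B g)@_(tnth ms i)] = 0) ->
  exists (e : 'M[K]_n'.+1) (a : 'I_n'.+1 -> int),
  [/\ e \in unitmx, \sum_i a i = 0, wge a 0 (act e f)
    & forall eps, eps ^+ 2 = 1 -> wge (roww a) 1 (Phi d ms Q (@idfun K) eps f e)].
Proof.
move=> fd cg Qg; pose n := n'.+1.
have gd := zclosure_homog fd cg.
pose F : fieldType := {fraction {mpoly K[n * n]}}.
pose tf : {rmorphism {mpoly K[n * n]} -> F} := @FracField.tofrac {mpoly K[n * n]}.
pose iota : {rmorphism K -> F} := tf \o @mpolyC (n * n) K.
pose G : 'M[F]_n := map_mx tf (genmx n' K).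
have dG : \det G != 0.
  by rewrite det_map_mx /= tofrac_eq0 det_genmx_neq0.
pose A := normmx 1 G.
have dA : \det A = 1 by rewrite det_normmx ?mul1r // invr1.
pose fF := map_mpoly iota f.
have fFd : fF \is d.-homog.
  apply/dhomogP => m; rewrite mcoeff_msupp mcoeff_map_mpoly => h.
  have /dhomogP := fd; apply; rewrite mcoeff_msupp.
  by apply: contraNneq h => ->; rewrite raddf0.
pose k0 := #|{: 'X_{1..n < d.+1}}|.
pose ms0 : k0.-tuple 'X_{1..n} := [tuple (enum_val i : 'X_{1..n < d.+1}) : 'X_{1..n} | i < k0].
pose v i : F * K := ((act A fF)@_(tnth ms0 i), g@_(tnth ms0 i)).
pose S0 (z : F * K) := exists P : {mpoly K[k0]}, z = mmap (diag_emb iota) v P.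
have pS0 : place iota S0.
  split.
  - by move=> c; exists c%:MP; rewrite mmapC.
  - by move=> _ _ [P ->] [P' ->]; exists (P - P'); rewrite rmorphB.
  - by move=> _ _ [P ->] [P' ->]; exists (P * P'); rewrite rmorphM.
  (* Membership of [g] in the closure enters here: a polynomial relation between the coefficients of
     the generic translate holds on the whole orbit, hence at [g], so the correspondence of
     coefficients is single-valued. *)
  move=> c [P e].
  have e2 : c = P.@[fun i => g@_(tnth ms0 i)].
    have := congr1 snd e; rewrite /= => ->.
    exact: (@rmorph_mmap _ _ _ _ (snd : {rmorphism F * K -> K}) _ (@idfun K)).
  have e1 : qval ms0 P iota (act A fF) = 0.
    have := congr1 fst e; rewrite /= => ->; apply/esym.
    exact: (@rmorph_mmap _ _ _ _ (fst : {rmorphism F * K -> F}) _ iota).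
  rewrite e2; apply: (cg (fun h => P.@[fun i => h@_(tnth ms0 i)])); first by exists k0, ms0, P.
  apply: (Phi_orbit (d := d)); apply/eqP; rewrite -(tofrac_eq0 (Phi _ _ _ _ _ _ _)); apply/eqP.
  rewrite Phi.unlock [LHS](@phi_map _ _ _ _ ms0 P _ _ tf _ iota) //.
  have -> : map_mpoly tf (map_mpoly (@mpolyC (n * n) K) f) = fF by apply: map_mpoly_comp_ext.
  rewrite map_mx1 mul1mx [tf 1%:MP]rmorph1 -/G phi_field ?mul1r // e1.
  exact: mulr0.
have [S [pS S0S invS totS]] := place_extend pS0.
apply: (@reduction_destab F K iota n' d f g gd k ms Q Qg S pS invS totS A dA) => m.
have [md|md] := ltnP (mdeg m) d.+1.
  apply: S0S; exists 'X_(enum_rank (BMultinom md)).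
  by rewrite [RHS]mmapX mmap1U /v tnth_mktuple enum_rankK.
have md' : mdeg m != d by rewrite neq_ltn md orbT.
rewrite !(dhomog_nemf_coeff (mf := mdeg) _ md') //; last exact: act_homog.
exact: (place0 pS).
Qed.

(** * Filtrations almost invariant under permutations *)

Section Filtration.
Variables (K : fieldType) (n : nat).
Implicit Types (e q : 'M[K]_n) (a b : 'I_n -> rat) (xi : 'rV[K]_n).

(* The basis [e] with weights [a] filters the linear forms; [fil e a c xi] says that [xi]
   lies in the step of index [c], a condition that only depends on the filtration. *)
Definition fil e a (c : rat) xi := forall j, (xi *m e) 0 j != 0 -> c <= a j.

Definition carries q a b := forall i j, q i j != 0 -> a i <= b j.

Lemma fil_carries e q a b c xi : carries q a b -> fil e a c xi -> fil (e *m q) b c xi.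
Proof.
move=> qab h j; rewrite mulmxA mxE => nz.
have [i hi] : exists i, (xi *m e) 0 i * q i j != 0.
  apply/existsP; apply: contraNT nz; rewrite negb_exists => /forallP z.
  by rewrite big1 // => i _; have := z i; rewrite negbK => /eqP.
move: hi; rewrite mulf_eq0 negb_or => /andP [/h h1 /qab]; exact: le_trans.
Qed.

Lemma fil_le e a c c' xi : c' <= c -> fil e a c xi -> fil e a c' xi.
Proof. by move=> le h j /h; apply: le_trans. Qed.

Lemma filD e a c xi zeta : fil e a c xi -> fil e a c zeta -> fil e a c (xi + zeta).
Proof.
move=> h h' j; rewrite mulmxDl mxE; have [->|/h//] := eqVneq ((xi *m e) 0 j) 0.
by rewrite add0r; apply: h'.
Qed.

Lemma filZ e a c x xi : fil e a c xi -> fil e a c (x *: xi).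
Proof.
move=> h j; rewrite -scalemxAl mxE mulf_eq0 negb_or => /andP [_]; exact: h.
Qed.

Lemma fil_sum e a c (I : Type) (r : seq I) (P : pred I) (X : I -> 'rV[K]_n) :
  (forall i, P i -> fil e a c (X i)) -> fil e a c (\sum_(i <- r | P i) X i).
Proof.
move=> h; elim/big_ind: _ => //; last exact: filD.
by move=> j; rewrite mul0mx mxE eqxx.
Qed.

Lemma fil_max e a xi : e \in unitmx -> xi != 0 ->
  exists g, forall c, fil e a c xi <-> c <= g.
Proof.
move=> ue xi0; have [j0 hj0] : exists j, (xi *m e) 0 j != 0.
  apply/existsP; apply: contraNT xi0; rewrite negb_exists => /forallP z.
  apply/eqP; rewrite -[xi]mulmx1 -(mulmxV ue) mulmxA (_ : xi *m e = 0) ?mul0mx //.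
  by apply/rowP => j; rewrite [RHS]mxE; have := z j; rewrite negbK => /eqP.
pose P j := (xi *m e) 0 j != 0.
have [j hj jm] := @arg_minP _ _ _ j0 P a hj0.
exists (a j) => c; split=> [h|le i hi]; first exact: h.
exact: le_trans le (jm i hi).
Qed.

Lemma fil_row e a c j : e \in unitmx -> fil e a c (row j (invmx e)) <-> c <= a j.
Proof.
move=> ue; have E i : (row j (invmx e) *m e) 0 i = (j == i)%:R.
  by rewrite -row_mul mulVmx // mxE mxE.
split=> [h|le i]; first by apply: h; rewrite E eqxx oner_neq0.
by rewrite E; have [<-|_] := eqVneq j i; rewrite ?eqxx.
Qed.

(** Two weighted bases lie in a common apartment: the basis [e'] defines both filtrations, with the
    weights [a] permuted for the first one. It is [e2] corrected by the right factor of the Bruhat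
    decomposition of [invmx e1 *m e2]. *)
Lemma common_basis e1 e2 a b : e1 \in unitmx -> e2 \in unitmx ->
  exists e' (t : 'S_n), [/\ e' \in unitmx,
    carries (invmx e1 *m e') a (a \o t), carries (invmx e' *m e1) (a \o t) a,
    carries (invmx e2 *m e') b b & carries (invmx e' *m e2) b b].
Proof.
move=> u1 u2; have uM : invmx e1 *m e2 \in unitmx by rewrite unitmx_mul unitmx_inv u1.
have [L [U [[uL La La'] [uU Ub Ub'] [s [x LMU]]]]] := bruhat a b uM.
set N := L *m _ *m U in LMU.
have uN : N \in unitmx by rewrite !unitmx_mul unitmx_inv uL u1 u2 uU.
have x0 i : x i != 0.
  have [j] := unitmx_row_neq0 i uN; rewrite LMU.
  by case: ifP; rewrite ?eqxx.
exists (e2 *m U), (s^-1)%g; split.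
- by rewrite unitmx_mul u2.
- have -> : invmx e1 *m (e2 *m U) = invmx L *m N.
    by rewrite /N !mulmxA mulVmx // mul1mx.
  move=> i j; rewrite mxE (bigD1 (s^-1 j)%g) //= big1 => [|k ks].
    by rewrite addr0 mulf_eq0 negb_or => /andP [/La'].
  by rewrite LMU (_ : j == s k = false) ?mulr0 //; apply: contraNF ks => /eqP ->; rewrite permK.
- rewrite invmx_mul //.
  have E : L = N *m (invmx U *m invmx e2 *m e1).
    by rewrite /N !mulmxA (mulmxK uU) (mulmxK u2) (mulmxKV u1).
  move=> j i h; have := La (s^-1 j)%g i; apply.
  rewrite E mxE (bigD1 j) //= big1 => [|k ks].
    by rewrite addr0 LMU permKV eqxx mulf_neq0.
  by rewrite LMU permKV (negPf ks) mul0r.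
- by rewrite mulKmx.
by rewrite invmx_mul // mulmxKV.
Qed.

Section Averaging.
Variable feas : 'M[K]_n -> ('I_n -> rat) -> Prop.
Hypothesis feas_carries : forall e q a b, carries q a b -> feas e a -> feas (e *m q) b.
Hypothesis feas_mid : forall e a b, feas e a -> feas e b ->
  feas e (fun i => (a i + b i) / 2).
Hypothesis feas_perm : forall e a (s : 'S_n), feas e a -> feas (perm_mx s *m e) a.

Definition sqnorm a := \sum_i a i ^+ 2.

Lemma sqnorm_ge0 a : 0 <= sqnorm a.
Proof. by apply: sumr_ge0 => i _; apply: sqr_ge0. Qed.

(** The slack [eps] ensures existence: each failure lowers the norm by more than [eps], which can
    happen only finitely often. *)
Definition near_min eps e a := [/\ e \in unitmx, \sum_i a i = 0, feas e a
  & forall e' a', e' \in unitmx -> \sum_i a' i = 0 -> feas e' a' -> sqnorm a <= sqnorm a' + eps].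

Lemma near_min_exists eps e a : 0 < eps -> e \in unitmx -> \sum_i a i = 0 -> feas e a ->
  exists e' a', near_min eps e' a'.
Proof.
move=> eps0 ue sa fa; have [k hk] : exists k : nat, sqnorm a < eps * k%:R.
  exists (Num.bound (sqnorm a / eps)); rewrite mulrC -ltr_pdivrMr //.
  by apply: archi_boundP; rewrite divr_ge0 ?sqnorm_ge0 // ltW.
elim: k e a ue sa fa hk => [|k IH] e a ue sa fa hk.
  by move: hk; rewrite mulr0 ltNge sqnorm_ge0.
have [h|h] := boolp.EM (near_min eps e a); first by exists e, a.
have [[e' [a' [ue' sa' fa' lt]]]|h'] := boolp.EM (exists e' a',
    [/\ e' \in unitmx, \sum_i a' i = 0, feas e' a' & sqnorm a' + eps < sqnorm a]).
  apply: (IH e' a') => //; rewrite -(ltrD2r eps); apply: lt_trans lt _.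
  by rewrite -natr1 mulrDr mulr1 in hk.
exfalso; apply: h; split=> // e' a' ue' sa' fa'; rewrite leNgt; apply/negP => lt.
by apply: h'; exists e', a'.
Qed.

(* The midpoint of [a] and its translate by [s], taken in a basis adapted to both, would
   otherwise be shorter: this is the convexity argument behind Kempf's theorem. *)
Lemma near_min_invariant del e a (s : 'S_n) : 0 <= del -> near_min (del ^+ 2 / 4) e a ->
  forall c xi, fil e a c xi -> fil e a (c - del) (xi *m perm_mx s).
Proof.
move=> del0 [ue sa fa amin] c xi hxi.
have us : perm_mx s *m e \in unitmx by rewrite unitmx_mul unitmx_perm.
have [e' [t [ue' h1 h2 h3 h4]]] := common_basis a a ue us.
pose a1 := a \o t.
have ft1 : feas e' a1.
  by rewrite -[e'](mulKVmx ue); apply: feas_carries h1 fa.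
have ft2 : feas e' a.
  by rewrite -[e'](mulKVmx us); apply: feas_carries h3 _; apply: feas_perm.
have sa1 : \sum_i a1 i = 0 by rewrite -[RHS]sa [RHS](reindex_inj (@perm_inj _ t)).
have na1 : sqnorm a1 = sqnorm a by rewrite /sqnorm [RHS](reindex_inj (@perm_inj _ t)).
have := amin e' (fun i => (a1 i + a i) / 2) ue' _ (feas_mid ft1 ft2).
rewrite -mulr_suml big_split /= sa1 sa addr0 mul0r => /(_ erefl).
(* Parallelogram identity. With the slack [del ^+ 2 / 4] it bounds the sum of the squares of
   [a1 i - a i] by [del ^+ 2], hence each difference by [del]. *)
have -> : sqnorm (fun i => (a1 i + a i) / 2) = sqnorm a - \sum_i (a1 i - a i) ^+ 2 / 4.
  transitivity ((sqnorm a1 + sqnorm a) / 2 - \sum_i (a1 i - a i) ^+ 2 / 4); last first.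
    by rewrite na1; congr (_ - _); lra.
  rewrite /sqnorm -big_split mulr_suml -sumrB; apply: eq_bigr => i _ /=.
  by rewrite /exprz; lra.
rewrite -addrA lerDl addrC subr_ge0 -mulr_suml ler_pM2r ?invr_gt0 // => hle.
have hd j : a1 j - del <= a j.
  rewrite lerBlDl -lerBlDr; apply: le_trans (ler_norm _) _.
  rewrite -(@ler_sqr _ _ del) ?nnegrE ?normr_ge0 // real_normK ?num_real //.
  apply: le_trans hle; rewrite (bigD1 j) //= lerDl.
  by apply: sumr_ge0 => i _; apply: sqr_ge0.
have h5 : fil e' a1 c xi by rewrite -[e'](mulKVmx ue); apply: fil_carries h1 hxi.
have h6 : fil e' a (c - del) xi.
  by move=> j /h5 le; apply: le_trans (hd j); rewrite lerD2r.
have : fil (perm_mx s *m e) a (c - del) xi.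
  by rewrite -[_ *m e](mulKVmx ue'); apply: fil_carries h4 h6.
by move=> h j; rewrite -mulmxA; apply: h.
Qed.

End Averaging.

End Filtration.

Section Invariant.
Variables (K : fieldType) (n' : nat).
Local Notation n := n'.+2.
Local Notation wd := (widen_ord (leqnSn n'.+1)).
Local Notation lf := (lift (@ord0 n'.+1)).
Implicit Types (e q : 'M[K]_n) (a b : 'I_n -> rat) (xi : 'rV[K]_n).

(* The rows are the forms [l], [b_1], .., [b_(n-1)]. *)
Definition lmat : 'M[K]_n := \matrix_(i, j)
  if unlift ord0 i is Some k then (j == wd k)%:R - (j == lf k)%:R else 1.

(** A kernel vector has equal coordinates by the rows [b_i], and [n] times their common value is 0
    by the row [l]. *)
Lemma lmat_unit : n%:R != 0 :> K -> lmat \in unitmx.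
Proof.
move=> nK; rewrite -unitmx_tr -row_free_unit -kermx_eq0; apply/eqP/row_matrixP => r.
rewrite row0; set v := row r _.
have v0 : lmat *m v^T = 0.
  apply: trmx_inj; rewrite trmx_mul trmxK trmx0 /v -row_mul mulmx_ker row0 //.
have E i : \sum_j lmat i j * v 0 j = 0.
  have := congr1 (fun A : 'cV[K]_n => A i 0) v0; rewrite !mxE.
  by under eq_bigr do rewrite [v^T _ _]mxE.
have vk (k : 'I_n'.+1) : v 0 (wd k) = v 0 (lf k).
  have := E (lf k); under eq_bigr do rewrite mxE liftK mulrBl.
  rewrite sumrB (bigD1 (wd k)) //= eqxx mul1r [X in _ + X - _]big1 => [|j /negPf ->]; last first.
    by rewrite mul0r.
  rewrite [X in _ - X](bigD1 (lf k)) //= eqxx mul1r [X in _ - (_ + X)]big1 => [|j /negPf ->].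
    by rewrite !addr0 => /eqP; rewrite subr_eq0 => /eqP.
  by rewrite mul0r.
have vc j : v 0 j = v 0 ord0.
  have H m (h : (m < n)%N) : v 0 (Ordinal h) = v 0 ord0.
    elim: m h => [|m IH] h; first by congr (v 0 _); apply: val_inj.
    rewrite -(IH (ltnW h)); have := vk (Ordinal (h : (m < n'.+1)%N)) => hv.
    by rewrite -(_ : lf (Ordinal (h : (m < n'.+1)%N)) = Ordinal h) -?hv; [congr (v 0 _)|];
       apply: val_inj.
  by case: j => m h; apply: H.
apply/rowP => j; rewrite vc [RHS]mxE; apply/eqP.
have := E ord0; under eq_bigr do rewrite mxE unlift_none mul1r vc.
by rewrite sumr_const card_ord -mulr_natl => /eqP; rewrite mulf_eq0 (negPf nK).
Qed.

Definition wdiff (i j : 'I_n) : 'rV[K]_n := delta_mx 0 i - delta_mx 0 j.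

Lemma row_lmat0 : row ord0 lmat = const_mx 1.
Proof. by apply/rowP => j; rewrite !mxE unlift_none. Qed.

Lemma row_lmatS k : row (lf k) lmat = wdiff (wd k) (lf k).
Proof. by apply/rowP => j; rewrite !mxE liftK eqxx. Qed.

Lemma mul_row_perm xi (s : 'S_n) k : (xi *m perm_mx s) 0 k = xi 0 ((s^-1)%g k).
Proof. by rewrite -[s in LHS]invgK -col_permE mxE. Qed.

Lemma wdiff_perm i j s : wdiff i j *m perm_mx s = wdiff (s i) (s j).
Proof.
apply/rowP => k; rewrite mul_row_perm !mxE /= -(inj_eq (@perm_inj _ s)) permKV.
by rewrite -(inj_eq (@perm_inj _ s) _ j) permKV.
Qed.

Lemma sub_tperm xi i j : xi - xi *m perm_mx (tperm i j) = (xi 0 i - xi 0 j) *: wdiff i j.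
Proof.
apply/rowP => k; rewrite mxE [X in _ + X]mxE mul_row_perm tpermV !mxE /=.
case: tpermP => [->|->|/eqP/negPf -> /eqP/negPf ->].
- by rewrite eqxx; have [->|ne] := eqVneq i j; rewrite ?subrr ?mulr0 // subr0 mulr1.
- rewrite eqxx; have [->|ne] := eqVneq j i; rewrite ?subrr ?mulr0 //.
  by rewrite sub0r mulrN1 opprB.
- by rewrite !subrr mulr0.
Qed.

Lemma perm_pair (i j k l : 'I_n) : i != j -> k != l -> exists s : 'S_n, s i = k /\ s j = l.
Proof.
move=> ij kl; exists (tperm i k * tperm (tperm i k j) l)%g.
rewrite !permM tpermL tpermL; split=> //; apply: tpermD; last by rewrite eq_sym.
by rewrite -[X in _ != X](tpermL i k) (inj_eq (@perm_inj _ _)) eq_sym.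
Qed.

Definition lamw (be : rat) (j : 'I_n) : rat := if j == ord0 then - (n'.+1)%:R * be else be.

Definition lweight (ga be : rat) (j : 'I_n) : rat := if j == ord0 then ga else be.

Lemma row_lmat_decomp xi : n%:R != 0 :> K ->
  xi = \sum_j (xi *m invmx lmat) 0 j *: row j lmat.
Proof.
by move=> nK; rewrite -mulmx_sum_row mulmxKV // lmat_unit.
Qed.

(** If two coordinates of [xi] differ, subtracting its image under a transposition leaves a multiple
    of [x_i - x_j], which a permutation moves to [b_1]: so [xi] lies at most [2 * del] deeper than
    [b_1]. The other [b_k] lose at most [del] against [b_1], whence [3 * del] for the component
    along [l]. If all coordinates agree, [xi] is a multiple of [l]. The weights [ga] and [be] are
    the depths of [l] and [b_1]. *)
Lemma almost_invariant_fil del e a : n%:R != 0 :> K -> 0 <= del -> e \in unitmx ->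
  (forall (s : 'S_n) c xi, fil e a c xi -> fil e a (c - del) (xi *m perm_mx s)) ->
  exists ga be, forall c xi,
    (fil e a c xi -> fil (invmx lmat) (lweight ga be) (c - 3 * del) xi) /\
    (fil (invmx lmat) (lweight ga be) c xi -> fil e a (c - 3 * del) xi).
Proof.
move=> nK del0 ue inv.
have rn0 j : row j lmat != 0.
  apply/eqP => h; have := mulmxV (lmat_unit nK) => /(congr1 (row j)).
  rewrite row_mul h mul0mx => /(congr1 (fun v : 'rV[K]_n => v 0 j)).
  by rewrite !mxE eqxx => /esym/eqP; rewrite oner_eq0.
have [ga gaP] := fil_max a ue (rn0 ord0).
have [be beP] := fil_max a ue (rn0 (lf ord0)).
have upper c xi i j : fil e a c xi -> xi 0 i != xi 0 j -> c - 2 * del <= be.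
  move=> h ne; apply/beP.
  have h1 : fil e a (c - del) (wdiff i j).
    rewrite -[wdiff i j](scalerK (a := xi 0 i - xi 0 j)) ?subr_eq0 //.
    apply: filZ; rewrite -sub_tperm -scaleN1r; apply: filD.
      by apply: fil_le h; rewrite gerBl.
    by apply: filZ; apply: inv.
  have ij : i != j by apply: contraNneq ne => ->.
  have [s [s1 s2]] := perm_pair ij (k := wd ord0) (l := lf ord0) isT.
  by rewrite row_lmatS -s1 -s2 -wdiff_perm; apply: fil_le (inv s _ _ h1); lra.
have lower k : fil e a (be - del) (row (lf k) lmat).
  have kk : wd k != lf k by rewrite -val_eqE /= neq_ltn leqnn.
  have [s [s1 s2]] := perm_pair (i := wd ord0) (j := lf ord0) isT kk.
  rewrite row_lmatS -s1 -s2 -wdiff_perm -row_lmatS; apply: inv; exact/beP.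
exists ga, be => c xi; set x := xi *m invmx lmat; split=> h.
  have low2 c' : c' <= be - del -> fil e a c' (\sum_k x 0 (lf k) *: row (lf k) lmat).
    by move=> le; apply: fil_sum => k _; apply: filZ; apply: fil_le le _; apply: lower.
  have xiE : xi = x 0 ord0 *: row ord0 lmat + \sum_k x 0 (lf k) *: row (lf k) lmat.
    by rewrite [LHS](row_lmat_decomp _ nK) big_ord_recl.
  have [[i [j ne]]|cst] := boolp.EM (exists i j, xi 0 i != xi 0 j).
    have cbe := upper c xi i j h ne.
    move=> j' hj'; rewrite /lweight; case: eqP => [j0|_]; last lra.
    rewrite j0 -/x in hj'; apply/gaP.
    rewrite -[row ord0 lmat](scalerK hj'); apply: filZ.
    rewrite (_ : x 0 ord0 *: _ = xi + -1 *: \sum_k x 0 (lf k) *: row (lf k) lmat); last first.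
      by rewrite [in RHS]xiE scaleN1r addrK.
    apply: filD; first by apply: fil_le h; lra.
    by apply: filZ; apply: low2; lra.
  have xi1 : xi = xi 0 ord0 *: row ord0 lmat.
    apply/rowP => j; rewrite row_lmat0 !mxE mulr1; apply/eqP; apply: contraT => ne.
    by case: cst; exists j, ord0.
  have xE : x = xi 0 ord0 *: delta_mx 0 ord0.
    rewrite /x {1}xi1 -scalemxAl -row_mul mulmxV ?lmat_unit //; congr (_ *: _).
    by rewrite row1.
  move=> j; rewrite -/x xE !mxE /= mulf_eq0 negb_or => /andP [hx].
  have [->|_] := eqVneq j ord0; last by rewrite eqxx.
  rewrite /lweight eqxx => _; have : c <= ga.
    by apply/gaP; rewrite -[row ord0 lmat](scalerK hx) -xi1; apply: filZ.
  lra.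
rewrite (row_lmat_decomp xi nK) -/x; apply: fil_sum => j _.
have [->|xj] := eqVneq (x 0 j) 0; first by rewrite scale0r => i; rewrite mul0mx mxE eqxx.
apply: filZ; have := h j xj; rewrite /lweight.
case: (unliftP ord0 j) => [k ->|->]; rewrite ?eqxx /= => le; last first.
  by apply: fil_le (_ : fil e a c _); [lra|apply/gaP].
by apply: fil_le (lower k); lra.
Qed.

Lemma sum_lweight ga be : \sum_j lweight ga be j = ga + (n'.+1)%:R * be.
Proof.
rewrite big_ord_recl /lweight eqxx; congr (_ + _).
rewrite (eq_bigr (fun=> be)) => [|i _]; last by [].
by rewrite sumr_const card_ord mulr_natl.
Qed.

Lemma invariant_filtration (feas : 'M[K]_n -> ('I_n -> rat) -> Prop) eta e a :
  n%:R != 0 :> K ->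
  (forall e q a b, carries q a b -> feas e a -> feas (e *m q) b) ->
  (forall e a b, feas e a -> feas e b -> feas e (fun i => (a i + b i) / 2)) ->
  (forall e a (s : 'S_n), feas e a -> feas (perm_mx s *m e) a) ->
  0 < eta -> e \in unitmx -> \sum_i a i = 0 -> feas e a ->
  exists be e' a', [/\ e' \in unitmx, feas e' a'
    & forall i j, (invmx e' *m invmx lmat) i j != 0 -> a' i - eta <= lamw be j].
Proof.
move=> nK hcar hmid hperm eta0 ue sa fa.
(* The weights of [e'] will differ from [lweight ga be] by at most [3 * del] each. As their sum is
   0, replacing [ga] by [- n'.+1%:R * be] costs at most [3 * del * n%:R] more, and the two errors
   add up to [eta]. *)
pose del := eta / (3 * (n%:R + 1)).
have del0 : 0 < del by rewrite divr_gt0 // mulr_gt0 // ltr_wpDl.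
have del2 : 0 < del ^+ 2 / 4 by rewrite divr_gt0 ?exprn_gt0.
have [e1 [a1 nm]] := near_min_exists del2 ue sa fa.
have [ue1 sa1 fa1 _] := nm.
have inv (s : 'S_n) c xi : fil e1 a1 c xi -> fil e1 a1 (c - del) (xi *m perm_mx s).
  exact: (near_min_invariant hcar hmid hperm (ltW del0) nm).
have [ga [be hgb]] := almost_invariant_fil nK (ltW del0) ue1 inv.
have ul : invmx lmat \in unitmx by rewrite unitmx_inv lmat_unit.
have [e' [t [ue' c1 c2 c3 c4]]] := common_basis a1 (lweight ga be) ue1 ul.
pose a' := a1 \o t.
have fe' : feas e' a'.
  by rewrite -[e'](mulKVmx ue1); apply: hcar c1 fa1.
have sa' : \sum_i a' i = 0 by rewrite -[RHS]sa1 [RHS](reindex_inj (@perm_inj _ t)).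
have cl j : a' j - 3 * del <= lweight ga be j.
  have h0 : fil e' a' (a' j) (row j (invmx e')) by apply/fil_row.
  have h1 : fil e1 a1 (a' j) (row j (invmx e')).
    by rewrite -[e1](mulKVmx ue'); apply: fil_carries c2 h0.
  have [/(_ h1) h2 _] := hgb (a' j) (row j (invmx e')).
  apply/(fil_row _ _ _ ue'); rewrite -[X in fil X](mulKVmx ul); exact: fil_carries c3 h2.
have cu j : lweight ga be j - 3 * del <= a' j.
  have h0 : fil e' (lweight ga be) (lweight ga be j) (row j (invmx e')) by apply/fil_row.
  have h1 : fil (invmx lmat) (lweight ga be) (lweight ga be j) (row j (invmx e')).
    by rewrite -[invmx lmat](mulKVmx ue'); apply: fil_carries c4 h0.
  have [_ /(_ h1) h2] := hgb (lweight ga be j) (row j (invmx e')).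
  apply/(fil_row _ _ _ ue'); rewrite -[X in fil X](mulKVmx ue1); exact: fil_carries c1 h2.
have sumE : \sum_j (lweight ga be j - a' j) = ga + n'.+1%:R * be.
  by rewrite sumrB sum_lweight sa' subr0.
have sum3 : \sum_(i < n) 3 * del = 3 * del * n%:R by rewrite sumr_const card_ord mulr_natr.
have sumb : ga + n'.+1%:R * be <= 3 * del * n%:R.
  by rewrite -sumE -sum3; apply: ler_sum => i _; have := cu i; lra.
have sumb' : - (3 * del * n%:R) <= ga + n'.+1%:R * be.
  by rewrite -sumE -sum3 -sumrN; apply: ler_sum => i _; have := cl i; lra.
have etaE : eta = 3 * del * n%:R + 3 * del.
  have h : del * (3 * (n%:R + 1)) = eta by rewrite /del divfK // gt_eqF // mulr_gt0 // ltr_wpDl.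
  by rewrite -h; lra.
exists be, e', a'; split=> // i j /c4 le.
have := cl i; move: le; rewrite /lweight /lamw; have := del0.
case: (j == ord0); case: (i == ord0); lra.
Qed.

End Invariant.

(** * Limits along one-parameter subgroups *)

Lemma wtZ (T : realDomainType) k (c : T) (w : 'I_k -> T) m :
  wt (fun i => c * w i) m = c * wt w m.
Proof. by rewrite /wt mulr_sumr; apply: eq_bigr => i _; rewrite mulrnAr. Qed.

Lemma wt_addcst (T : realDomainType) k (c : T) (w : 'I_k -> T) m :
  wt (fun i => w i + c) m = wt w m + c *+ mdeg m.
Proof.
rewrite -(wt_cst c m) /wt -big_split; apply: eq_bigr => i _.
by rewrite mulrnDl.
Qed.

Lemma eq_wge (T : realDomainType) (R : nzRingType) k (w w' : 'I_k -> T) c (p : {mpoly R[k]}) :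
  w =1 w' -> wge w c p -> wge w' c p.
Proof. by move=> ww h m /h; rewrite /wt; under eq_bigr do rewrite ww. Qed.

Lemma wge_int (R : nzRingType) k (w : 'I_k -> int) c (p : {mpoly R[k]}) :
  wge w c p -> wge (fun i => (w i)%:~R : rat) c%:~R p.
Proof.
move=> h m /h; rewrite -(ler_int rat) => le; apply: le_trans le _.
rewrite /wt rmorph_sum /= ler_sum // => i _.
by rewrite rmorphMn.
Qed.

Section Limit.
Variables (K : closedFieldType) (n' d : nat).
Local Notation n := n'.+1.

Lemma exprz_wt k (t : K) (w : 'I_k -> int) (m : 'X_{1..k}) : t != 0 ->
  \prod_l (t ^ w l) ^+ m l = t ^ wt w m.
Proof.
move=> t0; rewrite /wt; elim/big_rec2: _ => [|i y1 y2 _ ->]; first by rewrite expr0z.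
by rewrite expfzDr // exprnP exprz_exp -mulr_natr natz.
Qed.

Definition wzero (w : 'I_n -> int) (h : {mpoly K[n]}) : {mpoly K[n]} :=
  \sum_(m <- msupp h | wt w m == 0) h@_m *: 'X_[m].

(** The translates of [h] by the one-parameter subgroup, as a family polynomial in the parameter and
    so defined at 0. When [wge w 0 h], the absolute value is the weight itself. *)
Definition wcurve (w : 'I_n -> int) (h : {mpoly K[n]}) : {mpoly {poly K}[n]} :=
  \sum_(m <- msupp h) (h@_m *: 'X^(`|wt w m|%N)) *: 'X_[m].

Lemma wcurve0 w h : map_mpoly (horner_eval (0 : K)) (wcurve w h) = wzero w h.
Proof.
rewrite /wcurve /wzero rmorph_sum /= [RHS]big_mkcond /=; apply: eq_bigr => m _.
rewrite map_mpolyZ map_mpolyX /= horner_evalE hornerZ hornerXn expr0n absz_eq0.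
by case: (wt w m == 0); rewrite ?mulr1 // mulr0 scale0r.
Qed.

Lemma wcurve_neq0 w h t : t != 0 -> wge w 0 h ->
  map_mpoly (horner_eval t) (wcurve w h) = act (diag_mx (\row_i t ^ w i)) h.
Proof.
move=> t0 wh; apply/mpolyP => m; rewrite (mcoeff_act_diag (\row_i t ^ w i)).
rewrite (eq_bigr (fun i => (t ^ w i) ^+ m i)) => [|i _]; last by rewrite mxE.
rewrite (exprz_wt w m t0) /wcurve rmorph_sum raddf_sum /=.
under eq_bigr do rewrite map_mpolyZ map_mpolyX mcoeffZ mcoeffX /= horner_evalE hornerZ hornerXn.
have [mh|mh] := boolP (m \in msupp h); last first.
  rewrite (memN_msupp_eq0 mh) mul0r big1_seq // => m' /= m'h.
  by rewrite (_ : m' == m = false) ?mulr0 //; apply: contraNF mh => /eqP <-.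
rewrite (bigD1_seq m) //= eqxx mulr1 big1 ?addr0 => [|m' /negPf ->]; last by rewrite mulr0.
by rewrite exprnP gez0_abs // wh // -mcoeff_msupp.
Qed.

Section Curve.
Variables (f : {mpoly K[n]}) (e : 'M[K]_n) (w : 'I_n -> int).
Hypotheses (ue : e \in unitmx) (sw : \sum_i w i = 0) (wf : wge w 0 (act e f)).
Local Notation f0 := (act (invmx e) (wzero w (act e f))).
Variables (k : nat) (ms : k.-tuple 'X_{1..n}) (Q : {mpoly K[k]}).

Lemma limit_curve (B : 'M[K]_n) : exists pi : {poly K},
  pi.[0] = qval ms Q (@idfun K) (act B f0) /\
  forall t, t != 0 -> exists2 A : 'M[K]_n,
    A = e *m diag_mx (\row_i t ^ w i) *m (invmx e *m B) &
    \det A = \det B /\ pi.[t] = qval ms Q (@idfun K) (act A f).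
Proof.
pose C := map_mx polyC (invmx e *m B).
pose H := act C (wcurve w (act e f)).
exists (qval ms Q (polyC : {rmorphism K -> {poly K}}) H).
have evE t : (qval ms Q (polyC : {rmorphism K -> {poly K}}) H).[t] =
    qval ms Q (@idfun K) (act (invmx e *m B) (map_mpoly (horner_eval t) (wcurve w (act e f)))).
  rewrite -[LHS]/(horner_eval t _) [LHS](@rmorph_mmap _ _ _ _ _ _ (@idfun K)); last first.
    by move=> c; rewrite /= /horner_eval hornerC.
  congr mmap; apply: boolp.funext => i /=.
  rewrite /H -(mcoeff_map_mpoly (horner_eval t)) map_act; congr ((act _ _)@_ _).
  by apply/matrixP => i' j'; rewrite [LHS]mxE [C i' j']mxE /= horner_evalE hornerC.
split=> [|t t0]; first by rewrite evE wcurve0 act_comp.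
exists (e *m diag_mx (\row_i t ^ w i) *m (invmx e *m B)) => //; split; last first.
  by rewrite evE wcurve_neq0 // !act_comp !mulmxA.
have dd : \det (diag_mx (\row_i t ^ w i)) = 1.
  rewrite det_diag (eq_bigr (fun i => t ^ w i)) => [|i _]; last by rewrite mxE.
  rewrite -[RHS](expr0z t) -sw; elim/big_rec2: _ => [|i y1 y2 _ ->]; first by rewrite expr0z.
  by rewrite expfzDr.
by rewrite !det_mulmx dd mulr1 det_inv mulrA mulfV ?mul1r // -unitfE -unitmxE.
Qed.

(** Away from 0 the value of [Q] along the curve is [Phi] at a matrix with rescaled rows, where
    every monomial carries a positive power of the parameter. *)
Lemma limit_Phi (B : 'M[K]_n) : \det B = 1 ->
  wge (roww w) 1 (Phi d ms Q (@idfun K) 1 f e) -> qval ms Q (@idfun K) (act B f0) = 0.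
Proof.
move=> dB wP; have [pi [<- hpi]] := limit_curve B.
set P := Phi _ _ _ _ _ _ _ in wP.
pose Z := invmx e *m B.
pose pi2 : {poly K} := \sum_(mu <- msupp P)
  (P@_mu * \prod_l (mxvec Z 0 l) ^+ mu l) *: 'X^(`|wt (roww w) mu|%N).
suff -> : pi = pi2.
  rewrite /pi2 horner_sum big1_seq // => mu /= muP.
  rewrite hornerZ hornerXn expr0n absz_eq0 gt_eqF ?mulr0 //.
  by rewrite gtz0_ge1 wP // -mcoeff_msupp.
apply: poly_eq_nonzero => t t0; have [A AE [dA ->]] := hpi t t0.
rewrite -(@phi_det1 _ _ d _ ms Q _ idfun 1 f A) ?mul1r ?dA // AE -mulmxA.
rewrite -(Phi_meval d ms Q idfun 1 f e) -/P mevalE /pi2 horner_sum.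
rewrite big_seq_cond [RHS]big_seq_cond; apply: eq_bigr => mu; rewrite andbT => muP.
rewrite hornerZ hornerXn -mulrA; congr (_ * _).
rewrite exprnP gez0_abs; last by apply: le_trans (wP mu _); rewrite -?mcoeff_msupp.
rewrite -exprz_wt // mulrC -big_split /=; apply: eq_bigr => l _.
rewrite -exprMn; congr (_ ^+ _); case/mxvec_indexP: l => i j.
by rewrite !mxvecE rowwE mul_diag_mx !mxE.
Qed.

End Curve.

Lemma limit_closure f e (w : 'I_n -> int) : e \in unitmx -> \sum_i w i = 0 ->
  wge w 0 (act e f) -> zclosure (sl_orbit f) (act (invmx e) (wzero w (act e f))).
Proof.
move=> ue sw wf F [k [ms [Q FE]]] hF.
have [pi [p0 hpi]] := limit_curve ue sw wf ms Q 1%:M.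
rewrite act1 in p0; rewrite FE -[LHS]/(qval ms Q (@idfun K) _) -p0.
suff -> : pi = 0 by rewrite horner0.
apply: poly_eq_nonzero => t t0; rewrite horner0; have [A _ [dA ->]] := hpi t t0.
by rewrite -[LHS]FE; apply: hF; apply: sl_orbit_act; rewrite dA det1.
Qed.

End Limit.

(** * The pieces of a symmetric form *)

Section Symmetric.
Variables (K : closedFieldType) (n' d : nat).
Local Notation n := n'.+2.
Local Notation lf := (lift (@ord0 n'.+1)).
Hypothesis nK : n%:R != 0 :> K.
Variables (f : {mpoly K[n]}) (p : nat -> {mpoly K[n]}).
Hypothesis fd : f \is d.-homog.
Local Notation el := (invmx (lmat K n')).

Let ul : el \in unitmx. Proof. by rewrite unitmx_inv lmat_unit. Qed.

Definition linf (xi : 'rV[K]_n) : {mpoly K[n]} := \sum_j xi 0 j *: 'X_j.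

Lemma act_linf e xi : act e (linf xi) = linf (xi *m e).
Proof.
rewrite /linf rmorph_sum /=; under eq_bigr do rewrite actZ actX scaler_sumr.
rewrite exchange_big; apply: eq_bigr => j _ /=; rewrite mxE scaler_suml.
by apply: eq_bigr => i _; rewrite scalerA.
Qed.

Lemma act_row_lmat j : act el (linf (row j (lmat K n'))) = 'X_j.
Proof.
rewrite act_linf -row_mul mulmxV ?lmat_unit // /linf (bigD1 j) //= !mxE eqxx scale1r.
by rewrite big1 ?addr0 // => i /negPf ij; rewrite !mxE eq_sym ij scale0r.
Qed.

Lemma act_lform : act el (lform K n) = 'X_ord0.
Proof.
rewrite -act_row_lmat row_lmat0; congr (act _ _); apply: eq_bigr => j _.
by rewrite mxE scale1r.
Qed.

Lemma xvarE (j : 'I_n) : xvar K n j = 'X_j.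
Proof. by rewrite /xvar valK. Qed.

Lemma act_bvec (k : 'I_n'.+1) : act el (tnth (bvec K n) k) = 'X_(lf k).
Proof.
rewrite -act_row_lmat row_lmatS; congr (act _ _); rewrite tnth_mktuple /linf.
have -> : xvar K n k = 'X_(widen_ord (leqnSn n'.+1) k) by rewrite -xvarE.
have -> : xvar K n k.+1 = 'X_(lf k) by rewrite -xvarE.
rewrite /wdiff; under eq_bigr do rewrite !mxE /= scalerBl.
have E i : \sum_j (j == i)%:R *: 'X_j = 'X_i :> {mpoly K[n]}.
  rewrite (bigD1 i) //= eqxx scale1r big1 ?addr0 // => j /negPf ->.
  by rewrite scale0r.
by rewrite sumrB !E.
Qed.

Lemma act_comp_bvec (q : {mpoly K[n'.+1]}) :
  act el (q \mPo bvec K n) = q \mPo [tuple 'X_(lf k) | k < n'.+1].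
Proof.
rewrite /comp_mpoly (@rmorph_mmap _ _ _ _ (act el) _ (@mpolyC n K)) => [|c].
  by congr mmap; apply: boolp.funext => k; rewrite /= act_bvec tnth_mktuple.
exact: actC.
Qed.

Hypothesis hp : forall i : nat, (i <= d)%N ->
  exists q : {mpoly K[n'.+1]}, q \is (d - i)%N.-homog /\ p i = q \mPo bvec K n.
Hypothesis hdec : f = \sum_(i < d.+1) lform K n ^+ i * p i.

Local Notation h := (act el f).
Definition piece i := act el (lform K n ^+ i * p i).

(** In the coordinates [l, b_1, ..] the weights 1 and [-1] on the first variable bound its exponent
    from both sides. *)
Lemma piece_supp i m : (i <= d)%N -> (piece i)@_m != 0 -> m ord0 = i.
Proof.
move=> /hp [q [_ pi]] nz.
pose c0 (s : int) (j : 'I_n) : int := s * (j == ord0)%:Z.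
have wc s : wge (c0 s) (s * i%:Z) (piece i).
  rewrite /piece pi rmorphM rmorphXn /= act_lform act_comp_bvec -[s * i]addr0.
  apply: wgeM.
    have := @wge_exp _ K _ _ _ _ i (@wgeX _ K _ (c0 s) ord0).
    by rewrite /c0 eqxx mulr1 -mulr_natr natz.
  apply: (@wge_comp _ _ _ _ (fun=> 0)) => [m' _|k].
    by rewrite /wt big1 // => j _; rewrite mul0rn.
  rewrite tnth_mktuple (_ : 0 = c0 s (lf k)); first exact: wgeX.
  by rewrite /c0 mulr0.
have wE s : wt (c0 s) m = s * (m ord0)%:Z.
  rewrite /wt (bigD1 ord0) //= /c0 eqxx mulr1 big1 => [|j /negPf ->].
    by rewrite addr0 -mulr_natr natz.
  by rewrite mulr0 mul0rn.
have := wc 1 m nz; have := wc (-1) m nz; rewrite !wE; lia.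
Qed.

Lemma coef_pieces m : h@_m = \sum_(i < d.+1) (piece i)@_m.
Proof. by rewrite {1}hdec rmorph_sum raddf_sum. Qed.

Lemma coef_piece m : h@_m = if (m ord0 <= d)%N then (piece (m ord0))@_m else 0.
Proof.
rewrite coef_pieces; case: leqP => [le|gt].
  rewrite (bigD1 (Ordinal (le : (m ord0 < d.+1)%N))) //= big1 ?addr0 // => i ne.
  apply/eqP; apply: contraNT ne => /piece_supp-/(_ (ltn_ord i)) e.
  by apply/eqP/val_inj.
rewrite big1 // => i _; apply/eqP; apply: contraTT gt => /piece_supp-/(_ (ltn_ord i)) ->.
by rewrite -leqNgt -ltnS.
Qed.

Definition uwt (s : int) (j : 'I_n) : int := s * (if j == ord0 then - (n'.+1)%:Z else 1).

Lemma sum_uwt s : \sum_j uwt s j = 0.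
Proof.
rewrite -mulr_sumr big_ord_recl /= (eq_bigr (fun=> 1)) => [|i _]; last by [].
by rewrite sumr_const card_ord natz addNr mulr0.
Qed.

Lemma wt_uwt s m : wt (uwt s) m = s * ((mdeg m)%:Z - n%:Z * (m ord0)%:Z).
Proof.
have -> : (mdeg m)%:Z = (m ord0)%:Z + \sum_(j | j != ord0) (m j)%:Z.
  by rewrite mdegE (bigD1 ord0) //= PoszD (big_morph Posz PoszD (erefl _)).
rewrite wtZ /wt (bigD1 ord0) //=; congr (_ * _).
rewrite (eq_bigr (fun j => (m j)%:Z)) => [|j /negPf ->]; last by rewrite natz.
by set X := \sum_(_ | _) _; rewrite -mulr_natr natz; lia.
Qed.

Lemma wt_uwt_h s m : h@_m != 0 -> wt (uwt s) m = s * (d%:Z - n%:Z * (m ord0)%:Z).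
Proof.
move=> hm; rewrite wt_uwt; have /dhomogP/(_ m) := act_homog el fd.
by rewrite mcoeff_msupp => /(_ hm) /= ->.
Qed.

(** For [s = 1] all nonzero [p i] have [n * i <= d], for [s = -1] all have [d <= n * i]: the two
    directions of the one-parameter subgroup. *)
Definition side (s : int) := forall i, (i <= d)%N -> p i != 0 -> 0 <= s * (d%:Z - n%:Z * i%:Z).

Lemma lform_neq0 : lform K n != 0.
Proof.
apply/eqP => l0; have := act_lform; rewrite l0 rmorph0 => /(congr1 (mcoeff U_(ord0))).
by rewrite mcoeff0 mcoeffX eqxx => /esym/eqP; rewrite oner_eq0.
Qed.

Lemma piece_eq0 i : (piece i == 0) = (p i == 0).
Proof.
have lf0 := lform_neq0; rewrite /piece; apply/eqP/eqP => [e|->]; last by rewrite mulr0 rmorph0.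
have := congr1 (act (lmat K n')) e; rewrite act_comp mulVmx ?lmat_unit // act1 rmorph0.
by move/eqP; rewrite mulf_eq0 expf_eq0 (negPf lf0) andbF => /eqP.
Qed.

Lemma piece_coef i : (i <= d)%N -> p i != 0 -> exists2 m : 'X_{1..n}, m ord0 = i & h@_m != 0.
Proof.
move=> id; rewrite -piece_eq0 => nz.
have [m hm] := mpoly_neq0_coef nz.
have mi := piece_supp id hm; exists m => //.
by rewrite coef_piece mi id.
Qed.

Lemma side_wge s : side s <-> wge (uwt s) 0 h.
Proof.
split=> [hs m hm|hw i id pi]; last first.
  by have [m mi hm] := piece_coef id pi; rewrite -mi -wt_uwt_h //; apply: hw.
rewrite wt_uwt_h //; move: hm; rewrite coef_piece; case: leqP => [le hm|]; last by rewrite eqxx.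
apply: hs => //; rewrite -piece_eq0; apply: contraNneq hm => ->.
by rewrite mcoeff0.
Qed.

(* The limit of [f] along the one-parameter subgroup of weights [uwt s] in the basis
   [l, b_1, .., b_(n-1)] of linear forms. *)
Definition mid : {mpoly K[n]} := if (n %| d)%N then lform K n ^+ (d %/ n) * p (d %/ n) else 0.

Lemma mcoeff_wzero w (g : {mpoly K[n]}) m : (wzero w g)@_m = if wt w m == 0 then g@_m else 0.
Proof.
rewrite /wzero raddf_sum /=; under eq_bigr do rewrite mcoeffZ mcoeffX.
have [mg|mg] := boolP (m \in msupp g); last first.
  rewrite (memN_msupp_eq0 mg) if_same big1_seq // => m' /andP [_ m'g].
  by rewrite (_ : m' == m = false) ?mulr0 //; apply: contraNF mg => /eqP <-.
rewrite big_mkcond (bigD1_seq m) //= eqxx mulr1 big1 ?addr0 // => m' /negPf ->.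
by rewrite mulr0 if_same.
Qed.

Lemma wzero_mid s : s != 0 -> act (invmx el) (wzero (uwt s) h) = mid.
Proof.
move=> s0; rewrite -[RHS](act1 mid) -(mulmxV ul) -act_comp; congr (act _ _).
apply/mpolyP => m; rewrite mcoeff_wzero /mid.
have [hm|hm] := eqVneq h@_m 0.
  rewrite hm if_same; case: ifP => [nd|_]; last by rewrite rmorph0 mcoeff0.
  apply/esym/eqP; rewrite -[act el (_ * _)]/(piece (d %/ n)); apply: contraTT isT => hm'.
  have le : (d %/ n <= d)%N by apply: leq_div.
  by move: hm; rewrite coef_piece (piece_supp le hm') le => /eqP; rewrite (negPf hm').
rewrite wt_uwt_h // mulf_eq0 (negPf s0) /=.
have [nd|nd] := boolP (n %| d)%N; last first.
  rewrite rmorph0 mcoeff0 ifF //; apply: contraNF nd => /eqP e; apply/dvdnP.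
  by exists (m ord0); lia.
have dE := divnK nd; rewrite -[act el (_ * _)]/(piece (d %/ n)).
have [e|ne] := eqVneq (m ord0) (d %/ n)%N.
  rewrite ifT; last by rewrite e; lia.
  by rewrite coef_piece e leq_div.
rewrite ifF; last first.
  apply/negbTE; apply: contraNneq ne => e; rewrite -(@eqn_pmul2r n) // dE; lia.
apply/esym/eqP; apply: contraNT ne => hm'.
by apply/eqP; apply: piece_supp hm'; apply: leq_div.
Qed.

Lemma side_closure s : s != 0 -> side s -> zclosure (sl_orbit f) mid.
Proof.
move=> s0 /side_wge hs; rewrite -(wzero_mid s0).
by apply: limit_closure => //; apply: sum_uwt.
Qed.

Lemma mid_eq0 : (forall i, (i <= d)%N -> p i != 0 -> (n * i)%N != d) -> mid = 0.
Proof.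
rewrite /mid; case: ifP => // nd hne; have [->|pn] := eqVneq (p (d %/ n)) 0.
  by rewrite mulr0.
by have := hne _ (leq_div d n) pn; rewrite mulnC divnK // eqxx.
Qed.

Lemma mid_neq0 i : (i <= d)%N -> p i != 0 -> (n * i)%N = d -> mid != 0.
Proof.
move=> id pi nid; have nd : (n %| d)%N by rewrite -nid dvdn_mulr.
by rewrite /mid nd -{1 2}nid mulKn // mulf_neq0 // expf_neq0 // lform_neq0.
Qed.

Lemma truncate_pieces c : (c <= d.+1)%N -> (forall i, (i <= d)%N -> p i != 0 -> (i < c)%N) ->
  f = \sum_(i < c) lform K n ^+ i * p i.
Proof.
move=> cd hc; rewrite (big_ord_widen d.+1 (fun i => lform K n ^+ i * p i) cd) {1}hdec.
rewrite [RHS]big_mkcond; apply: eq_bigr => i _; case: ifP => // /negP ic.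
have [->|pi] := eqVneq (p i) 0; first by rewrite mulr0.
by case: ic; apply: hc; rewrite // -ltnS.
Qed.

Lemma ldiv_pieces c : (forall i, (i <= d)%N -> p i != 0 -> (c <= i)%N) -> ldiv c f.
Proof.
move=> hc; exists (\sum_(i < d.+1) lform K n ^+ (i - c) * p i).
rewrite {1}hdec mulr_sumr; apply: eq_bigr => i _; rewrite mulrA -exprD.
have [->|pi] := eqVneq (p i) 0; first by rewrite !mulr0.
by rewrite subnKC // hc // -ltnS.
Qed.

Lemma pieces_lt c : (c <= d.+1)%N -> f = \sum_(i < c) lform K n ^+ i * p i ->
  forall i, (i <= d)%N -> p i != 0 -> (i < c)%N.
Proof.
move=> cd fE i id pi; have [m <- hm] := piece_coef id pi.
have [i' hi'] : exists i' : 'I_c, (piece i')@_m != 0.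
  apply/existsP; apply: contraNT hm; rewrite negb_exists => /forallP z.
  rewrite fE rmorph_sum raddf_sum /= big1 // => i' _.
  by have := z i'; rewrite negbK => /eqP.
rewrite (piece_supp _ hi') // -ltnS; exact: leq_trans (ltn_ord i') cd.
Qed.

Lemma pieces_ge c : ldiv c f -> forall i, (i <= d)%N -> p i != 0 -> (c <= i)%N.
Proof.
move=> [g fE] i id pi; have [m <- hm] := piece_coef id pi.
pose w (j : 'I_n) := (j == ord0)%:Z.
have wE m' : wt w m' = m' ord0.
  rewrite /wt (bigD1 ord0) //= /w eqxx big1 => [|j /negPf ->]; last by rewrite mul0rn.
  by rewrite addr0 natz.
have H : wge w (c%:Z + 0) h.
  rewrite fE rmorphM rmorphXn /= act_lform; apply: wgeM.
    have := @wge_exp _ K _ _ _ _ c (@wgeX _ K _ w ord0).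
    by rewrite /w eqxx natz.
  by move=> m' _; rewrite wE.
by have := H m hm; rewrite wE addr0 lez_nat.
Qed.

End Symmetric.

Section WeightMore.
Variable T : realFieldType.

Lemma wge_mid (R : nzRingType) k (a b : 'I_k -> T) c (q : {mpoly R[k]}) :
  wge a c q -> wge b c q -> wge (fun i => (a i + b i) / 2) c q.
Proof.
move=> ha hb m hm; rewrite (_ : wt _ m = (wt a m + wt b m) / 2).
  by have := ha m hm; have := hb m hm; lra.
rewrite /wt -big_split mulr_suml; apply: eq_bigr => i _ /=.
by rewrite -mulrnDl mulrnAl.
Qed.

(** A uniform error [eta] in the weights costs [eta] times the degree. *)
Lemma wge_shift (R : nzRingType) k (a : 'I_k -> T) c eta (D : nat) (q : {mpoly R[k]}) :
  0 <= eta -> wge (fun=> -1 : T) (- D%:R) q -> wge a c q ->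
  wge (fun i => a i - eta) (c - eta * D%:R) q.
Proof.
move=> eta0 hD ha m hm; have := ha m hm; have := hD m hm.
rewrite wt_addcst wt_cst mulNrn lerN2 => le1 le2.
have : eta * (mdeg m)%:R <= eta * D%:R by rewrite ler_wpM2l.
rewrite (_ : - eta *+ mdeg m = - (eta * (mdeg m)%:R)); first by lra.
by rewrite mulNrn mulr_natr.
Qed.

Lemma wge_deg (R : nzRingType) k (q : {mpoly R[k]}) (D : nat) : (msize q <= D)%N ->
  wge (fun=> -1 : T) (- D%:R) q.
Proof.
move=> le m; rewrite -mcoeff_msupp => /msize_mdeg_lt lt.
by rewrite wt_cst mulNrn lerN2 ler_nat ltnW // (leq_trans lt).
Qed.

Lemma roww_map2 n' (g : T -> T -> T) (a b : 'I_n'.+1 -> T) l :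
  roww (fun i => g (a i) (b i)) l = g (roww a l) (roww b l).
Proof. by case/mxvec_indexP: l => i j; rewrite !rowwE. Qed.

End WeightMore.

(** * From a point of the closure to a direction of the one-parameter subgroup *)

Section SymmetricSide.
Variables (K : closedFieldType) (n' d : nat).
Local Notation n := n'.+2.
Hypothesis nK : n%:R != 0 :> K.
Variables (f g : {mpoly K[n]}).
Hypotheses (fd : f \is d.-homog) (fsym : f \is symmetric).
Hypothesis cg : zclosure (sl_orbit f) g.
Variables (k : nat) (ms : k.-tuple 'X_{1..n}) (Q : {mpoly K[k]}).
Hypothesis Qg : forall B : 'M[K]_n, (\det B) ^+ 2 = 1 ->
  Q.@[fun i => (act B g)@_(tnth ms i)] = 0.
Local Notation Ph := (Phi d ms Q (@idfun K)).
Local Notation el := (invmx (lmat K n')).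
Hypothesis Ph0 : Ph 1 f 1%:M != 0.

Lemma Phi_perm eps (s : 'S_n) e : Ph eps f (perm_mx s *m e) = Ph (eps * \det (perm_mx s)) f e.
Proof.
rewrite -Phi_act act_perm.
by have /issymP -> := fsym.
Qed.

(* The degree bound [D] controls the effect on [Ph] of perturbing all weights by a constant. *)
Definition feas (D : nat) (e : 'M[K]_n) (a : 'I_n -> rat) : Prop :=
  wge a 0 (act e f) /\ forall eps, eps ^+ 2 = 1 ->
    wge (roww a) 1 (Ph eps f e) /\ wge (roww (fun=> -1 : rat)) (- D%:R) (Ph eps f e).

Lemma feas_carries D e q a b : carries q a b -> feas D e a -> feas D (e *m q) b.
Proof.
move=> qab [h1 h2]; split; first by rewrite -act_comp; apply: wge_act h1.
by move=> eps /h2 [h3 h4]; split; [apply: wge_Phi h3|apply: wge_Phi h4].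
Qed.

Lemma feas_mid D e a b : feas D e a -> feas D e b -> feas D e (fun i => (a i + b i) / 2).
Proof.
move=> [h1 h2] [h1' h2']; split; first exact: wge_mid.
move=> eps e2; have [h3 h4] := h2 eps e2; have [h3' _] := h2' eps e2; split=> //.
have := wge_mid h3 h3'; apply: eq_wge => l.
by rewrite (roww_map2 (fun x y => (x + y) / 2)).
Qed.

(** A permutation can be moved from the basis to the symmetric [f], at the price of its sign in
    [eps]; this is why [feas] quantifies over both signs. *)
Lemma feas_perm D e a (s : 'S_n) : feas D e a -> feas D (perm_mx s *m e) a.
Proof.
move=> [h1 h2]; split.
  by rewrite -act_comp act_perm; have /issymP -> := fsym.
move=> eps e2; rewrite Phi_perm; apply: h2.
by rewrite exprMn e2 mul1r det_perm -exprM mulnC exprM sqrrN expr1n expr1n.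
Qed.

Lemma wt_bound (D : nat) l (w : 'I_l -> rat) (c : rat) m : 0 <= c -> (forall i, `|w i| <= c) ->
  (mdeg m <= D)%N -> `|wt w m| <= c * D%:R.
Proof.
move=> c0 wc mD; apply: le_trans (ler_norm_sum _ _ _) _.
apply: le_trans (_ : \sum_i c *+ m i <= _).
  by apply: ler_sum => i _; rewrite normrMn lerMn2r wc orbT.
rewrite (_ : \sum_i c *+ m i = c * (mdeg m)%:R); first by rewrite ler_wpM2l // ler_nat.
by rewrite mdegE mulr_natr sumrMnr.
Qed.

(* By averaging, some destabilizing filtration is, up to an error [eta], the one given by
   [l] and the [b_i]; the weights of the latter being integers, a small error is harmless. *)
Lemma symmetric_side : exists2 s : int, s = 1 \/ s = -1 &
  wge (uwt s) 0 (act el f) /\ wge (roww (uwt s)) 1 (Ph 1 f el).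
Proof.
have [e [a [ue sa hf hP]]] := closure_destab fd cg Qg.
pose D := maxn d (maxn (msize (Ph 1 f e)) (msize (Ph (-1) f e))).
have f0 : feas D e (fun i => (a i)%:~R).
  split; first by have := wge_int hf.
  move=> eps eps2; split.
    have := wge_int (hP eps eps2); apply: eq_wge => l.
    by case/mxvec_indexP: l => i j; rewrite !rowwE.
  have : (msize (Ph eps f e) <= D)%N.
    by rewrite /D; have [->|->] := sqr_eq1P eps2; rewrite !leq_max leqnn ?orbT.
  move/(wge_deg rat_rat__canonical__Num_RealField); apply: eq_wge => l.
  by case/mxvec_indexP: l => i j; rewrite rowwE.
have sa' : \sum_i (a i)%:~R = 0 :> rat by rewrite -rmorph_sum /= sa.
pose N : rat := n'.+1%:R * D%:R.
(* [N] bounds the weight, for integer weights of absolute value at most [n'.+1], of a monomial of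
   degree at most [D]. Errors [eta] in the weights amount to [kap] on such a monomial, and [eta] is
   chosen to make [kap * (N + 1) < 1]. *)
pose eta : rat := (2 * (D%:R + 1) * (N + 1))^-1.
have N0 : 0 <= N by rewrite mulr_ge0.
have eta0 : 0 < eta by rewrite invr_gt0 !mulr_gt0 // ltr_wpDl.
have [be [e' [a' [ue' [h1 h2] car]]]] := invariant_filtration nK
  (@feas_carries D) (@feas_mid D) (@feas_perm D) eta0 ue sa' f0.
pose kap := eta * D%:R.
have kap1 : kap * (N + 1) < 1.
  have E : 2 * (D%:R + 1) * (N + 1) * eta = 1.
    by rewrite mulfV // gt_eqF // !mulr_gt0 // ltr_wpDl.
  rewrite /kap; have : 0 < eta * (N + 1) by rewrite mulr_gt0 // ltr_wpDl.
  have : 0 <= D%:R :> rat by [].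
  by move: E; nra.
have elE : el = e' *m (invmx e' *m el) by rewrite mulKVmx.
pose u : 'I_n -> int := uwt 1.
have lamE j : lamw be j = be * (u j)%:~R.
  rewrite /lamw /u /uwt mul1r; case: (j == ord0); last by rewrite mulr1.
  by rewrite mulNr mulrNz mulrN mulrC.
have wtE m : wt (lamw be) m = be * (wt u m)%:~R :> rat.
  rewrite /wt rmorph_sum /= mulr_sumr; apply: eq_bigr => j _.
  by rewrite lamE rmorphMn /= mulrnAr.
have wtE' mu : wt (roww (lamw be)) mu = be * (wt (roww u) mu)%:~R :> rat.
  rewrite /wt rmorph_sum /= mulr_sumr; apply: eq_bigr => l _.
  by case/mxvec_indexP: l => i j; rewrite !rowwE lamE rmorphMn /= mulrnAr.
have B1 m : (act el f)@_m != 0 -> - kap <= be * (wt u m)%:~R.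
  move=> hm; rewrite -wtE -[- kap]sub0r.
  have hd : wge (fun=> -1 : rat) (- D%:R) (act e' f).
    move=> m'; rewrite -mcoeff_msupp => m's; rewrite wt_cst mulNrn lerN2 ler_nat.
    by have /dhomogP/(_ m' m's) -> := act_homog e' fd; apply: leq_maxl.
  have := wge_shift (ltW eta0) hd h1; rewrite elE -act_comp in hm *.
  by move/(wge_act car); apply.
have [h3 h4] := h2 1 (expr1n _ 2).
have B2 mu : (Ph 1 f el)@_mu != 0 -> 1 - kap <= be * (wt (roww u) mu)%:~R.
  move=> hm; rewrite -wtE'.
  have hd : wge (fun=> -1 : rat) (- D%:R) (Ph 1 f e').
    by apply: eq_wge h4 => l; case/mxvec_indexP: l => i j; rewrite rowwE.
  have := wge_shift (ltW eta0) hd h3.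
  have Ew : (fun l => roww a' l - eta) =1 roww (fun i => a' i - eta).
    by move=> l; case/mxvec_indexP: l => i j; rewrite !rowwE.
  move/(eq_wge Ew); rewrite elE in hm *.
  by move/(wge_Phi car); apply.
have [mu0 hmu0] : exists mu, (Ph 1 f el)@_mu != 0.
  apply: mpoly_neq0_coef; apply: contraNneq Ph0 => P0; apply/eqP.
  have := Phi_comp d ms Q (@idfun K) 1 f el (invmx el).
  rewrite mulmxV ?unitmx_inv ?lmat_unit // => ->.
  by rewrite P0 comp_mpoly0.
have B3 : `|(wt (roww u) mu0)%:~R : rat| <= N.
  have mD : (mdeg mu0 <= D)%N.
    have : wge (fun=> -1 : rat) (- D%:R) (Ph 1 f el).
      have hd : wge (roww (fun=> -1 : rat)) (- D%:R) (Ph 1 f el).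
        by rewrite elE; apply: wge_Phi h4.
      by apply: eq_wge hd => l; case/mxvec_indexP: l => i j; rewrite rowwE.
    by move=> /(_ mu0 hmu0); rewrite wt_cst mulNrn lerN2 ler_nat.
  have := @wt_bound D _ (fun l => (roww u l)%:~R) n'.+1%:R mu0 (ler0n _ _) _ mD.
  rewrite (_ : wt _ mu0 = (wt (roww u) mu0)%:~R); last first.
    by rewrite /wt rmorph_sum /=; apply: eq_bigr => l _; rewrite rmorphMn.
  apply=> l; case/mxvec_indexP: l => i j; rewrite rowwE /u /uwt mul1r.
  case: (i == ord0); first by rewrite mulrNz normrN ger0_norm.
  by rewrite normr1 ler1n.
have kap0 : 0 <= kap by rewrite mulr_ge0 // ltW.
have kapN : 0 <= kap * N by rewrite mulr_ge0.
(* If not, the monomial [mu0] of [Ph] would give [1 - kap <= kap * N]. Consequently an integer whose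
   product with [be] is at least [- kap] has, up to the sign of [be], no negative value: this
   removes the error. *)
have beK : kap < `|be|.
  rewrite ltNge; apply/negP => le; have := B2 mu0 hmu0.
  have : be * (wt (roww u) mu0)%:~R <= kap * N.
    by apply: le_trans (ler_norm _) _; rewrite normrM; apply: ler_pM.
  by lra.
exists (if 0 < be then 1 else -1); first by case: ifP; [left|right].
set s : int := if _ then _ else _.
have sE (z : int) : `|be| * (s * z)%:~R = be * z%:~R.
  rewrite rmorphM /= mulrA; congr (_ * _); rewrite /s; case: ltP => h.
    by rewrite gtr0_norm // mulr1.
  by rewrite ler0_norm // mulrN1 opprK.
have be0 : 0 < `|be| by apply: le_lt_trans beK.
have wsE m : wt (uwt s : 'I_n -> int) m = s * wt u m.
  by rewrite /u !wtZ mul1r.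
have wsE' mu : wt (roww (uwt s : 'I_n -> int)) mu = s * wt (roww u) mu.
  rewrite /wt mulr_sumr; apply: eq_bigr => l _; case/mxvec_indexP: l => i j.
  by rewrite !rowwE /u /uwt mul1r mulrnAr.
split=> [m /B1|mu /B2]; rewrite -sE.
  rewrite wsE => le; rewrite leNgt; apply/negP => lt.
  have lt' : (s * wt u m)%:~R <= -1 :> rat.
    rewrite -[X in _ <= X]add0r lerBrDr.
    by move: lt; rewrite -lezD1 -(ler_int rat) rmorphD.
  have : `|be| * (s * wt u m)%:~R <= `|be| * -1 by rewrite ler_pM2l.
  by lra.
rewrite wsE' => le; rewrite -gtz0_ge1 -(ltr_int rat) -(pmulr_rgt0 _ be0).
apply: lt_le_trans le; rewrite subr_gt0.
by apply: le_lt_trans kap1; rewrite mulrDr mulr1 lerDr.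
Qed.

End SymmetricSide.

(** * The criteria for instability and polystability *)

Section Side.
Variables (K : closedFieldType) (n' d : nat).
Local Notation n := n'.+2.
Hypothesis nK : n%:R != 0 :> K.
Variables (f : {mpoly K[n]}) (p : nat -> {mpoly K[n]}).
Hypotheses (f0 : f != 0) (fd : f \is d.-homog) (fsym : f \is symmetric).
Hypothesis hp : forall i : nat, (i <= d)%N ->
  exists q : {mpoly K[n'.+1]}, q \is (d - i)%N.-homog /\ p i = q \mPo bvec K n.
Hypothesis hdec : f = \sum_(i < d.+1) lform K n ^+ i * p i.

(** The second conclusion transfers the vanishing of [F] from the arbitrary limit [g] to the
    explicit limit [mid]. *)
Lemma closure_side g (F : {mpoly K[n]} -> K) : polyfun F ->
  zclosure (sl_orbit f) g -> (forall B : 'M[K]_n, \det B ^+ 2 = 1 -> F (act B g) = 0) ->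
  (exists2 h, sl_orbit f h & F h != 0) ->
  exists2 s : int, s = 1 \/ s = -1 &
    side d p s /\ forall B : 'M[K]_n, \det B = 1 -> F (act B (mid d p)) = 0.
Proof.
move=> [k [ms [Q FE]]] cg hg [h fh hF].
have P0 : Phi d ms Q (@idfun K) 1 f 1%:M != 0.
  by apply: contraNneq hF => /Phi_orbit P0; rewrite FE P0.
have hQ (B : 'M[K]_n) : \det B ^+ 2 = 1 -> Q.@[fun i => (act B g)@_(tnth ms i)] = 0.
  by move=> /hg; rewrite FE.
have [s s1 [sf sP]] := symmetric_side nK fd fsym cg hQ P0.
exists s => //; split; first by apply/(side_wge nK fd hp hdec).
move=> B dB; rewrite FE -(wzero_mid nK fd hp hdec (s := s)); last by case: s1 => ->.
have ue : invmx (lmat K n') \in unitmx by rewrite unitmx_inv lmat_unit.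
exact: (limit_Phi ue (sum_uwt _ s) sf dB sP).
Qed.

Lemma side_pos_lt i : side d p 1 -> mid d p = 0 -> (i <= d)%N -> p i != 0 -> (n * i < d)%N.
Proof.
move=> hs m0 id pi; have := hs i id pi; rewrite mul1r subr_ge0 -PoszM lez_nat leq_eqVlt.
case/orP=> // /eqP e; have := mid_neq0 nK id pi e; by rewrite m0 eqxx.
Qed.

Lemma side_neg_gt i : side d p (-1) -> mid d p = 0 -> (i <= d)%N -> p i != 0 -> (d < n * i)%N.
Proof.
move=> hs m0 id pi; have := hs i id pi; rewrite mulN1r opprB subr_ge0 -PoszM lez_nat leq_eqVlt.
case/orP=> // /eqP e; have := mid_neq0 nK id pi (esym e); by rewrite m0 eqxx.
Qed.

Lemma lt_ceil_div i : (i < ceil_div d n)%N = (n * i < d)%N.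
Proof. by rewrite /ceil_div leq_divRL //= mulSn mulnC (addnC d) addSn ltn_add2l. Qed.

Lemma ceil_div_le : (ceil_div d n <= d.+1)%N.
Proof. by rewrite leqNgt lt_ceil_div -leqNgt; apply: leq_trans (leq_pmull _ _). Qed.

Lemma unstable_side : f_unstable f ->
  mid d p = 0 /\ exists2 s : int, s = 1 \/ s = -1 & side d p s.
Proof.
move=> uf; have [m fm] := mpoly_neq0_coef f0.
have z0 m' (B : 'M[K]_n) : \det B ^+ 2 = 1 -> (act B 0)@_m' = 0.
  by move=> _; rewrite rmorph0 mcoeff0.
have [|s s1 [hs _]] := closure_side (polyfun_coef K m) uf (z0 m).
  by exists f => //; apply: sl_orbit_refl.
split; last by exists s.
(* [mid] does not depend on the direction. A coefficient that is nonzero at [mid] is nonzero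
   somewhere on the orbit, so a second use of [closure_side] with this coefficient makes it vanish
   at [mid]. *)
apply/eqP; apply: contraT => /mpoly_neq0_coef [m2 mm].
have cm : zclosure (sl_orbit f) (mid d p).
  by apply: (side_closure nK fd hp hdec _ hs); case: s1 => ->.
have [|s' _ [_ /(_ 1%:M (det1 _ _))]] := closure_side (polyfun_coef K m2) uf (z0 m2).
  apply: boolp.contrapT => hn; move/eqP: mm; apply; apply: cm (polyfun_coef K m2) _ => h fh.
  by apply/eqP; apply: contraT => hh; case: hn; exists h.
by rewrite act1 => /eqP; rewrite (negPf mm).
Qed.

Lemma unstableP : f_unstable f <->
  ldiv (d %/ n).+1 f \/ f = \sum_(i < ceil_div d n) lform K n ^+ i * p i.
Proof.
split=> [/unstable_side [m0 [s [] -> hs]]|].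
- right; apply: (truncate_pieces hdec ceil_div_le) => i id pi.
  by rewrite lt_ceil_div side_pos_lt.
- left; apply: (ldiv_pieces hdec) => i id pi.
  by rewrite ltn_divLR // mulnC side_neg_gt.
suff H s : s != 0 -> side d p s ->
    (forall i, (i <= d)%N -> p i != 0 -> (n * i)%N != d) -> f_unstable f.
  case=> [/(pieces_ge nK fd hp hdec) hi|/(pieces_lt nK fd hp hdec ceil_div_le) hi].
    have {}hi i : (i <= d)%N -> p i != 0 -> (d < n * i)%N.
      by move=> id pi; rewrite mulnC -ltn_divLR //; apply: hi.
    apply: (H (-1)) => // i id pi; have lt := hi i id pi; last by rewrite neq_ltn lt orbT.
    by rewrite mulN1r opprB subr_ge0 -PoszM lez_nat ltnW.
  have {}hi i : (i <= d)%N -> p i != 0 -> (n * i < d)%N.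
    by move=> id pi; rewrite -lt_ceil_div; apply: hi.
  apply: (H 1) => // i id pi; have lt := hi i id pi; last by rewrite neq_ltn lt.
  by rewrite mul1r subr_ge0 -PoszM lez_nat ltnW.
move=> s0 hs hne; have := side_closure nK fd hp hdec s0 hs.
by rewrite (mid_eq0 hne).
Qed.

Lemma not_polystable_side : ~ f_polystable f ->
  ~ sl_orbit f (mid d p) /\ exists2 s : int, s = 1 \/ s = -1 & side d p s.
Proof.
move=> npf.
have [g [cg ng]] : exists g, zclosure (sl_orbit f) g /\ ~ sl_orbit f g.
  apply: boolp.contrapT => hn; apply: npf; split=> // g cg.
  by apply: boolp.contrapT => ng; apply: hn; exists g.
(* Otherwise [f] would lie in the closure of the orbit of [g], and the two orbits would coincide. *)
have [F [pF hF Ff]] : exists F, [/\ polyfun F, forall h, sl_orbit g h -> F h = 0 & F f != 0].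
  apply: boolp.contrapT => hn; apply: ng; apply: orbit_closure_antisym fd cg _ => F pF hF.
  by apply/eqP; apply: contraT => Ff; case: hn; exists F.
(* The product of [F] with its translate by a transposition vanishes on every [act B g] with
   [\det B = 1] or [-1], whence the invariance under odd permutations needed above. *)
pose s0 : 'M[K]_n := perm_mx (tperm ord0 (lift ord0 ord0)).
have ds0 : \det s0 = -1 by rewrite det_perm odd_tperm.
have fs0 : act s0 f = f by rewrite act_perm; have /issymP -> := fsym.
pose G h := F h * F (act s0 h).
have pG : polyfun G := polyfunM pF (polyfun_act s0 pF).
have hG (B : 'M[K]_n) : \det B ^+ 2 = 1 -> G (act B g) = 0.
  move=> /sqr_eq1P []dB; rewrite /G.
    by rewrite hF ?mul0r //; apply: sl_orbit_act.
  rewrite act_comp mulrC hF ?mul0r //; apply: sl_orbit_act.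
  by rewrite det_mulmx dB ds0 mulN1r opprK.
have Gf : G f != 0 by rewrite /G fs0 mulf_neq0.
have [|s s1 [hs hm]] := closure_side pG cg hG.
  by exists f => //; apply: sl_orbit_refl.
split; last by exists s.
move=> /sl_orbit_sym/sl_orbitP [A [dA fA]]; move/eqP: Gf; apply.
by rewrite fA hm.
Qed.

Lemma not_polystableP : ~ f_unstable f ->
  (~ f_polystable f <->
     [/\ (n %| d)%N,
         ~ sl_orbit f (lform K n ^+ (d %/ n) * p (d %/ n)%N)
       & ldiv (d %/ n) f \/ f = \sum_(i < (d %/ n).+1) lform K n ^+ i * p i]).
Proof.
move=> nu; have le : ((d %/ n).+1 <= d.+1)%N by rewrite ltnS leq_div.
split=> [/not_polystable_side [nm [s s1 hs]]|[nd nm hd] [_ hcl]].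
  have s0 : s != 0 by case: s1 => ->.
  (* If [n] did not divide [d], the limit [mid] would be 0 and [f] unstable. *)
  have nd : (n %| d)%N.
    apply: contraT => nd; case: nu; have := side_closure nK fd hp hdec s0 hs.
    by rewrite /mid (negPf nd).
  split=> //; first by move: nm; rewrite /mid nd.
  case: s1 hs => -> hs; [right; apply: (truncate_pieces hdec le)|left; apply: (ldiv_pieces hdec)];
      move=> i id pi; have := hs i id pi.
    by rewrite mul1r subr_ge0 -PoszM lez_nat ltnS leq_divRL // mulnC.
  rewrite mulN1r opprB subr_ge0 -PoszM lez_nat => di.
  by rewrite -(leq_pmul2l (ltn0Sn n'.+1)) mulnC divnK.
have [s s0 hs] : exists2 s : int, s != 0 & side d p s.
  case: hd => [/(pieces_ge nK fd hp hdec) hi|/(pieces_lt nK fd hp hdec le) hi].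
    exists (-1) => // i id pi; rewrite mulN1r opprB subr_ge0 -PoszM lez_nat.
    by rewrite -[leqLHS](divnK nd) mulnC leq_pmul2l // hi.
  exists 1 => // i id pi; rewrite mul1r subr_ge0 -PoszM lez_nat.
  by rewrite mulnC -leq_divRL // -ltnS hi.
apply: nm; have := hcl _ (side_closure nK fd hp hdec s0 hs).
by rewrite /mid nd.
Qed.

End Side.

Theorem theorem8p8 (K : closedFieldType) (n d : nat)
  (hn : (2 <= n)%N)
  (hchar : forall p : nat, p \in [pchar K] -> ~~ (p %| n)%N)
  (f : {mpoly K[n]}) (p : nat -> {mpoly K[n]})
  (hf0 : f != 0)
  (hfd : f \is d.-homog)
  (hfsym : f \is symmetric)
  (hp : forall i : nat, (i <= d)%N ->
          exists q : {mpoly K[n.-1]}, q \is (d - i)%N.-homog /\ p i = q \mPo bvec K n)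
  (hdec : f = \sum_(i < d.+1) lform K n ^+ i * p i) :
  (f_unstable f <->
     (ldiv (d %/ n).+1 f \/ f = \sum_(i < ceil_div d n) lform K n ^+ i * p i))
  /\
  (~ f_unstable f ->
     (~ f_polystable f <->
        [/\ (n %| d)%N,
            ~ (sl_orbit f (lform K n ^+ (d %/ n) * p (d %/ n)%N))
          & (ldiv (d %/ n) f \/ f = \sum_(i < (d %/ n).+1) lform K n ^+ i * p i)])).
Proof.
case: n hn hchar f p hf0 hfd hfsym hp hdec => [//|[//|n']] _ hchar f p f0 fd fsym hp hdec.
have nK : n'.+2%:R != 0 :> K.
  apply/negP => n0; have [//|q qK] := natf0_pchar _ n0.
  by have := hchar q qK; rewrite (dvdn_pcharf qK) n0.
by split; [apply: unstableP|apply: not_polystableP].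
Qed.
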